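(* Let $p\ge 1$ be a fixed integer and let $\{\mathbf y_t\}$ be a mean-zero $p$-dimensional process satisfying $$\mathbf y_t=D(\boldsymbol\lambda_0)\mathbf W\mathbf y_t+D(\boldsymbol\lambda_1)\mathbf y_{t-1}+D(\boldsymbol\lambda_2)\mathbf W\mathbf y_{t-1}+\boldsymbol\varepsilon_t .$$ Assume the following, for every $i=1,\dots,p$ where $i$ appears. (A1) $\mathbf W$ is a known $p\times p$ matrix with zero main diagonal, and $\mathbf S(\boldsymbol\lambda_0)=\mathbf I-D(\boldsymbol\lambda_0)\mathbf W$ is invertible. (A2) (a) $\mathrm{Cov}(\mathbf y_{t-1},\boldsymbol\varepsilon_t)=0$. (b) $\{\mathbf y_t\}$ is strictly stationary and $\alpha$-mixing with mixing coefficients satisfying $\sum_{k=1}^\infty\alpha(k)^{\gamma/(4+\gamma)}<\infty$ for some constant $\gamma>0$. (c) For this $\gamma$, the moments $\mathrm E|\mathbf w_i^T\boldsymbol\Sigma_0\mathbf y_t|^{4+\gamma}$, $\mathrm E|\mathbf w_i^T\boldsymbol\Sigma_1\mathbf y_t|^{4+\gamma}$, $\mathrm E|\mathbf e_i^T\boldsymbol\Sigma_0\mathbf y_t|^{4+\gamma}$, $\mathrm E|\mathbf w_i^T\mathbf y_t|^{4+\gamma}$, $\mathrm E|\mathbf e_i^T\mathbf y_t|^{4+\gamma}$ are finite, and the diagonal elements of $\mathbf V_i$ are finite. (A3) The $p\times 3$ matrix $(\boldsymbol\Sigma_1^T\mathbf w_i,\boldsymbol\Sigma_0\mathbf e_i,\boldsymbol\Sigma_0\mathbf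 w_i)$ has rank $3$. Then, as $n\to\infty$, for each $i=1,\dots,p$, $$\sqrt n\left(\begin{pmatrix}\hat\lambda_{0i}\\ \hat\lambda_{1i}\\ \hat\lambda_{2i}\end{pmatrix}-\begin{pmatrix}\lambda_{0i}\\ \lambda_{1i}\\ \lambda_{2i}\end{pmatrix}\right)\xrightarrow{d}N(0,\mathbf V_i^{-1}\mathbf U_i\mathbf V_i^{-1}).$$
   Context: Notation: $\mathbf y_t=(y_{1,t},\dots,y_{p,t})^T$, $\boldsymbol\varepsilon_t=(\varepsilon_{1,t},\dots,\varepsilon_{p,t})^T$, $D(\boldsymbol\lambda_k)=\mathrm{diag}(\lambda_{k1},\dots,\lambda_{kp})$ for $k=0,1,2$, where the $\lambda_{ki}$ are unknown real parameters. $\mathbf w_i^T$ is the $i$-th row of $\mathbf W$ (with $\mathbf w_i$ a column vector), and $\mathbf e_i$ is the $i$-th unit vector. $\mathrm E\,\mathbf y_t=\mathbf 0$. $\boldsymbol\Sigma_k=\mathrm{Cov}(\mathbf y_{t+k},\mathbf y_t)$ for $k\ge0$. Mixing: $\alpha(k)=\sup_{A\in\mathcal F_{-\infty}^0,\,B\in\mathcal F_k^\infty}|P(A)P(B)-P(AB)|$, where $\mathcal F_a^b$ is the $\sigma$-algebra generated by $\{\mathbf y_t: a\le t\le b\}$; $\alpha$-mixing means $\alpha(k)\to0$ as $k\to\infty$. Estimator (generalized Yule-Walker), based on observations $\mathbf y_0,\dots,\mathbf y_n$: $$(\hat\lambda_{0i},\hat\lambda_{1i},\hat\lambda_{2i})^T=(\hat{\mathbf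 X}_i^T\hat{\mathbf X}_i)^{-1}\hat{\mathbf X}_i^T\hat{\mathbf Y}_i,$$ $$\hat{\mathbf X}_i=\Big(\tfrac1n\sum_{t=1}^n\mathbf y_{t-1}(\mathbf w_i^T\mathbf y_t),\ \tfrac1n\sum_{t=1}^n\mathbf y_{t-1}y_{i,t-1},\ \tfrac1n\sum_{t=1}^n\mathbf y_{t-1}(\mathbf w_i^T\mathbf y_{t-1})\Big),\qquad \hat{\mathbf Y}_i=\tfrac1n\sum_{t=1}^n\mathbf y_{t-1}y_{i,t}.$$ Matrices: let $\mathbf X_i=(\boldsymbol\Sigma_1^T\mathbf w_i,\boldsymbol\Sigma_0\mathbf e_i,\boldsymbol\Sigma_0\mathbf w_i)$ ($p\times3$). Let $\boldsymbol\Sigma_{\mathbf y,\varepsilon_i}(j)=\mathrm{Cov}(\mathbf y_{t-1+j}\varepsilon_{i,t+j},\mathbf y_{t-1}\varepsilon_{i,t})$ for $j\ge0$ and $\boldsymbol\Sigma_{\mathbf y,\varepsilon_i}=\boldsymbol\Sigma_{\mathbf y,\varepsilon_i}(0)+\sum_{j=1}^\infty[\boldsymbol\Sigma_{\mathbf y,\varepsilon_i}(j)+\boldsymbol\Sigma_{\mathbf y,\varepsilon_i}^T(j)]$. Then $\mathbf V_i=\mathbf X_i^T\mathbf X_i$ (with diagonal entries $\mathbf w_i^T\boldsymbol\Sigma_1\boldsymbol\Sigma_1^T\mathbf w_i$, $\mathbf e_i^T\boldsymbol\Sigma_0\boldsymbol\Sigma_0\mathbf e_i$, $\mathbf w_i^T\boldsymbol\Sigma_0\boldsymbol\Sigma_0\mathbf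 w_i$) and $\mathbf U_i=\mathbf X_i^T\boldsymbol\Sigma_{\mathbf y,\varepsilon_i}\mathbf X_i$, both $3\times3$. *)

(* Defs.v *)
From HB Require Import structures.
From mathcomp Require Import all_boot all_order all_algebra.
From mathcomp Require Import all_classical all_reals all_analysis.

Set Implicit Arguments.
Unset Strict Implicit.
Unset Printing Implicit Defensive.

Import Order.TTheory GRing.Theory Num.Theory.
Import numFieldNormedType.Exports.

Local Open Scope classical_set_scope.
Local Open Scope ring_scope.

Notation borelM R m n := (g_sigma_algebraType (@open 'M[R]_(m, n))).

Section Vectors.
Context {R : realType}.

Definition dotv {p} (u v : 'cV[R]_p) : R := (u^T *m v) 0 0.

Definition wrow {p} (W : 'M[R]_p) (i : 'I_p) : 'cV[R]_p := (row i W)^T.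

Definition unitv {p} (i : 'I_p) : 'cV[R]_p := delta_mx i 0.

Definition cols3 {p} (u v w : 'cV[R]_p) : 'M[R]_(p, 3) :=
  \matrix_(k < p, c < 3) [:: u k 0; v k 0; w k 0]`_c.

Definition col3 (a b c : R) : 'cV[R]_3 := \col_(k < 3) [:: a; b; c]`_k.

End Vectors.

Section Normal.
Context {R : realType}.

(* [normal_prob m 0] is a junk value in the library, hence the case split. *)
Definition normal1 (m v : R) : set R -> \bar R :=
  if v == 0 then \d_m else normal_prob m (Num.sqrt v).

(* mu = N(m, S), with S possibly singular: every linear combination of the
   coordinates is a (possibly degenerate) univariate normal. *)
Definition is_mvnormal {k} (mu : probability (borelM R k 1) R)
    (m : 'cV[R]_k) (S : 'M[R]_k) : Prop :=
  [/\ S^T = S,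
      forall a : 'cV[R]_k, 0 <= dotv a (S *m a) &
      forall (a : 'cV[R]_k) (B : set R), measurable B ->
        mu [set x | B (dotv a x)] = normal1 (dotv a m) (dotv a (S *m a)) B].

Definition cvg_in_distribution {d : measure_display} {T : measurableType d}
    (P : probability T R) {k} (X : nat -> T -> 'cV[R]_k)
    (mu : probability (borelM R k 1) R) : Prop :=
  forall f : 'cV[R]_k -> R, continuous f ->
    (exists M : R, forall x, `|f x| <= M) ->
    ('E_P[fun w => f (X n w)] @[n --> \oo] --> \int[mu]_x (f x)%:E)%E.

End Normal.

Section Process.
Context {d : measure_display} {T : measurableType d} {R : realType}.
Variable P : probability T R.

(* Cov(X, Y) has extended-real entries in the library; [covmx] is its real form. *)
Definition ecovmx {p} (X Y : T -> 'cV[R]_p) (a b : 'I_p) : \bar R :=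
  covariance P (fun w => X w a 0) (fun w => Y w b 0).

Definition covmx {p} (X Y : T -> 'cV[R]_p) : 'M[R]_p :=
  \matrix_(a, b) fine (ecovmx X Y a b).

Section OneProcess.
Context {p : nat}.
Variable y : int -> T -> 'cV[R]_p.

Definition strictly_stationary : Prop :=
  forall (m : nat) (s : 'I_m -> int) (h : int) (B : set (borelM R p m)),
    measurable B ->
    P [set w | B (\matrix_(i, j) y (s j + h) w i 0)] =
    P [set w | B (\matrix_(i, j) y (s j) w i 0)].

Definition gen_sigma (D : set int) : set (set T) :=
  <<s [set A | exists2 t, D t &
         exists2 B : set (borelM R p 1), measurable B & A = y t @^-1` B] >>.

Definition alpha (k : nat) : R :=
  sup [set x | exists A B,
    [/\ gen_sigma [set t | t <= 0] A, gen_sigma [set t | k%:Z <= t] B &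
        x = `|fine (P A) * fine (P B) - fine (P (A `&` B))|]].

(* Cov(y_{t+k}, y_t), which does not depend on t under stationarity. *)
Definition Sigma (k : nat) : 'M[R]_p := covmx (y k%:Z) (y 0).

Variable W : 'M[R]_p.

Definition Xmx (i : 'I_p) : 'M[R]_(p, 3) :=
  cols3 ((Sigma 1)^T *m wrow W i) (Sigma 0 *m unitv i) (Sigma 0 *m wrow W i).

Definition Vmx (i : 'I_p) : 'M[R]_3 := (Xmx i)^T *m Xmx i.

(* The c-th diagonal entry of [Vmx i] computed in the extended reals: the real
   matrix [Vmx i] cannot express that this entry is finite. *)
Definition Vdiag (i : 'I_p) (c : 'I_3) : \bar R :=
  let X (k : 'I_p) : \bar R := nth 0%E
    [:: (\sum_(l < p) ecovmx (y 1) (y 0) l k * (W i l)%:E)%E;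
        ecovmx (y 0) (y 0) k i;
        (\sum_(l < p) ecovmx (y 0) (y 0) k l * (W i l)%:E)%E] c in
  (\sum_(k < p) X k * X k)%E.

Variable eps : int -> T -> 'cV[R]_p.

(* Cov(y_{t-1+j} eps_{i,t+j}, y_{t-1} eps_{i,t}) at t = 1. *)
Definition Sigma_yeps_lag (i : 'I_p) (j : nat) : 'M[R]_p :=
  covmx (fun w => eps (j%:Z + 1) w i 0 *: y j%:Z w)
        (fun w => eps 1 w i 0 *: y 0 w).

Definition Sigma_yeps (i : 'I_p) : 'M[R]_p :=
  Sigma_yeps_lag i 0 +
  \matrix_(a, b) limn (fun m : nat =>
    \sum_(1 <= j < m) (Sigma_yeps_lag i j + (Sigma_yeps_lag i j)^T) a b).

Definition Umx (i : 'I_p) : 'M[R]_3 :=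
  (Xmx i)^T *m Sigma_yeps i *m Xmx i.

End OneProcess.
End Process.

Section Estimator.
Context {R : realType} {T : Type} {p : nat}.
Variables (y : int -> T -> 'cV[R]_p) (W : 'M[R]_p) (i : 'I_p).
Variables (n : nat) (w : T).

Definition lagavg (g : int -> R) : 'cV[R]_p :=
  n%:R^-1 *: \sum_(1 <= t < n.+1) g t%:Z *: y (t%:Z - 1) w.

Definition Xhat : 'M[R]_(p, 3) :=
  cols3 (lagavg (fun t => dotv (wrow W i) (y t w)))
        (lagavg (fun t => y (t - 1) w i 0))
        (lagavg (fun t => dotv (wrow W i) (y (t - 1) w))).

Definition Yhat : 'cV[R]_p := lagavg (fun t => y t w i 0).

(* [invmx] is the identity on singular matrices, so this is total. *)
Definition lambda_hat : 'cV[R]_3 :=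
  invmx (Xhat^T *m Xhat) *m Xhat^T *m Yhat.

End Estimator.

(* Main.v *)
(* Let Z_t = y_t eps_(i,t+1) and S_n = n^(-1/2) sum_(t<n) Z_t. The normal
   equations give sqrt n (lambda_hat - lambda) = H(Xhat) S_n, where
   H(M) = (M^T M)^-1 M^T, as soon as Xhat^T Xhat is invertible. Xhat tends to X
   in mean square and H is continuous at X, so everything reduces to a central
   limit theorem for the linear forms <a, S_n>.

   Laws are handled through E cos(u .) and E sin(u .). Davydov's inequality makes
   the autocovariances of <a, Z_t> summable, and since the mixing coefficients
   decrease and are summable, n alpha(n) -> 0. After truncation, the sum is cut
   into blocks of length of order sqrt n separated by shorter gaps; mixing
   decouples the blocks and a second-order expansion on each of them gives
   |E cos(u S) - exp(- u^2 E S^2 / 2)| -> 0, without a Lindeberg condition.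

   To return to continuous bounded test functions, these are approximated on boxes
   by trigonometric polynomials: a Bernstein operator in the variables
   sin(x_j / L). The limit law is the image of independent normals under a square
   root of the covariance matrix; its transform comes from comparing a normal
   density with its translates (Stein's identity). *)
Require Import Defs.
From HB Require Import structures.
From mathcomp Require Import all_boot all_order all_algebra.
From mathcomp Require Import all_classical all_reals all_analysis.
From mathcomp Require Import measurable_realfun ring lra zify.

Set Implicit Arguments.
Unset Strict Implicit.
Unset Printing Implicit Defensive.

Import Order.TTheory GRing.Theory Num.Theory.
Import numFieldNormedType.Exports.

Local Open Scope classical_set_scope.
Local Open Scope ring_scope.

(** Mixing and stationarity concern [y] only, so the noise is replaced by the residual, a function
    of [y_t] and [y_(t+1)] equal to it almost everywhere. Everything then becomes a statement about
    functions of two-column windows of [y]. A product of two observations has a moment of order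
    [s = (4 + gamma) / 2], and Davydov's exponent [1 - 2 / s] is exactly [gamma / (4 + gamma)].

    The block sizes involve an auxiliary integer [a]: gaps have length [q] close to sqrt n / a^2 and
    blocks length a q, so there are about a sqrt n blocks. Decoupling them costs at most a multiple
    of a^3 q alpha(q), whence the use of n alpha(n) -> 0. The gaps carry a share 1/a of the
    variance, and the third-order terms add up to block length / sqrt n, again 1/a. Hence [a] is
    fixed first and n grows afterwards.

    Each partial sum is compared with the Gaussian having its exact second moment. No lower bound on
    the variance is required and the limit may be degenerate; the long-run variance enters only at
    the end, as a Cesaro limit. *)

Lemma ex_natSinv_lt {R : realType} (e : R) : 0 < e -> exists N, N.+1%:R^-1 < e.
Proof.
move=> e0; have [N _ NE] := near_infty_natSinv_lt (PosNum e0).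
by exists N; exact: NE N (leqnn N).
Qed.

Lemma dist_le_below {R : realType} (a b e : R) : 0 <= e -> a - e <= b -> b <= a -> `|a - b| <= e.
Proof. by move=> e0 h1 h2; rewrite ger0_norm ?subr_ge0//; lra. Qed.

(** * Real expectations *)

Section RealExpectation.
Context {d : measure_display} {T : measurableType d} {R : realType}.
Variable P : probability T R.
Implicit Types f g : T -> R.

Definition Ex f : R := \int[P]_w f w.
Definition L1 f : Prop := P.-integrable setT (EFin \o f).

Lemma L1_meas f : L1 f -> measurable_fun setT f.
Proof. by move/measurable_int/measurable_EFinP. Qed.

Lemma L1_bdd f (M : R) : measurable_fun setT f -> (forall w, `|f w| <= M) -> L1 f.
Proof.
move=> mf fM; apply: measurable_bounded_integrable => //.
  by rewrite (le_lt_trans (probability_le1 _ _))// ltry.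
exists M; split; first exact: num_real.
by move=> x Mx w _; rewrite /= (le_trans (fM w))// ltW.
Qed.

Lemma L1_dom f g : measurable_fun setT f -> (forall w, `|f w| <= g w) -> L1 g -> L1 f.
Proof.
move=> mf fg; apply: le_integrable => //; first exact/measurable_EFinP.
by move=> w _ /=; rewrite lee_fin (le_trans (fg w))// ler_norm.
Qed.

Lemma eq_L1 f g : L1 f -> f =1 g -> L1 g.
Proof. by move=> lf /funext <-. Qed.

Lemma L1_cst c : L1 (cst c).
Proof. exact: finite_measure_integrable_cst. Qed.

Lemma L1D f g : L1 f -> L1 g -> L1 (fun w => f w + g w).
Proof. by move=> lf lg; apply: eq_integrable (integrableD _ lf lg). Qed.

Lemma L1N f : L1 f -> L1 (fun w => - f w).
Proof. by move=> lf; apply: eq_integrable (integrableN lf). Qed.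

Lemma L1B f g : L1 f -> L1 g -> L1 (fun w => f w - g w).
Proof. by move=> lf lg; exact/L1D/L1N. Qed.

Lemma L1Z c f : L1 f -> L1 (fun w => c * f w).
Proof. by move=> lf; apply: eq_integrable (integrableZl _ c lf). Qed.

Lemma L1_norm f : L1 f -> L1 (fun w => `|f w|).
Proof. exact: integrable_norm. Qed.

Lemma L1_sum (I : Type) (s : seq I) (Q : pred I) (F : I -> T -> R) :
  (forall i, Q i -> L1 (F i)) -> L1 (fun w => \sum_(i <- s | Q i) F i w).
Proof.
move=> LF; elim: s => [|i s IH].
  by apply: eq_integrable (L1_cst 0) => // w _; rewrite /= big_nil.
case Qi: (Q i).
  by apply: eq_integrable (L1D (LF _ Qi) IH) => // w _; rewrite /= big_cons Qi.
by apply: eq_integrable IH => // w _; rewrite /= big_cons Qi.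
Qed.

Lemma L1_bddM f g (M : R) : measurable_fun setT f -> (forall w, `|f w| <= M) ->
  L1 g -> L1 (fun w => f w * g w).
Proof.
move=> mf fM lg; apply: L1_dom (L1Z M (L1_norm lg)).
  exact: measurable_funM (L1_meas lg).
by move=> w; rewrite normrM ler_wpM2r.
Qed.

Lemma L1_sqM f g : measurable_fun setT f -> measurable_fun setT g ->
  L1 (fun w => f w ^+ 2) -> L1 (fun w => g w ^+ 2) -> L1 (fun w => f w * g w).
Proof.
move=> mf mg lf lg; apply: L1_dom (L1D lf lg); first exact: measurable_funM.
move=> w; rewrite ler_norml; move: (f w) (g w) => a b.
by have := sqr_ge0 (a + b); have := sqr_ge0 (a - b); rewrite !expr2 => ? ?; apply/andP; split; nra.
Qed.

Lemma L1_sq f : measurable_fun setT f -> L1 (fun w => f w ^+ 2) -> L1 f.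
Proof.
move=> mf lf; apply: L1_dom (L1D (L1_cst 1) lf) => //.
move=> w /=; rewrite ler_norml; move: (f w) => a.
by have := sqr_ge0 (a + 1); have := sqr_ge0 (a - 1); rewrite !expr2 => ? ?; apply/andP; split; nra.
Qed.

Lemma L1_sqD f g : measurable_fun setT f -> measurable_fun setT g ->
  L1 (fun w => f w ^+ 2) -> L1 (fun w => g w ^+ 2) ->
  L1 (fun w => (f w + g w) ^+ 2).
Proof.
move=> mf mg lf lg; apply: L1_dom (L1D (L1Z 2 lf) (L1Z 2 lg)).
  exact/measurable_funX/measurable_funD.
move=> w; rewrite ger0_norm ?sqr_ge0//; have := sqr_ge0 (f w - g w).
by rewrite !expr2; nra.
Qed.

Lemma eq_Ex f g : f =1 g -> Ex f = Ex g.
Proof. by move=> fg; congr Ex; apply/funext. Qed.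

Lemma Ex_cst c : Ex (fun=> c) = c.
Proof. by rewrite /Ex Rintegral_cst//= probability_setT mulr1. Qed.

Lemma ExD f g : L1 f -> L1 g -> Ex (fun w => f w + g w) = Ex f + Ex g.
Proof. exact: RintegralD. Qed.

Lemma ExB f g : L1 f -> L1 g -> Ex (fun w => f w - g w) = Ex f - Ex g.
Proof. exact: RintegralB. Qed.

Lemma ExZ c f : L1 f -> Ex (fun w => c * f w) = c * Ex f.
Proof. exact: RintegralZl. Qed.

Lemma Ex_sum (I : Type) (s : seq I) (Q : pred I) (F : I -> T -> R) :
  (forall i, Q i -> L1 (F i)) ->
  Ex (fun w => \sum_(i <- s | Q i) F i w) = \sum_(i <- s | Q i) Ex (F i).
Proof.
move=> LF; elim: s => [|i s IH].
  by under eq_Ex do rewrite big_nil; rewrite big_nil Ex_cst.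
rewrite big_cons -IH; under eq_Ex do rewrite big_cons.
by case: ifP => // Qi; rewrite ExD//; [exact: LF | exact: L1_sum].
Qed.

Lemma Ex_le f g : L1 f -> L1 g -> (forall w, f w <= g w) -> Ex f <= Ex g.
Proof. by move=> lf lg fg; apply: le_Rintegral. Qed.

Lemma Ex_ge0 f : (forall w, 0 <= f w) -> 0 <= Ex f.
Proof. by move=> f0; apply: Rintegral_ge0. Qed.

Lemma Ex_abs f : L1 f -> `|Ex f| <= Ex (fun w => `|f w|).
Proof. exact: le_normr_Rintegral. Qed.

Lemma Ex_abs_le f g : measurable_fun setT f -> L1 g ->
  (forall w, `|f w| <= g w) -> `|Ex f| <= Ex g.
Proof.
move=> mf lg fg; have lf := L1_dom mf fg lg.
by apply: (le_trans (Ex_abs lf)); apply: Ex_le => //; exact: L1_norm.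
Qed.

Lemma Ex_bdd f M : measurable_fun setT f -> (forall w, `|f w| <= M) -> `|Ex f| <= M.
Proof.
move=> mf fM; rewrite -[leRHS](Ex_cst M); apply: Ex_abs_le => //.
exact: L1_cst.
Qed.

Lemma Ex_jensen2 f : measurable_fun setT f -> L1 (fun w => f w ^+ 2) ->
  (Ex f) ^+ 2 <= Ex (fun w => f w ^+ 2).
Proof.
move=> mf l2; have l1 := L1_sq mf l2; set m := Ex f.
have lin : L1 (fun w => 2 * m * f w - m ^+ 2) by apply: L1B; [exact: (L1Z (2 * m) l1)|exact: L1_cst].
have := Ex_le lin l2; rewrite (ExB (L1Z (2 * m) l1) (L1_cst (m ^+ 2))) (ExZ _ l1) (Ex_cst (m ^+ 2)).
rewrite -/m => H; apply: le_trans (H _); first by lra.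
by move=> w; have := sqr_ge0 (f w - m); rewrite !expr2; nra.
Qed.

Lemma Ex_indic (A : set T) : measurable A -> Ex (\1_A) = fine (P A).
Proof. by move=> mA; rewrite /Ex /Rintegral integral_indic// setIT. Qed.

Lemma L1_indic (A : set T) : measurable A -> L1 (\1_A).
Proof. by move=> mA; exact: integrable_indic. Qed.

Definition cov f g : R := Ex (fun w => f w * g w) - Ex f * Ex g.

Lemma covC f g : cov f g = cov g f.
Proof.
by rewrite /cov [X in _ - X]mulrC; congr (_ - _); apply: eq_Ex => w; rewrite mulrC.
Qed.

End RealExpectation.

Arguments L1_bdd {d T R P f} M.
Arguments L1_cst {d T R P} c.
Arguments L1_indic {d T R P A}.
Arguments eq_Ex {d T R P f} g.
Arguments Ex_cst {d T R P} c.
Arguments Ex_ge0 {d T R P f}.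
Arguments Ex_bdd {d T R P f} M.
Arguments Ex_indic {d T R P A}.
Arguments covC {d T R P f g}.

(** * Mixing coefficient of a pair of variables *)

Section Mixing.
Context {d : measure_display} {T : measurableType d} {R : realType}.
Variable P : probability T R.
Implicit Types U V : T -> R.

(* alpha(sigma(U), sigma(V)) <= b. *)
Definition amix (b : R) U V : Prop := forall C D : set R, measurable C -> measurable D ->
  `|fine (P (U @^-1` C `&` V @^-1` D)) - fine (P (U @^-1` C)) * fine (P (V @^-1` D))| <= b.

Lemma amix_comp b U V (f g : R -> R) : measurable_fun setT f -> measurable_fun setT g ->
  amix b U V -> amix b (f \o U) (g \o V).
Proof.
move=> mf mg UV C D mC mD; apply: (UV (f @^-1` C) (g @^-1` D)).
  by rewrite -[X in measurable X]setTI; exact: mf.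
by rewrite -[X in measurable X]setTI; exact: mg.
Qed.

Lemma amix_le b b' U V : b <= b' -> amix b U V -> amix b' U V.
Proof. by move=> bb UV C D mC mD; exact: le_trans (UV _ _ mC mD) bb. Qed.

(* The number of integers in [1, z]: averaged over levels j/N, it writes a
   [0,1]-valued function as a mean of indicators of its level sets, up to 1/N. *)
Lemma staircase (N : nat) (z : R) : 0 <= z <= N%:R ->
  z - 1 <= \sum_(j < N) (if j.+1%:R <= z then 1 else 0) <= z.
Proof.
elim: N => [|N IH] /andP[z0 zN]; first by rewrite big_ord0; apply/andP; split; lra.
rewrite big_ord_recr/=; have [zle|zgt] := leP z N%:R.
  have -> : (N.+1%:R <= z) = false.
    by apply/negbTE; rewrite -ltNge (le_lt_trans zle)// ltr_nat.
  by rewrite addr0 IH// z0.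
have -> : \sum_(i < N) (if i.+1%:R <= z then 1 else 0) = N%:R :> R.
  rewrite (eq_bigr (fun=> 1)) => [|i _]; first by rewrite sumr_const card_ord.
  by rewrite ifT// (le_trans _ (ltW zgt))// ler_nat.
by move: zN; rewrite -natr1 => zN; case: ifPn; rewrite -?ltNge => h; apply/andP; split; lra.
Qed.

(** The covariance of two staircase approximations is an average of differences P(A and B) - P(A)
    P(B) over pairs of level sets, each at most [b]; so no constant is lost. *)
Lemma cov_unit b U V : measurable_fun setT U -> measurable_fun setT V ->
  (forall w, 0 <= U w <= 1) -> (forall w, 0 <= V w <= 1) ->
  amix b U V -> `|cov P U V| <= b.
Proof.
move=> mU mV U01 V01 UV.
have mI (W : T -> R) (mW : measurable_fun setT W) (c : R) :
    measurable (W @^-1` `[c, +oo[) by rewrite -[X in measurable X]setTI; exact: mW.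
(* Of the four errors 1/(N+1), two come from the product U V and one from each of the two means. *)
suff key N : `|cov P U V| <= b + 4 * N.+1%:R^-1.
  apply/ler_addgt0Pr => e e0.
  have e40 : 0 < e / 4 by rewrite divr_gt0.
  have [N NE] := ex_natSinv_lt e40.
  apply: (le_trans (key N)); rewrite lerD2l; move: NE.
  by rewrite ltr_pdivlMr// mulrC => /ltW.
have bnd (W : T -> R) : (forall w, 0 <= W w <= 1) -> forall w, `|W w| <= 1.
  by move=> W01 w; have := W01 w; rewrite ler_norml => /andP[? ?]; apply/andP; split; lra.
pose st (W : T -> R) (w : T) := N.+1%:R^-1 * \sum_(j < N.+1) \1_(W @^-1` `[j.+1%:R / N.+1%:R, +oo[) w : R.
have n0 : 0 < N.+1%:R :> R by rewrite ltr0n.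
have stE (W : T -> R) w : (forall w, 0 <= W w <= 1) -> W w - N.+1%:R^-1 <= st W w <= W w.
  move=> W01; have [W0 W1] := andP (W01 w); rewrite /st.
  have /staircase : 0 <= N.+1%:R * W w <= N.+1%:R.
    by rewrite mulr_ge0//= ger_pMr.
  rewrite (eq_bigr (fun j : 'I_N.+1 => \1_(W @^-1` `[j.+1%:R / N.+1%:R, +oo[) w)); last first.
    move=> j _; rewrite indicE.
    suff -> : (j.+1%:R <= N.+1%:R * W w) = (w \in W @^-1` `[j.+1%:R / N.+1%:R, +oo[) by case: ifP.
    apply/idP/idP => [h|].
      by apply/mem_set; rewrite /= in_itv/= andbT ler_pdivrMr// mulrC.
    by move/set_mem; rewrite /= in_itv/= andbT ler_pdivrMr// mulrC.
  move=> /andP[h1 h2].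
  rewrite -(ler_pM2l n0) -[X in _ && X](ler_pM2l n0) mulrA divff ?gt_eqF// mul1r.
  by rewrite mulrBr divff ?gt_eqF// h1.
have mst (W : T -> R) : measurable_fun setT W -> measurable_fun setT (st W).
  move=> mW; apply: measurable_funM => //; apply: measurable_sum => j.
  exact/measurable_indic/mI.
have st1 (W : T -> R) w : (forall w, 0 <= W w <= 1) -> `|st W w| <= 1.
  move=> W01; have /andP[_ h] := stE W w W01; have /andP[_ h2] := W01 w.
  rewrite ger0_norm ?(le_trans h)// /st mulr_ge0 ?invr_ge0// sumr_ge0// => j _.
have LU : L1 P U by apply: (L1_bdd _ mU (bnd _ U01)).
have LV : L1 P V by apply: (L1_bdd _ mV (bnd _ V01)).
have LsU : L1 P (st U) by apply: (L1_bdd _ (mst _ mU)) => w; exact: st1.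
have LsV : L1 P (st V) by apply: (L1_bdd _ (mst _ mV)) => w; exact: st1.
have LUV : L1 P (fun w => U w * V w) by apply: (L1_bddM mU (bnd _ U01)).
have LsUV : L1 P (fun w => st U w * st V w).
  by apply: (L1_bddM (mst _ mU) (fun w => st1 _ w U01)).
have stcov : `|cov P (st U) (st V)| <= b.
  pose A j := U @^-1` `[j.+1%:R / N.+1%:R, +oo[.
  pose B j := V @^-1` `[j.+1%:R / N.+1%:R, +oo[.
  have EsumA (F : nat -> set T) : (forall j, measurable (F j)) ->
     Ex P (fun w => N.+1%:R^-1 * \sum_(j < N.+1) \1_(F j) w) =
     N.+1%:R^-1 * \sum_(j < N.+1) fine (P (F j)).
    move=> mF; rewrite ExZ; last by apply: L1_sum => j _; exact: L1_indic.
    rewrite Ex_sum; last by move=> j _; exact: L1_indic.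
    by congr (_ * _); apply: eq_bigr => j _; rewrite Ex_indic.
  have -> : cov P (st U) (st V) = N.+1%:R^-1 * (N.+1%:R^-1 *
     \sum_(j < N.+1) \sum_(k < N.+1) (fine (P (A j `&` B k)) - fine (P (A j)) * fine (P (B k)))).
    rewrite /cov (EsumA A) ?(EsumA B); try by move=> j; exact: mI.
    have -> : Ex P (fun w => st U w * st V w) = N.+1%:R^-1 * (N.+1%:R^-1 *
         \sum_(j < N.+1) \sum_(k < N.+1) fine (P (A j `&` B k))).
      rewrite (eq_Ex (fun w => N.+1%:R^-1 * \sum_(j < N.+1) (N.+1%:R^-1 *
         \sum_(k < N.+1) \1_(A j `&` B k) w))); last first.
        move=> w; rewrite /st mulrCA -mulrA; congr (_ * _).
        rewrite mulr_suml mulr_sumr; apply: eq_bigr => j _; rewrite mulr_sumr; congr (_ * _).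
        by apply: eq_bigr => k _; rewrite indicI.
      have LI j k : L1 P (\1_(A j `&` B k)).
        by apply/L1_indic/measurableI; exact: mI.
      rewrite ExZ; last by apply: L1_sum => j _; apply: L1Z; apply: L1_sum => k _; exact: LI.
      rewrite Ex_sum; last by move=> j _; apply: L1Z; apply: L1_sum => k _; exact: LI.
      congr (_ * _); rewrite mulr_sumr; apply: eq_bigr => j _.
      rewrite ExZ; last by apply: L1_sum => k _; exact: LI.
      rewrite Ex_sum; last by move=> k _; exact: LI.
      congr (_ * _); apply: eq_bigr => k _; rewrite Ex_indic//.
      by apply: measurableI; exact: mI.
    have -> : forall x y z : R, x * y * (x * z) = x * (x * (y * z)) by move=> *; ring.
    rewrite -mulrBr -mulrBr; congr (_ * (_ * _)).
    rewrite mulr_suml -sumrB; apply: eq_bigr => j _.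
    by rewrite mulr_sumr -sumrB.
  rewrite mulrA normrM ger0_norm ?mulr_ge0 ?invr_ge0//.
  rewrite mulrC -expr2 exprVn ler_pdivrMr ?exprn_gt0//.
  apply: (le_trans (ler_norm_sum _ _ _)).
  have -> : b * N.+1%:R ^+ 2 = \sum_(j < N.+1) \sum_(k < N.+1) b.
    by rewrite !sumr_const !card_ord expr2 mulrA !mulr_natr.
  apply: ler_sum => j _; apply: (le_trans (ler_norm_sum _ _ _)); apply: ler_sum => k _.
  by apply: UV.
clearbody st.
have near (W : T -> R) : measurable_fun setT W -> (forall w, 0 <= W w <= 1) -> `|Ex P W - Ex P (st W)| <= N.+1%:R^-1.
  move=> mW W01; rewrite -ExB; last 2 first.
  - exact: (L1_bdd _ mW (bnd _ W01)).
  - by apply: (L1_bdd _ (mst _ mW)) => w; exact: st1.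
  apply: Ex_bdd; first exact: measurable_funB mW (mst _ mW).
  by move=> w; have /andP[] := stE W w W01; apply: dist_le_below; rewrite invr_ge0.
have near2 : `|Ex P (fun w => U w * V w) - Ex P (fun w => st U w * st V w)| <= 2 * N.+1%:R^-1.
  rewrite -ExB//; apply: Ex_bdd.
    by apply: measurable_funB; apply: measurable_funM => //; exact: mst.
  move=> w; have -> : U w * V w - st U w * st V w = (U w - st U w) * V w + st U w * (V w - st V w) by ring.
  apply: (le_trans (ler_normD _ _)); rewrite !normrM mulrDl mul1r.
  have D (W : T -> R) : (forall w, 0 <= W w <= 1) -> `|W w - st W w| <= N.+1%:R^-1.
    by move=> W01; have /andP[] := stE W w W01; apply: dist_le_below; rewrite invr_ge0.
  apply: lerD.
    by rewrite -[leRHS]mulr1; apply: ler_pM => //; [exact: D|exact: bnd].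
  by rewrite -[leRHS]mul1r; apply: ler_pM => //; [exact: st1|exact: D].
have b1 (W : T -> R) : measurable_fun setT W -> (forall w, `|W w| <= 1) -> `|Ex P W| <= 1 by move=> mW; exact: Ex_bdd.
have -> : cov P U V = cov P (st U) (st V) + (Ex P (fun w => U w * V w) - Ex P (fun w => st U w * st V w))
   - ((Ex P U - Ex P (st U)) * Ex P V + Ex P (st U) * (Ex P V - Ex P (st V))) by rewrite /cov; ring.
apply: (le_trans (ler_normB _ _)).
have -> : b + 4 * N.+1%:R^-1 = (b + 2 * N.+1%:R^-1) + (N.+1%:R^-1 + N.+1%:R^-1) by ring.
apply: lerD; first by apply: (le_trans (ler_normD _ _)); exact: lerD.
apply: (le_trans (ler_normD _ _)); rewrite !normrM; apply: lerD.
  rewrite -[leRHS]mulr1; apply: ler_pM => //; [exact: near|exact: b1 (bnd _ V01)].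
rewrite -[leRHS]mul1r; apply: ler_pM => //; [|exact: near].
by apply: (b1 _ (mst _ mU)) => w; exact: st1.
Qed.

End Mixing.

(** * Covariance inequalities under mixing *)

Section Covariance.
Context {d : measure_display} {T : measurableType d} {R : realType}.
Variable P : probability T R.
Implicit Types f g : T -> R.

Lemma cov_affine f g (a b c e : R) : L1 P f -> L1 P g -> L1 P (fun w => f w * g w) ->
  cov P (fun w => a * f w + b) (fun w => c * g w + e) = a * c * cov P f g.
Proof.
move=> lf lg lfg; rewrite /cov.
have Lc k : L1 P (fun=> k) by exact: L1_cst.
rewrite (ExD (L1Z a lf) (Lc b)) (ExD (L1Z c lg) (Lc e)) (ExZ _ lf) (ExZ _ lg) !Ex_cst.
rewrite (eq_Ex (fun w => a * c * (f w * g w) + (a * e * f w + (b * c * g w + b * e)))); last first.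
  by move=> w; ring.
rewrite (ExD (L1Z _ lfg) (L1D (L1Z _ lf) (L1D (L1Z _ lg) (Lc _)))) (ExZ _ lfg).
rewrite (ExD (L1Z _ lf) (L1D (L1Z _ lg) (Lc _))) (ExD (L1Z _ lg) (Lc _)).
by rewrite (ExZ _ lf) (ExZ _ lg) Ex_cst; ring.
Qed.

Lemma covDl f1 f2 g : L1 P f1 -> L1 P f2 -> L1 P (fun w => f1 w * g w) ->
  L1 P (fun w => f2 w * g w) ->
  cov P (fun w => f1 w + f2 w) g = cov P f1 g + cov P f2 g.
Proof.
move=> l1 l2 l1g l2g; rewrite /cov ExD//.
by under eq_Ex do rewrite mulrDl; rewrite ExD//; ring.
Qed.

Lemma cov_le_bdd f g (M : R) : measurable_fun setT f -> (forall w, `|f w| <= M) ->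
  L1 P g -> `|cov P f g| <= 2 * M * Ex P (fun w => `|g w|).
Proof.
move=> mf fM lg; rewrite /cov; apply: (le_trans (ler_normB _ _)).
have -> : 2 * M * Ex P (fun w => `|g w|) = M * Ex P (fun w => `|g w|) + M * Ex P (fun w => `|g w|) by ring.
apply: lerD.
  rewrite -(ExZ _ (L1_norm lg)); apply: Ex_abs_le.
  - exact: measurable_funM mf (L1_meas lg).
  - exact: L1Z (L1_norm lg).
  - by move=> w; rewrite normrM ler_wpM2r.
by rewrite normrM; apply: ler_pM => //; [exact: Ex_bdd|exact: Ex_abs].
Qed.

(** The arithmetic-geometric inequality bounds the mean of the product by half of the right-hand
    side, and Jensen's inequality does the same for the product of the means. *)
Lemma cov_le_sq f g : measurable_fun setT f -> measurable_fun setT g ->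
  L1 P (fun w => f w ^+ 2) -> L1 P (fun w => g w ^+ 2) ->
  `|cov P f g| <= Ex P (fun w => f w ^+ 2) + Ex P (fun w => g w ^+ 2).
Proof.
move=> mf mg lf lg; rewrite /cov; apply: (le_trans (ler_normB _ _)).
have jf := Ex_jensen2 mf lf; have jg := Ex_jensen2 mg lg.
have : `|Ex P (fun w => f w * g w)| <= 2^-1 * (Ex P (fun w => f w ^+ 2) + Ex P (fun w => g w ^+ 2)).
  rewrite -(ExD lf lg) -(ExZ _ (L1D lf lg)); apply: Ex_abs_le => //.
  - exact: measurable_funM.
  - exact: L1Z (L1D lf lg).
  - move=> w; rewrite normrM -(real_normK (num_real (f w))) -(real_normK (num_real (g w))).
    by have := sqr_ge0 (`|f w| - `|g w|); nra.
rewrite normrM; move: jf jg.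
rewrite -(real_normK (num_real (Ex P f))) -(real_normK (num_real (Ex P g))).
by have := sqr_ge0 (`|Ex P f| - `|Ex P g|); nra.
Qed.

(** The affine map [h] carries [-M, M] onto [0, 1]; undoing it on both sides multiplies the
    covariance by 2M and 2N, whence the 4. *)
Lemma cov_bdd f g (b M N : R) : 0 < M -> 0 < N -> measurable_fun setT f -> measurable_fun setT g ->
  (forall w, `|f w| <= M) -> (forall w, `|g w| <= N) -> amix P b f g ->
  `|cov P f g| <= 4 * b * M * N.
Proof.
move=> M0 N0 mf mg fM gN fg.
pose h (K x : R) := (x / K + 1) / 2.
have mh K : measurable_fun setT (h K).
  by apply: measurable_funM => //; apply: measurable_funD => //; exact: measurable_funM.
have h01 K x : 0 < K -> `|x| <= K -> 0 <= h K x <= 1.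
  move=> K0; rewrite ler_norml => /andP[h1 h2].
  have : -1 <= x / K <= 1 by rewrite ler_pdivlMr// ler_pdivrMr// mulN1r mul1r h1 h2.
  by rewrite /h => /andP[? ?]; apply/andP; split; lra.
have hf01 w := h01 _ _ M0 (fM w).
have hg01 w := h01 _ _ N0 (gN w).
have mhf : measurable_fun setT (h M \o f) by exact: measurableT_comp.
have mhg : measurable_fun setT (h N \o g) by exact: measurableT_comp.
have C := cov_unit mhf mhg hf01 hg01 (amix_comp (mh M) (mh N) fg).
have b1 (u : T -> R) : (forall w, 0 <= u w <= 1) -> forall w, `|u w| <= 1.
  by move=> u01 w; have /andP[? ?] := u01 w; rewrite ger0_norm.
have Lf : L1 P (h M \o f) by exact: L1_bdd (b1 _ hf01).
have Lg : L1 P (h N \o g) by exact: L1_bdd (b1 _ hg01).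
have Lfg : L1 P (fun w => (h M \o f) w * (h N \o g) w) by exact: L1_bddM (b1 _ hf01) Lg.
have -> : cov P f g = 2 * M * (2 * N) * cov P (h M \o f) (h N \o g).
  rewrite -(cov_affine _ (- M) _ (- N) Lf Lg Lfg); congr cov; apply/funext => w; rewrite /h/=.
    by field; rewrite gt_eqF.
  by field; rewrite gt_eqF.
rewrite normrM ger0_norm ?mulr_ge0 ?(ltW M0) ?(ltW N0)//.
have : 0 < 2 * M * (2 * N) by rewrite !mulr_gt0.
by move=> ?; nra.
Qed.

End Covariance.

(** * Truncation and Davydov's inequality *)

Section Clip.
Context {R : realType}.
Implicit Types x M s : R.

Definition clip M x : R := Num.max (- M) (Num.min x M).

Lemma clip_bdd M x : 0 <= M -> `|clip M x| <= M.
Proof.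
move=> M0; rewrite ler_norml /clip le_max lexx/= ge_max ge_min lexx orbT andbT.
by rewrite (le_trans _ M0)// oppr_le0.
Qed.

Lemma clip_id M x : `|x| <= M -> clip M x = x.
Proof. by rewrite ler_norml /clip => /andP[h1 h2]; rewrite min_l// max_r. Qed.

Lemma clip_dist M x : 0 <= M -> `|x - clip M x| <= `|x|.
Proof.
move=> M0; have [xM|Mx] := leP `|x| M; first by rewrite clip_id// subrr normr0.
rewrite /clip; move: Mx; case: (ger0P x) => x0 Mx.
  by rewrite min_r ?(ltW Mx)// max_r ?ger0_norm; lra.
by rewrite min_l ?max_l ?ler0_norm; lra.
Qed.

Lemma measurable_clip M : measurable_fun setT (clip M).
Proof. by apply: measurable_maxr => //; exact: measurable_minr. Qed.

(** The remainder vanishes unless |x| > M, and there M^(s-2) <= |x|^(s-2). Keeping the power of [M]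
    as a factor on the left avoids divisions; the same is done in [clip_abs]. *)
Lemma clip_sq M s x : 0 < M -> 2 <= s ->
  (x - clip M x) ^+ 2 * M `^ (s - 2) <= `|x| `^ s.
Proof.
move=> M0 s2; have [xM|Mx] := leP `|x| M.
  by rewrite clip_id// subrr expr0n/= mul0r powR_ge0.
have x0 : 0 < `|x| by exact: lt_trans Mx.
rewrite [in leRHS](_ : s = 2 + (s - 2)); last by lra.
rewrite [in leRHS]powRD ?(gt_eqF x0) ?implybT//.
rewrite (powR_mulrn 2)//.
apply: ler_pM => //; [exact: sqr_ge0|exact: powR_ge0| |].
  by rewrite -real_normK ?num_real// ler_sqr ?nnegrE// clip_dist// ltW.
by rewrite ge0_ler_powR ?nnegrE ?subr_ge0// ltW.
Qed.

Lemma clip_abs M s x : 0 < M -> 2 <= s ->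
  `|x - clip M x| * M * M `^ (s - 2) <= `|x| `^ s.
Proof.
move=> M0 s2; have [xM|Mx] := leP `|x| M.
  by rewrite clip_id// subrr normr0 !mul0r powR_ge0.
have x0 : 0 < `|x| by exact: lt_trans Mx.
rewrite [in leRHS](_ : s = 2 + (s - 2)); last by lra.
rewrite [in leRHS]powRD ?(gt_eqF x0) ?implybT//.
rewrite (powR_mulrn 2)//.
apply: ler_pM => //; [by rewrite mulr_ge0// ltW|exact: powR_ge0| |].
  by rewrite expr2; apply: ler_pM => //; rewrite ?clip_dist// ltW.
by rewrite ge0_ler_powR ?nnegrE ?subr_ge0// ltW.
Qed.

Lemma sq_le_powR s x : 2 <= s -> x ^+ 2 <= 1 + `|x| `^ s.
Proof.
move=> s2; have [xM|Mx] := leP `|x| 1.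
  rewrite -real_normK ?num_real//; have := powR_ge0 `|x| s; have := normr_ge0 x; nra.
rewrite -real_normK ?num_real// -powR_mulrn// ler_wpDl// ler_powR// ltW//.
Qed.

End Clip.

Section Davydov.
Context {d : measure_display} {T : measurableType d} {R : realType}.
Variable P : probability T R.
Implicit Types f g : T -> R.

Lemma L1_powR_sq f (s : R) : 2 <= s -> measurable_fun setT f ->
  L1 P (fun w => `|f w| `^ s) -> L1 P (fun w => f w ^+ 2).
Proof.
move=> s2 mf lf; apply: L1_dom (L1D (L1_cst 1) lf); first exact: measurable_funX.
by move=> w; rewrite ger0_norm ?sqr_ge0//; exact: sq_le_powR.
Qed.

Section Remainder.
Variables (f : T -> R) (s M B : R).
Hypotheses (M0 : 0 < M) (s2 : 2 <= s) (mf : measurable_fun setT f).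
Hypotheses (lf : L1 P (fun w => `|f w| `^ s)) (fB : Ex P (fun w => `|f w| `^ s) <= B).

Lemma measurable_clip_rem : measurable_fun setT (fun w => f w - clip M (f w)).
Proof. by apply: measurable_funB => //; exact: measurableT_comp (measurable_clip _) mf. Qed.

Lemma L1_clip_rem2 : L1 P (fun w => (f w - clip M (f w)) ^+ 2).
Proof.
apply: L1_dom (L1_powR_sq s2 mf lf); first exact/measurable_funX/measurable_clip_rem.
move=> w; rewrite ger0_norm ?sqr_ge0// -[in leRHS]real_normK ?num_real//.
by rewrite -real_normK ?num_real// ler_sqr ?nnegrE// clip_dist// ltW.
Qed.

Lemma Ex_clip_rem2 : Ex P (fun w => (f w - clip M (f w)) ^+ 2) * M `^ (s - 2) <= B.
Proof.
apply: le_trans fB; rewrite mulrC -(ExZ _ L1_clip_rem2); apply: Ex_le => //.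
  exact: L1Z L1_clip_rem2.
by move=> w; rewrite mulrC; exact: clip_sq.
Qed.

Lemma Ex_clip_rem1 : M * Ex P (fun w => `|f w - clip M (f w)|) * M `^ (s - 2) <= B.
Proof.
have L := L1_norm (L1_sq measurable_clip_rem L1_clip_rem2).
apply: le_trans fB; rewrite mulrAC -(ExZ _ L); apply: Ex_le => //.
  exact: L1Z L.
by move=> w; rewrite mulrC mulrA; exact: clip_abs.
Qed.

End Remainder.

(** Each variable is split at level [M] into a truncated part and a remainder. The truncated pair
    gives the mixing term; the two mixed covariances and the covariance of the remainders contribute
    2B each, whence the 6. *)
Lemma davydov_trunc f g (b s M B : R) : 0 < M -> 2 <= s ->
  measurable_fun setT f -> measurable_fun setT g ->
  L1 P (fun w => `|f w| `^ s) -> L1 P (fun w => `|g w| `^ s) ->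
  Ex P (fun w => `|f w| `^ s) <= B -> Ex P (fun w => `|g w| `^ s) <= B ->
  amix P b f g ->
  `|cov P f g| * M `^ (s - 2) <= 4 * b * M ^+ 2 * M `^ (s - 2) + 6 * B.
Proof.
move=> M0 s2 mf mg lf lg fB gB fg.
pose f1 w := clip M (f w); pose f2 w := f w - clip M (f w).
pose g1 w := clip M (g w); pose g2 w := g w - clip M (g w).
have mf1 : measurable_fun setT f1 by exact: measurableT_comp (measurable_clip _) mf.
have mg1 : measurable_fun setT g1 by exact: measurableT_comp (measurable_clip _) mg.
have mf2 : measurable_fun setT f2 by exact: measurable_clip_rem.
have mg2 : measurable_fun setT g2 by exact: measurable_clip_rem.
have f1M w : `|f1 w| <= M by apply/clip_bdd/ltW.
have g1M w : `|g1 w| <= M by apply/clip_bdd/ltW.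
have lf1 : L1 P f1 by exact: L1_bdd f1M.
have lg1 : L1 P g1 by exact: L1_bdd g1M.
have l2f2 : L1 P (fun w => f2 w ^+ 2) by exact: L1_clip_rem2 lf.
have l2g2 : L1 P (fun w => g2 w ^+ 2) by exact: L1_clip_rem2 lg.
have lf2 := L1_sq mf2 l2f2; have lg2 := L1_sq mg2 l2g2.
have lf1g1 := L1_bddM mf1 f1M lg1; have lf1g2 := L1_bddM mf1 f1M lg2.
have lg1f1 := L1_bddM mg1 g1M lf1; have lg1f2 := L1_bddM mg1 g1M lf2.
have lf2g2 := L1_sqM mf2 mg2 l2f2 l2g2.
have sw (u v : T -> R) : L1 P (fun w => u w * v w) -> L1 P (fun w => v w * u w).
  by move=> l; apply: (eq_L1 l) => w; rewrite mulrC.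
have -> : cov P f g = cov P f1 g1 + cov P f1 g2 + (cov P g1 f2 + cov P f2 g2).
  have -> : f = (fun w => f1 w + f2 w) by apply/funext => w; rewrite /f1 /f2; ring.
  have -> : g = (fun w => g1 w + g2 w) by apply/funext => w; rewrite /g1 /g2; ring.
  have la : L1 P (fun w => f1 w * (g1 w + g2 w)).
    by apply: (eq_L1 (L1D lf1g1 lf1g2)) => w; rewrite [RHS]mulrDr.
  have lb : L1 P (fun w => f2 w * (g1 w + g2 w)).
    by apply: (eq_L1 (L1D lg1f2 lf2g2)) => w; rewrite [RHS]mulrDr [X in _ = X + _]mulrC.
  rewrite (covDl lf1 lf2 la lb) (@covC _ _ _ _ f1) (@covC _ _ _ _ f2).
  rewrite (covDl lg1 lg2 lg1f1 (sw _ _ lf1g2)) (covDl lg1 lg2 lg1f2 (sw _ _ lf2g2)).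
  by rewrite (@covC _ _ _ _ g1 f1) (@covC _ _ _ _ g2 f1) (@covC _ _ _ _ g2 f2).
have K0 : 0 < M `^ (s - 2) by rewrite powR_gt0.
have c11 : `|cov P f1 g1| <= 4 * b * M * M.
  by apply: cov_bdd => //; apply: amix_comp fg; exact: measurable_clip.
have c12 := cov_le_bdd mf1 f1M lg2.
have c21 := cov_le_bdd mg1 g1M lf2.
have c22 := cov_le_sq mf2 mg2 l2f2 l2g2.
have rf1 := Ex_clip_rem1 M0 s2 mf lf fB.
have rg1 := Ex_clip_rem1 M0 s2 mg lg gB.
have rf2 := Ex_clip_rem2 M0 s2 mf lf fB.
have rg2 := Ex_clip_rem2 M0 s2 mg lg gB.
apply: (@le_trans _ _ ((`|cov P f1 g1| + `|cov P f1 g2| + (`|cov P g1 f2| + `|cov P f2 g2|)) * M `^ (s - 2))).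
  apply: ler_wpM2r; first exact: ltW.
  by apply: (le_trans (ler_normD _ _)); apply: lerD; exact: ler_normD.
rewrite -/f2 -/g2 in rf1 rg1 rf2 rg2.
rewrite -/(f2 _) -/(g2 _) in rf1.
move: c11 c12 c21 c22 rf1 rg1 rf2 rg2.
rewrite -/f2 -/g2 /f2 /g2.
set a1 := `|cov _ _ _|; set a2 := `|cov _ _ _|; set a3 := `|cov _ _ _|; set a4 := `|cov _ _ _|.
set e1 := Ex _ _; set e2 := Ex _ _; set e3 := Ex _ _; set e4 := Ex _ _.
set K := M `^ (s - 2) in K0 *.
move=> c11 c12 c21 c22 rf1 rg1 rf2 rg2.
have := ler_wpM2r (ltW K0) c11; have := ler_wpM2r (ltW K0) c12.
have := ler_wpM2r (ltW K0) c21; have := ler_wpM2r (ltW K0) c22.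
by move=> *; lra.
Qed.

Lemma davydov f g (b s B : R) : 0 <= b -> 2 < s ->
  measurable_fun setT f -> measurable_fun setT g ->
  L1 P (fun w => `|f w| `^ s) -> L1 P (fun w => `|g w| `^ s) ->
  Ex P (fun w => `|f w| `^ s) <= B -> Ex P (fun w => `|g w| `^ s) <= B ->
  amix P b f g -> `|cov P f g| <= (4 + 6 * B) * b `^ (1 - 2 / s).
Proof.
move=> b0 s2 mf mg lf lg fB gB fg.
have s0 : 0 < s by exact: lt_trans s2.
have pos c : 0 < c -> amix P c f g -> `|cov P f g| <= (4 + 6 * B) * c `^ (1 - 2 / s).
  (* This level balances the truncated part c M^2 and the tail M^(2-s). *)
  move=> c0 fgc; pose M := c `^ (- s^-1).
  have M0 : 0 < M by exact: powR_gt0.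
  have := davydov_trunc M0 (ltW s2) mf mg lf lg fB gB fgc.
  have MK : M `^ (s - 2) = c `^ - (1 - 2 / s).
    by rewrite /M -powRrM; congr powR; field; rewrite gt_eqF.
  have M2 : M ^+ 2 = c `^ (- 2 / s).
    by rewrite -powR_mulrn ?ltW// /M -powRrM; congr powR; field; rewrite gt_eqF.
  have cM2 : c * M ^+ 2 = c `^ (1 - 2 / s).
    by rewrite M2 -{1}(powRr1 (ltW c0)) -powRD ?(gt_eqF c0) ?implybT//; congr powR; lra.
  have inv : c `^ (1 - 2 / s) * M `^ (s - 2) = 1.
    by rewrite MK -powRD ?(gt_eqF c0) ?implybT// subrr powRr0.
  have K0 : 0 < M `^ (s - 2) by exact: powR_gt0.
  move=> H; rewrite -(ler_pM2r K0) -mulrA inv mulr1; apply: (le_trans H).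
  by rewrite -[4 * c * _]mulrA cM2 -mulrA inv; lra.
(* The balancing level b^(-1/s) makes no sense for b = 0. That case follows by enlarging the mixing
   bound to small positive values. *)
have [bE|bn0] := eqVneq b 0; last by apply: pos => //; rewrite lt_def bn0.
have r0 : 0 < 1 - 2 / s by rewrite subr_gt0 ltr_pdivrMr// mul1r.
have B0 : 0 <= B by apply: le_trans fB; apply: Ex_ge0 => w; exact: powR_ge0.
rewrite bE powR0 ?gt_eqF// mulr0; apply/ler_addgt0Pr => e e0; rewrite add0r.
(* Solution of (4 + 6B) c^(1 - 2/s) = e. *)
pose c := (e / (4 + 6 * B)) `^ (1 - 2 / s)^-1.
have B4 : 0 < 4 + 6 * B by rewrite ltr_wpDr// mulr_ge0.
have q0 : 0 < e / (4 + 6 * B) by rewrite divr_gt0.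
have /pos : 0 < c by exact: powR_gt0.
rewrite -powRrM mulVf ?gt_eqF// powRr1 ?(ltW q0)// mulrC divfK; last by rewrite gt_eqF.
by apply; apply: amix_le fg; rewrite bE powR_ge0.
Qed.

End Davydov.

(** * Elementary bounds for sine, cosine and exponential *)

Section TrigBounds.
Context {R : realType}.
Implicit Types (a b x y : R).

Lemma mvt_bound (f f' : R -> R) a b (K : R) : (forall x, is_derive x (1 : R) f (f' x)) ->
  (forall z, `|z - a| <= `|b - a| -> `|f' z| <= K) -> `|f b - f a| <= K * `|b - a|.
Proof.
move=> df fK; have cf u v : {within `[u, v], continuous f}.
  apply: derivable_within_continuous => z _; exact: ex_derive.
have [ab|ba] := leP a b.
  have [c /andP[ac cb] ->] := MVT_segment ab (fun z _ => df z) (cf _ _).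
  rewrite normrM; apply: ler_wpM2r => //; apply: fK.
  by rewrite !ger0_norm ?subr_ge0// lerB.
have [c /andP[bc ca] E] := MVT_segment (ltW ba) (fun z _ => df z) (cf _ _).
rewrite distrC E normrM [`|a - b|]distrC; apply: ler_wpM2r => //; apply: fK.
by rewrite distrC [`|b - a|]distrC !ger0_norm ?subr_ge0// ?lerB// ltW.
Qed.

Lemma cos_lip a b : `|cos a - cos b| <= `|a - b|.
Proof.
rewrite -[leRHS]mul1r; apply: (@mvt_bound _ (fun x => - sin x)) => z _.
by rewrite normrN ler_norml sin_geN1 sin_le1.
Qed.

Lemma sin_lip a b : `|sin a - sin b| <= `|a - b|.
Proof.
rewrite -[leRHS]mul1r; apply: (@mvt_bound _ cos) => z _.
by rewrite ler_norml cos_geN1 cos_le1.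
Qed.

Lemma sin_abs x : `|sin x| <= `|x|.
Proof. by have := sin_lip x 0; rewrite sin0 !subr0. Qed.

Lemma cos1_abs x : `|cos x - 1| <= `|x|.
Proof. by have := cos_lip x 0; rewrite cos0 subr0. Qed.

Lemma cos1_sq x : `|cos x - 1| <= `|x| ^+ 2.
Proof.
rewrite expr2; have := @mvt_bound cos (fun x => - sin x) 0 x `|x|.
rewrite cos0 subr0; apply => z; rewrite subr0 normrN; exact: le_trans (sin_abs z).
Qed.

Lemma sin_lin x : `|sin x - x| <= `|x| ^+ 2 /\ `|sin x - x| <= `|x| ^+ 3.
Proof.
have H K : (forall z, `|z| <= `|x| -> `|cos z - 1| <= K) -> `|sin x - x| <= K * `|x|.
  move=> zK; have := @mvt_bound (fun x => sin x - x) (fun x => cos x - 1) 0 x K.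
  by rewrite /= sin0 !subr0; apply => // z; rewrite subr0; exact: zK.
split; first by rewrite expr2; apply: H => z; exact: le_trans (cos1_abs z).
rewrite exprSr; apply: H => z zx; apply: (le_trans (cos1_sq z)).
by rewrite ler_sqr ?nnegrE.
Qed.

Lemma cos_quad x : `|cos x - 1 + x ^+ 2 / 2| <= `|x| ^+ 3.
Proof.
have := @mvt_bound (fun x => cos x - 1 + x ^+ 2 / 2) (fun x => x - sin x) 0 x (`|x| ^+ 2).
rewrite /= cos0 subrr expr0n/= mul0r addr0 !subr0 -exprSr; apply => z.
  apply: is_derive_eq; rewrite ?scaler0 ?add0r ?addr0.
  by rewrite /GRing.scale/=; field.
rewrite subr0 distrC => zx; apply: (le_trans (sin_lin z).1).
by rewrite ler_sqr ?nnegrE.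
Qed.

Lemma expN_lip x y : 0 <= x -> 0 <= y -> `|expR (- x) - expR (- y)| <= `|x - y|.
Proof.
move=> x0 y0.
suff H2 (u v : R) : 0 <= u -> u <= v -> `|expR (- u) - expR (- v)| <= v - u.
  have [xy|/ltW yx] := leP x y; first by rewrite [`|x - y|]distrC [leRHS]ger0_norm ?subr_ge0//; exact: H2.
  by rewrite distrC [leRHS]ger0_norm ?subr_ge0//; exact: H2.
move=> u0 uv; have v0 := le_trans u0 uv.
rewrite ger0_norm ?subr_ge0 ?ler_expR ?lerN2//.
have := expR_ge1Dx (- (v - u)); have : expR (- u) <= 1 by rewrite -expR0 ler_expR oppr_le0.
have -> : expR (- v) = expR (- u) * expR (- (v - u)) by rewrite -expRD; congr expR; ring.
by have := expR_gt0 (- u); nra.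
Qed.

Lemma expN_lin x : 0 <= x -> `|expR (- x) - (1 - x)| <= x ^+ 2.
Proof.
move=> x0; have h := expR_ge1Dx (- x); rewrite ger0_norm; last by lra.
have h2 := expR_ge1Dx x; have e0 := expR_gt0 x.
have E : expR x * expR (- x) = 1 by rewrite -expRD subrr expR0.
have : expR (- x) * (1 + x) <= 1 by rewrite -E; have := expR_gt0 (- x); nra.
by have := expR_gt0 (- x); nra.
Qed.

(** If |a - b| exceeds [e], then it is at most its square divided by [e]. This converts mean-square
    closeness into closeness in mean, with [e] left to be optimised. *)
Lemma dist_amgm a b (e : R) : 0 < e -> `|a - b| <= e + (a - b) ^+ 2 / e.
Proof.
move=> e0; rewrite -(real_normK (num_real (a - b))); move: `|a - b| (normr_ge0 (a - b)) => z z0.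
have [ze|ez] := leP z e; first by rewrite ler_wpDr// divr_ge0 ?sqr_ge0// ltW.
by rewrite ler_wpDl ?(ltW e0)// ler_pdivlMr// expr2 ler_wpM2l// ltW.
Qed.

End TrigBounds.

(** * Partial sums with summable autocovariances *)

Section Variance.
Context {d : measure_display} {T : measurableType d} {R : realType}.
Variable P : probability T R.
Variables (X : nat -> T -> R) (c tau : nat -> R).
Hypothesis mX : forall i, measurable_fun setT (X i).
Hypothesis X2 : forall i, L1 P (fun w => X i w ^+ 2).
Hypothesis c0 : forall k, 0 <= c k.
Hypothesis Xc : forall i j, (i <= j)%N -> `|Ex P (fun w => X i w * X j w)| <= c (j - i).
Hypothesis ctau : forall q N, \sum_(q <= k < N) c k <= tau q.

(** The predicate allows a sum over the blocks alone, or over the gaps alone, to be treated as one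
    object. *)
Definition psum (Q : pred nat) m n w : R := \sum_(m <= i < n | Q i) X i w.

Lemma measurable_psum Q m n : measurable_fun setT (psum Q m n).
Proof.
rewrite (_ : psum Q m n = fun w => \sum_(m <= i < n) (if Q i then X i w else 0)).
  by apply: measurable_sum => i; case: (Q i).
by apply/funext => w; rewrite /psum big_mkcond.
Qed.

Lemma L1_XX i j : L1 P (fun w => X i w * X j w).
Proof. exact: L1_sqM. Qed.

Lemma psum_mul Q m n Q' m' n' w : psum Q m n w * psum Q' m' n' w =
  \sum_(m <= i < n | Q i) \sum_(m' <= j < n' | Q' j) X i w * X j w.
Proof. by rewrite /psum mulr_suml; apply: eq_bigr => i _; rewrite mulr_sumr. Qed.

Lemma L1_psumM Q m n Q' m' n' : L1 P (fun w => psum Q m n w * psum Q' m' n' w).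
Proof.
apply: (@eq_L1 _ _ _ _ (fun w => \sum_(m <= i < n | Q i) \sum_(m' <= j < n' | Q' j) X i w * X j w)).
  by apply: L1_sum => i _; apply: L1_sum => j _; exact: L1_XX.
by move=> w; rewrite psum_mul.
Qed.

Lemma L1_psum2 Q m n : L1 P (fun w => psum Q m n w ^+ 2).
Proof. by apply: (eq_L1 (L1_psumM Q m n Q m n)) => w; rewrite expr2. Qed.

Lemma Ex_psumM Q m n Q' m' n' : Ex P (fun w => psum Q m n w * psum Q' m' n' w) =
  \sum_(m <= i < n | Q i) \sum_(m' <= j < n' | Q' j) Ex P (fun w => X i w * X j w).
Proof.
under eq_Ex do rewrite psum_mul.
rewrite Ex_sum; last by move=> i _; apply: L1_sum => j _; exact: L1_XX.
apply: eq_bigr => i _; rewrite Ex_sum// => j _; exact: L1_XX.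
Qed.

Lemma sum_rev_sub (i m : nat) : (m <= i.+1)%N ->
  \sum_(0 <= l < m) c (i - l) = \sum_(i.+1 - m <= k < i.+1) c k.
Proof.
elim: m => [|m IH] mi; first by rewrite subn0 !big_geq.
rewrite big_nat_recr//= IH ?(ltnW mi)// subSS [RHS]big_ltn ?ltnS ?leq_subr//.
by rewrite subSn// addrC.
Qed.

(** The indices up to [i] and those after [i] each contribute at most [tau 0]. *)
Lemma row_sum i n : \sum_(0 <= j < n) `|Ex P (fun w => X i w * X j w)| <= 2 * tau 0.
Proof.
have E j : Ex P (fun w => X i w * X j w) = Ex P (fun w => X j w * X i w).
  by apply: eq_Ex => w; rewrite mulrC.
have A m : (m <= i.+1)%N -> \sum_(0 <= j < m) `|Ex P (fun w => X i w * X j w)| <= tau 0.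
  move=> mi; apply: (@le_trans _ _ (\sum_(0 <= l < m) c (i - l))).
    apply: ler_sum_nat => j /andP[_ jm]; rewrite E; apply: Xc.
    by rewrite -ltnS (leq_trans jm).
  rewrite sum_rev_sub//; apply: le_trans (ctau 0 i.+1).
  by rewrite [leRHS](@big_cat_nat _ _ _ (i.+1 - m))//= ?leq_subr// lerDr sumr_ge0.
have t0 : 0 <= tau 0 by have := ctau 0 0; rewrite big_geq.
have [ni|ni] := leqP n i.+1; first by rewrite (le_trans (A n ni))//; lra.
rewrite (@big_cat_nat _ _ _ i.+1)//=; last exact: ltnW.
rewrite mulr_natl mulr2n; apply: lerD; first exact: A.
apply: (@le_trans _ _ (\sum_(i.+1 <= j < n) c (j - i))).
  by apply: ler_sum_nat => j /andP[ij _]; apply: Xc; exact: ltnW.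
apply: le_trans (ctau 0 (n - i)).
rewrite -{1}(add0n i.+1) big_addn.
have -> : \sum_(0 <= i0 < n - i.+1) c (i0 + i.+1 - i) = \sum_(0 <= k < n - i.+1) c k.+1.
  by apply: eq_bigr => k _; rewrite addnS subSn ?leq_addl// addnK.
have -> : (n - i = (n - i.+1).+1)%N by rewrite subnSK// ltnW.
by rewrite [leRHS]big_nat_recl//= lerDr.
Qed.

(** Only selected indices are counted: a sum over the gaps has variance proportional to the total
    gap length, which is what makes the gaps negligible. *)
Lemma psum_var Q m n : Ex P (fun w => psum Q m n w ^+ 2) <=
  2 * tau 0 * \sum_(m <= i < n | Q i) 1.
Proof.
under eq_Ex do rewrite expr2.
rewrite Ex_psumM mulr_sumr; apply: ler_sum => i _; rewrite mulr1.
apply: le_trans (row_sum i n).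
apply: (@le_trans _ _ (\sum_(m <= j < n | Q j) `|Ex P (fun w => X i w * X j w)|)).
  by apply: ler_sum => j _; exact: ler_norm.
rewrite big_mkcond/= (@le_trans _ _ (\sum_(m <= j < n) `|Ex P (fun w => X i w * X j w)|))//.
  by apply: ler_sum => j _; case: ifP.
have [mn|nm] := leqP m n; last by rewrite [leLHS]big_geq ?(ltnW nm)//; apply: sumr_ge0.
by rewrite [leRHS](@big_cat_nat _ _ _ m)//= lerDr; apply: sumr_ge0.
Qed.

(** Every index of the second sum is at distance more than [q] from all those of the first, so its
    covariances with the past add up to at most [tau q], however long the past is. *)
Lemma psum_cross Q m q l : `|Ex P (fun w => psum Q 0 m w * psum predT (m + q) (m + q + l) w)| <=
  l%:R * tau q.
Proof.
have -> : Ex P (fun w => psum Q 0 m w * psum predT (m + q) (m + q + l) w) =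
    Ex P (fun w => psum predT (m + q) (m + q + l) w * psum Q 0 m w).
  by apply: eq_Ex => w; rewrite mulrC.
rewrite Ex_psumM; apply: (le_trans (ler_norm_sum _ _ _)).
have -> : l%:R * tau q = \sum_(m + q <= i < m + q + l) tau q.
  by rewrite sumr_const_nat addKn mulr_natl.
apply: ler_sum_nat => i /andP[mi _].
have mi' : (m <= i)%N by rewrite (leq_trans _ mi)// leq_addr.
apply: (le_trans (ler_norm_sum _ _ _)); rewrite big_mkcond/=.
apply: (@le_trans _ _ (\sum_(0 <= j < m) c (i - j))).
  apply: ler_sum_nat => j /andP[_ jm]; case: ifP => _; last exact: c0.
  rewrite (_ : Ex _ _ = Ex P (fun w => X j w * X i w)); last by apply: eq_Ex => w; rewrite mulrC.
  by apply: Xc; rewrite ltnW// (leq_trans jm).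
rewrite sum_rev_sub; last exact: leqW.
apply: le_trans (ctau q i.+1).
have qi : (q <= i.+1 - m)%N by rewrite leq_subRL ?(leqW mi')// (leq_trans mi).
by rewrite [leRHS](@big_cat_nat _ _ _ (i.+1 - m))//= ?leq_subr// lerDr sumr_ge0.
Qed.

End Variance.

(** * Distance to the Gaussian transform of equal second moment *)

Section CharGap.
Context {d : measure_display} {T : measurableType d} {R : realType}.
Variable P : probability T R.
Implicit Types S U : T -> R.

(** The reference is N(0, E S^2) and not a limit law: errors can then be accumulated block by block
    before any convergence of variances is known. [singap] is the imaginary part, with reference
    0. *)
Definition cosgap (u : R) S : R :=
  `|Ex P (fun w => cos (u * S w)) - expR (- (u ^+ 2 * Ex P (fun w => S w ^+ 2) / 2))|.
Definition singap (u : R) S : R := `|Ex P (fun w => sin (u * S w))|.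

Lemma measurable_cosu (u : R) S : measurable_fun setT S -> measurable_fun setT (fun w => cos (u * S w)).
Proof.
move=> mS; apply: (measurableT_comp (f := cos)); last exact: measurable_funM.
by apply: continuous_measurable_fun; exact: continuous_cos.
Qed.

Lemma measurable_sinu (u : R) S : measurable_fun setT S -> measurable_fun setT (fun w => sin (u * S w)).
Proof.
move=> mS; apply: (measurableT_comp (f := sin)); last exact: measurable_funM.
by apply: continuous_measurable_fun; exact: continuous_sin.
Qed.

Lemma cos_le1' (x : R) : `|cos x| <= 1.
Proof. by rewrite ler_norml cos_geN1 cos_le1. Qed.
Lemma sin_le1' (x : R) : `|sin x| <= 1.
Proof. by rewrite ler_norml sin_geN1 sin_le1. Qed.

Lemma L1_cosu (u : R) S : measurable_fun setT S -> L1 P (fun w => cos (u * S w)).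
Proof. by move=> mS; apply: (L1_bdd 1 (measurable_cosu u mS)) => w; exact: cos_le1'. Qed.

Lemma L1_sinu (u : R) S : measurable_fun setT S -> L1 P (fun w => sin (u * S w)).
Proof. by move=> mS; apply: (L1_bdd 1 (measurable_sinu u mS)) => w; exact: sin_le1'. Qed.

Section Compare.
Variables (S U : T -> R) (u D V eta : R).
Hypotheses (mS : measurable_fun setT S) (mU : measurable_fun setT U).
Hypotheses (S2 : L1 P (fun w => S w ^+ 2)) (U2 : L1 P (fun w => U w ^+ 2)).
Hypotheses (eta0 : 0 < eta) (SD : Ex P (fun w => (S w - U w) ^+ 2) <= D).
Hypotheses (SV : Ex P (fun w => S w ^+ 2) <= V) (UV : Ex P (fun w => U w ^+ 2) <= V).

Let lSU : L1 P (fun w => (S w - U w) ^+ 2).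
Proof.
apply: (@eq_L1 _ _ _ _ (fun w => (S w + - U w) ^+ 2)) => //.
apply: L1_sqD => //; first exact: measurableT_comp.
by apply: (eq_L1 U2) => w; rewrite sqrrN.
Qed.

Let trig_compare (f : R -> R) : measurable_fun setT (fun w => f (u * S w)) ->
  measurable_fun setT (fun w => f (u * U w)) -> (forall x, `|f x| <= 1) ->
  (forall x y, `|f x - f y| <= `|x - y|) ->
  `|Ex P (fun w => f (u * S w)) - Ex P (fun w => f (u * U w))| <= eta + u ^+ 2 * D / eta.
Proof.
move=> mfS mfU f1 flip.
rewrite -ExB; [|by apply: (L1_bdd 1)|by apply: (L1_bdd 1)].
have L := L1D (L1_cst (P := P) eta) (L1Z (u ^+ 2 / eta) lSU).
apply: (@le_trans _ _ (Ex P (fun w => cst eta w + u ^+ 2 / eta * (S w - U w) ^+ 2))).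
  apply: Ex_abs_le => //; first exact: measurable_funB.
  move=> w; apply: (le_trans (flip _ _)); rewrite /cst.
  have -> : u ^+ 2 / eta * (S w - U w) ^+ 2 = (u * S w - u * U w) ^+ 2 / eta.
    by field; rewrite gt_eqF.
  exact: dist_amgm.
rewrite (ExD (L1_cst eta) (L1Z _ lSU)) (ExZ _ lSU) (Ex_cst eta) lerD2l.
by rewrite mulrAC ler_wpM2r ?invr_ge0 ?(ltW eta0)// ler_wpM2l// sqr_ge0.
Qed.

Lemma singap_compare : singap u S <= singap u U + (eta + u ^+ 2 * D / eta).
Proof.
rewrite /singap -lerBlDl; apply: (le_trans (lerB_dist _ _)); apply: trig_compare.
- exact: measurable_sinu.
- exact: measurable_sinu.
- exact: sin_le1'.
- exact: sin_lip.
Qed.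

(** The cosines differ by at most |u (S - U)|, handled by [dist_amgm]; the remaining terms come from
    the change of second moment inside the exponential. [eta] is free and is chosen by the
    callers. *)
Lemma cosgap_compare :
  cosgap u S <= cosgap u U + (eta + 2 * (u ^+ 2 * D / eta) + eta * u ^+ 2 * V).
Proof.
have C : `|Ex P (fun w => cos (u * S w)) - Ex P (fun w => cos (u * U w))| <= eta + u ^+ 2 * D / eta.
  apply: trig_compare.
  - exact: measurable_cosu.
  - exact: measurable_cosu.
  - exact: cos_le1'.
  - exact: cos_lip.
(* Here |a^2 - b^2| = |a - b| |a + b| is split with weights 1/(2 eta) and eta, using (a + b)^2 + (a
   - b)^2 = 2 (a^2 + b^2). *)
have d2 : `|Ex P (fun w => S w ^+ 2) - Ex P (fun w => U w ^+ 2)| <= D / (2 * eta) + 2 * eta * V.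
  rewrite -(ExB S2 U2).
  have L := L1D (L1Z (2 * eta)^-1 lSU) (L1Z eta (L1D S2 U2)).
  apply: (@le_trans _ _ (Ex P (fun w => (2 * eta)^-1 * (S w - U w) ^+ 2 + eta * (S w ^+ 2 + U w ^+ 2)))).
    apply: Ex_abs_le => //; first by apply: measurable_funB; exact: measurable_funX.
    move=> w; move: (S w) (U w) => a b.
    have -> : (2 * eta)^-1 * (a - b) ^+ 2 + eta * (a ^+ 2 + b ^+ 2) =
      (2 * eta)^-1 * ((a - b) ^+ 2 + (eta * (a + b)) ^+ 2 + (eta * (a - b)) ^+ 2).
      by field; rewrite gt_eqF.
    rewrite ler_pdivlMl ?mulr_gt0//.
    have -> : 2 * eta * `|a ^+ 2 - b ^+ 2| = `|2 * (a - b) * (eta * (a + b))|.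
      rewrite [RHS](_ : _ = `|2 * eta * (a ^+ 2 - b ^+ 2)|); last by congr Num.norm; ring.
      by rewrite normrM gtr0_norm ?mulr_gt0.
    move: (a - b) (eta * (a + b)) => x y.
    have := sqr_ge0 (eta * x); have := sqr_ge0 (x - y); have := sqr_ge0 (x + y).
    by rewrite ler_norml => *; apply/andP; split; nra.
  rewrite (ExD (L1Z (2 * eta)^-1 lSU) (L1Z eta (L1D S2 U2))) (ExZ _ lSU) (ExZ _ (L1D S2 U2)) (ExD S2 U2).
  apply: lerD; first by rewrite mulrC ler_wpM2r// invr_ge0 mulr_ge0// ltW.
  by rewrite [leRHS](_ : _ = eta * (2 * V)); [rewrite ler_wpM2l ?(ltW eta0)// mulrDl !mul1r; exact: lerD|ring].
have S0 : 0 <= Ex P (fun w => S w ^+ 2) by apply: Ex_ge0 => w; exact: sqr_ge0.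
have U0 : 0 <= Ex P (fun w => U w ^+ 2) by apply: Ex_ge0 => w; exact: sqr_ge0.
have e1 := expN_lip (x := u ^+ 2 * Ex P (fun w => S w ^+ 2) / 2) (y := u ^+ 2 * Ex P (fun w => U w ^+ 2) / 2).
have h0 a : 0 <= a -> 0 <= u ^+ 2 * a / 2 by move=> a0; rewrite divr_ge0// mulr_ge0// sqr_ge0.
have {}e1 := e1 (h0 _ S0) (h0 _ U0).
have e2 : `|u ^+ 2 * Ex P (fun w => S w ^+ 2) / 2 - u ^+ 2 * Ex P (fun w => U w ^+ 2) / 2| <=
   u ^+ 2 * D / eta + eta * u ^+ 2 * V.
  rewrite -mulrBl -mulrBr (normrM _ 2^-1) (normrM (u ^+ 2) _) (ger0_norm (sqr_ge0 u)) (@ger0_norm _ 2^-1) ?invr_ge0//.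
  have D0 : 0 <= D by apply: le_trans SD; apply: Ex_ge0 => w; exact: sqr_ge0.
  have := ler_wpM2l (sqr_ge0 u) d2 => d3.
  apply: (@le_trans _ _ (u ^+ 2 * (D / (2 * eta) + 2 * eta * V) / 2)).
    by rewrite ler_wpM2r// invr_ge0.
  have -> : u ^+ 2 * (D / (2 * eta) + 2 * eta * V) / 2 = (u ^+ 2 * D / eta) / 4 + eta * u ^+ 2 * V.
    by field; rewrite gt_eqF.
  have : 0 <= u ^+ 2 * D / eta := divr_ge0 (mulr_ge0 (sqr_ge0 u) D0) (ltW eta0).
  by lra.
rewrite /cosgap.
set cS := Ex P _; set cU := Ex P (fun w => cos (u * U w)).
rewrite -/cS -/cU in C.
set eS := expR _; set eU := expR _.
have -> : cS - eS = (cS - cU) + (cU - eU) + (eU - eS) by ring.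
apply: (le_trans (ler_normD _ _)).
have := ler_normD (cS - cU) (cU - eU); have : `|eU - eS| <= u ^+ 2 * D / eta + eta * u ^+ 2 * V.
  by rewrite distrC; exact: le_trans e1 e2.
by move: C => *; lra.
Qed.

End Compare.
End CharGap.

(** Convergence to 0 in epsilon-N form, convenient for combining explicit ranks; [tends0P] relates
    it to filters. *)
Definition tends0 {R : realType} (f : nat -> R) : Prop :=
  forall e : R, 0 < e -> exists N, forall n, (N <= n)%N -> `|f n| <= e.

(** * Central limit theorem for mixing sequences *)

Section Blocks.
Context {d : measure_display} {T : measurableType d} {R : realType}.
Variable P : probability T R.
Variables (X : nat -> T -> R) (beta c tau : nat -> R) (M : R).
Hypothesis mX : forall i, measurable_fun setT (X i).
Hypothesis M0 : 0 < M.
Hypothesis XM : forall i w, `|X i w| <= M.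
Hypothesis X0 : forall i, Ex P (X i) = 0.
Hypothesis c0 : forall k, 0 <= c k.
Hypothesis Xc : forall i j, (i <= j)%N -> `|Ex P (fun w => X i w * X j w)| <= c (j - i).
Hypothesis ctau : forall q N, \sum_(q <= k < N) c k <= tau q.
Hypothesis mix : forall Q m q l,
  amix P (beta q) (psum X Q 0 m) (psum X predT (m + q) (m + q + l)).

Let X2 i : L1 P (fun w => X i w ^+ 2).
Proof.
apply: (L1_bdd (M ^+ 2)); first exact: measurable_funX.
by move=> w; rewrite normrX lerXn2r ?nnegrE// ltW.
Qed.

Let t0 : 0 <= tau 0.
Proof. by have := ctau 0 0; rewrite big_geq. Qed.

Let beta0 q : 0 <= beta q.
Proof. by have := mix predT 0 q 0 measurable0 measurable0; apply: le_trans. Qed.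

Variables (u : R) (p q : nat).
Hypothesis p0 : (0 < p)%N.
(* Gaps of length q followed by blocks of length p: Q selects the indices in a
   block, Bb j is the sum over the j-th block and Tb j over the first j blocks. *)
Let s := (q + p)%N.
Let Q := fun i : nat => (q <= i %% s)%N.
Let Tb j := psum X Q 0 (j * s).
Let Bb j := psum X predT (j * s + q) (j * s + q + p).

Lemma block_split (F : nat -> R) (A : pred nat) j :
  \sum_(0 <= i < j.+1 * s | A i) F i = \sum_(0 <= i < j * s | A i) F i +
  (\sum_(j * s <= i < j * s + q | A i) F i + \sum_(j * s + q <= i < j * s + q + p | A i) F i).
Proof.
rewrite (@big_cat_nat _ _ _ (j * s))//=; last by rewrite leq_mul2r leqnSn orbT.
rewrite (@big_cat_nat _ _ _ (j * s + q) _ (j.+1 * s))//= ?leq_addr//; last first.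
  by rewrite mulSn addnC leq_add2r leq_addr.
by rewrite mulSn [(s + _)%N]addnC addnA.
Qed.

Lemma mod_gap j i : (j * s <= i < j * s + q)%N -> Q i = false.
Proof.
move=> /andP[ji iq]; rewrite /Q -(subnKC ji) modnMDl; apply/negbTE; rewrite -ltnNge.
have h : (i - j * s < q)%N by rewrite ltn_subLR.
by rewrite modn_small// (leq_trans h)// leq_addr.
Qed.

Lemma mod_block j i : (j * s + q <= i < j * s + q + p)%N -> Q i.
Proof.
move=> /andP[ji iq]; have ji' := leq_trans (leq_addr _ _) ji.
rewrite /Q -(subnKC ji') modnMDl modn_small; first by rewrite leq_subRL.
by rewrite ltn_subLR// addnA.
Qed.

Lemma TbS j w : Tb j.+1 w = Tb j w + Bb j w.
Proof.
rewrite /Tb /psum block_split; congr (_ + _).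
rewrite big_nat_cond big_pred0 ?add0r => [|i]; last first.
  by case: (boolP (_ <= i < _)%N) => // /mod_gap ->.
rewrite big_nat_cond [RHS]big_nat_cond; apply: eq_bigl => i.
by case: (boolP (_ <= i < _)%N) => // /mod_block ->.
Qed.

Lemma count_gap j : \sum_(0 <= i < j * s | ~~ Q i) 1 = (j * q)%:R :> R.
Proof.
elim: j => [|j IH]; first by rewrite !mul0n big_geq.
rewrite block_split IH [X in _ + (_ + X)]big_nat_cond big_pred0 ?addr0 => [|i]; last first.
  by case: (boolP (_ <= i < _)%N) => // /mod_block ->.
rewrite big_nat_cond (eq_bigl (fun i => (j * s <= i < j * s + q)%N && true)) => [|i]; last first.
  by case: (boolP (_ <= i < _)%N) => // /mod_gap ->.
by rewrite -big_nat_cond sumr_const_nat addKn -natrD mulSn addnC.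
Qed.

Lemma count_all m n : \sum_(m <= i < n) 1 = (n - m)%:R :> R.
Proof. by rewrite sumr_const_nat. Qed.

Lemma count_le (A : pred nat) n : \sum_(0 <= i < n | A i) 1 <= n%:R :> R.
Proof.
rewrite -[X in _ <= X%:R]subn0 -count_all [leLHS]big_mkcond; apply: ler_sum => i _.
by case: ifP.
Qed.

Let mT j : measurable_fun setT (Tb j). Proof. exact: measurable_psum. Qed.
Let mB j : measurable_fun setT (Bb j). Proof. exact: measurable_psum. Qed.
Let LT2 j : L1 P (fun w => Tb j w ^+ 2). Proof. exact: L1_psum2. Qed.
Let LB2 j : L1 P (fun w => Bb j w ^+ 2). Proof. exact: L1_psum2. Qed.

Lemma block_var j : Ex P (fun w => Bb j w ^+ 2) <= 2 * tau 0 * p%:R.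
Proof.
have := psum_var mX X2 c0 Xc ctau predT (j * s + q) (j * s + q + p).
by rewrite count_all addKn.
Qed.

Lemma block_bdd j w : `|Bb j w| <= p%:R * M.
Proof.
apply: (le_trans (ler_norm_sum _ _ _)).
rewrite (@le_trans _ _ (\sum_(j * s + q <= i < j * s + q + p) M))//; first exact: ler_sum.
by rewrite sumr_const_nat addKn mulr_natl.
Qed.

(** Since |B| <= p M, the cube is at most p M times the square: a third moment costs one uniform
    bound and one variance. This is what takes the place of a Lindeberg condition. *)
Lemma block_abs3 j : L1 P (fun w => `|u * Bb j w| ^+ 3) /\
  Ex P (fun w => `|u * Bb j w| ^+ 3) <= `|u| ^+ 3 * (p%:R * M * (2 * tau 0 * p%:R)).
Proof.
have m3 : measurable_fun setT (fun w => `|u * Bb j w| ^+ 3).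
  by apply/measurable_funX/measurableT_comp => //; exact: measurable_funM.
have pM0 : 0 <= p%:R * M by rewrite mulr_ge0// ltW.
have le3 w : `|u * Bb j w| ^+ 3 <= `|u| ^+ 3 * (p%:R * M) * Bb j w ^+ 2.
  rewrite normrM exprMn -mulrA ler_wpM2l ?exprn_ge0//.
  rewrite exprS -(real_normK (num_real (Bb j w))) ler_wpM2r ?sqr_ge0//; exact: block_bdd.
have L := L1Z (`|u| ^+ 3 * (p%:R * M)) (LB2 j).
have L3 : L1 P (fun w => `|u * Bb j w| ^+ 3).
  by apply: (L1_dom m3 _ L) => w; rewrite ger0_norm ?exprn_ge0.
split => //; apply: (le_trans (Ex_le L3 L le3)); rewrite (ExZ _ (LB2 j)).
rewrite [leRHS]mulrA; apply: ler_wpM2l; first by rewrite mulr_ge0// exprn_ge0.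
exact: block_var.
Qed.

Lemma block_mean j : Ex P (Bb j) = 0.
Proof.
rewrite /Bb /psum Ex_sum; last by move=> i _; exact: L1_sq.
by rewrite big1.
Qed.

(** Size of the third-order Taylor remainder over one block. *)
Let W := `|u| ^+ 3 * (p%:R * M * (2 * tau 0 * p%:R)).

(** The linear term of the sine has mean zero, so only the cubic remainder is left. *)
Lemma block_sin j : `|Ex P (fun w => sin (u * Bb j w))| <= W.
Proof.
have [L3 E3] := block_abs3 j.
have LB := L1_sq (mB j) (LB2 j).
have -> : Ex P (fun w => sin (u * Bb j w)) = Ex P (fun w => sin (u * Bb j w) - u * Bb j w).
  by rewrite (ExB (L1_sinu _ u (mB j)) (L1Z u LB)) (ExZ _ LB) block_mean mulr0 subr0.
apply: le_trans E3; apply: Ex_abs_le => //.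
  by apply: measurable_funB; [exact: measurable_sinu|exact: measurable_funM].
by move=> w; exact: (sin_lin _).2.
Qed.

(** The expected cosine and the exponential share the expansion 1 - u^2 v / 2; they leave it by a
    third-order and a fourth-order term respectively. *)
Lemma block_cos j :
  `|Ex P (fun w => cos (u * Bb j w)) - expR (- (u ^+ 2 * Ex P (fun w => Bb j w ^+ 2) / 2))|
  <= W + (u ^+ 2 * (tau 0 * p%:R)) ^+ 2.
Proof.
have [L3 E3] := block_abs3 j.
set v := Ex P (fun w => Bb j w ^+ 2).
have v0 : 0 <= v by apply: Ex_ge0 => w; exact: sqr_ge0.
have vB : v <= 2 * tau 0 * p%:R := block_var j.
have A : `|Ex P (fun w => cos (u * Bb j w)) - (1 - u ^+ 2 * v / 2)| <= W.
  have L0 := L1Z (u ^+ 2 / 2) (LB2 j).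
  have -> : Ex P (fun w => cos (u * Bb j w)) - (1 - u ^+ 2 * v / 2) =
     Ex P (fun w => (cos (u * Bb j w) - cst 1 w) + (u ^+ 2 / 2) * Bb j w ^+ 2).
    rewrite (ExD (L1B (L1_cosu _ u (mB j)) (L1_cst 1)) L0).
    by rewrite (ExB (L1_cosu _ u (mB j)) (L1_cst 1)) (Ex_cst 1) (ExZ _ (LB2 j)) -/v; ring.
  apply: le_trans E3; apply: Ex_abs_le => //.
    exact: L1_meas (L1D (L1B (L1_cosu P u (mB j)) (L1_cst 1)) L0).
  move=> w; rewrite /cst [X in _ + X](_ : _ = (u * Bb j w) ^+ 2 / 2); last by ring.
  exact: cos_quad.
have x0 : 0 <= u ^+ 2 * v / 2 by rewrite divr_ge0// mulr_ge0// sqr_ge0.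
have B := expN_lin x0.
have C : (u ^+ 2 * v / 2) ^+ 2 <= (u ^+ 2 * (tau 0 * p%:R)) ^+ 2.
  rewrite ler_sqr ?nnegrE//; last by rewrite mulr_ge0 ?sqr_ge0// mulr_ge0.
  by rewrite -mulrA ler_wpM2l ?sqr_ge0//; lra.
rewrite (_ : Ex _ _ - _ = (Ex P (fun w => cos (u * Bb j w)) - (1 - u ^+ 2 * v / 2))
  - (expR (- (u ^+ 2 * v / 2)) - (1 - u ^+ 2 * v / 2))); last by ring.
by apply: (le_trans (ler_normB _ _)); apply: lerD => //; exact: le_trans B C.
Qed.

Let decouple (f g : R -> R) j : measurable_fun setT f -> measurable_fun setT g ->
  (forall x, `|f x| <= 1) -> (forall x, `|g x| <= 1) ->
  `|Ex P (fun w => f (Tb j w) * g (Bb j w)) - Ex P (fun w => f (Tb j w)) * Ex P (fun w => g (Bb j w))|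
  <= 4 * beta q.
Proof.
move=> mf mg f1 g1.
have := @cov_bdd _ _ _ P (f \o Tb j) (g \o Bb j) (beta q) 1 1 ltr01 ltr01.
rewrite !mulr1; apply => //.
- exact: measurableT_comp.
- exact: measurableT_comp.
- by move=> w; exact: f1.
- by move=> w; exact: g1.
- by apply: amix_comp => //; exact: mix.
Qed.

Let mcos : measurable_fun setT (fun x : R => cos (u * x)).
Proof. exact: (measurable_cosu u (@measurable_id _ _ setT)). Qed.
Let msin : measurable_fun setT (fun x : R => sin (u * x)).
Proof. exact: (measurable_sinu u (@measurable_id _ _ setT)). Qed.

Let LTB (f g : R -> R) j : measurable_fun setT f -> measurable_fun setT g ->
  (forall x, `|f x| <= 1) -> (forall x, `|g x| <= 1) ->
  L1 P (fun w => f (Tb j w) * g (Bb j w)).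
Proof.
move=> mf mg f1 g1; apply: (L1_bddM (M := 1)).
- exact: measurableT_comp mf (mT j).
- by move=> w; exact: f1.
- by apply: (L1_bdd 1) => [|w]; [exact: measurableT_comp mg (mB j)|exact: g1].
Qed.

Let cos1 x : `|cos (u * x)| <= 1. Proof. exact: cos_le1'. Qed.
Let sin1 x : `|sin (u * x)| <= 1. Proof. exact: sin_le1'. Qed.

(** Cost of adding one block: two decouplings at 4 [beta q] each, the cosine and sine remainders of
    the block, the second-order remainder of the exponential, and the covariance of the block with
    the past. *)
Definition block_err := 8 * beta q + 2 * W + (u ^+ 2 * (tau 0 * p%:R)) ^+ 2
  + u ^+ 2 * (p%:R * tau q).

Let W0 : 0 <= W.
Proof. by rewrite /W !mulr_ge0 ?exprn_ge0// ltW. Qed.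

Let tau0 k : 0 <= tau k.
Proof. by have := ctau k k; rewrite big_geq. Qed.

Lemma block_sin_step j : singap P u (Tb j.+1) <= singap P u (Tb j) + block_err.
Proof.
rewrite /singap.
rewrite (eq_Ex (fun w => sin (u * Tb j w) * cos (u * Bb j w) + cos (u * Tb j w) * sin (u * Bb j w))); last first.
  by move=> w; rewrite TbS mulrDr sinD.
rewrite (ExD (LTB j msin mcos sin1 cos1) (LTB j mcos msin cos1 sin1)).
have D1 := decouple j msin mcos sin1 cos1; have D2 := decouple j mcos msin cos1 sin1.
have bs := block_sin j.
have b1 : `|Ex P (fun w => cos (u * Bb j w))| <= 1.
  by apply: Ex_bdd => [|w]; [exact: measurable_cosu|exact: cos1].
have b2 : `|Ex P (fun w => cos (u * Tb j w))| <= 1.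
  by apply: Ex_bdd => [|w]; [exact: measurable_cosu|exact: cos1].
move: D1 D2 bs b1 b2; set e1 := Ex P _; set e2 := Ex P _; set e3 := Ex P _; set e4 := Ex P _.
set e5 := Ex P _; set e6 := Ex P _ => D1 D2 bs b1 b2.
have n1 : `|e2 * e3| <= `|e2| by rewrite normrM ler_piMr.
have n2 : `|e5 * e6| <= `|e6| by rewrite normrM ler_piMl.
have -> : e1 + e4 = (e1 - e2 * e3) + (e4 - e5 * e6) + (e2 * e3 + e5 * e6) by ring.
have r1 := ler_normD (e1 - e2 * e3 + (e4 - e5 * e6)) (e2 * e3 + e5 * e6).
have r2 := ler_normD (e1 - e2 * e3) (e4 - e5 * e6).
have r3 := ler_normD (e2 * e3) (e5 * e6).
have E : 8 * beta q + W <= block_err.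
  rewrite /block_err; have : 0 <= (u ^+ 2 * (tau 0 * p%:R)) ^+ 2 by exact: sqr_ge0.
  have : 0 <= u ^+ 2 * (p%:R * tau q) by rewrite mulr_ge0 ?sqr_ge0// mulr_ge0.
  by move: W0 => *; lra.
by lra.
Qed.

(** By the addition formula, after decoupling, the cosine part multiplies the transforms, while the
    sine product is small because the sine of the new block alone is. The product of the two
    exponentials misses the exponential of the new variance only by the cross covariance of
    [psum_cross]. *)
Lemma block_cos_step j : cosgap P u (Tb j.+1) <= cosgap P u (Tb j) + block_err.
Proof.
rewrite /cosgap.
rewrite (eq_Ex (fun w => cos (u * Tb j w) * cos (u * Bb j w) - sin (u * Tb j w) * sin (u * Bb j w))); last first.
  by move=> w; rewrite TbS mulrDr cosD.
rewrite (ExB (LTB j mcos mcos cos1 cos1) (LTB j msin msin sin1 sin1)).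
have D1 := decouple j mcos mcos cos1 cos1; have D2 := decouple j msin msin sin1 sin1.
have bs := block_sin j; have bc := block_cos j.
have b1 : `|Ex P (fun w => cos (u * Tb j w))| <= 1.
  by apply: Ex_bdd => [|w]; [exact: measurable_cosu|exact: cos1].
have b2 : `|Ex P (fun w => sin (u * Tb j w))| <= 1.
  by apply: Ex_bdd => [|w]; [exact: measurable_sinu|exact: sin1].
have cross := psum_cross mX X2 c0 Xc ctau Q (j * s) q p.
rewrite -/(Tb j) -/(Bb j) in cross.
have LTBm : L1 P (fun w => Tb j w * Bb j w) := L1_sqM (mT j) (mB j) (LT2 j) (LB2 j).
have VS : Ex P (fun w => Tb j.+1 w ^+ 2) = Ex P (fun w => Tb j w ^+ 2) + Ex P (fun w => Bb j w ^+ 2)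
   + 2 * Ex P (fun w => Tb j w * Bb j w).
  rewrite (eq_Ex (fun w => (Tb j w ^+ 2 + Bb j w ^+ 2) + 2 * (Tb j w * Bb j w))).
    by rewrite (ExD (L1D (LT2 j) (LB2 j)) (L1Z 2 LTBm)) (ExD (LT2 j) (LB2 j)) (ExZ _ LTBm).
  by move=> w; rewrite TbS; ring.
have vT0 : 0 <= Ex P (fun w => Tb j w ^+ 2) by apply: Ex_ge0 => w; exact: sqr_ge0.
have vB0 : 0 <= Ex P (fun w => Bb j w ^+ 2) by apply: Ex_ge0 => w; exact: sqr_ge0.
have vS0 : 0 <= Ex P (fun w => Tb j.+1 w ^+ 2) by apply: Ex_ge0 => w; exact: sqr_ge0.
move: D1 D2 bs bc b1 b2 VS cross vT0 vB0 vS0.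
set e1 := Ex P _; set e2 := Ex P _; set e3 := Ex P _; set e4 := Ex P _.
set e5 := Ex P _; set e6 := Ex P _; set vB := Ex P _; set vS := Ex P _; set vT := Ex P _; set x := Ex P _.
move=> D1 D2 bs bc b1 b2 VS cross vT0 vB0 vS0.
set gB := expR _ in bc; set gS := expR _; set gT := expR _.
have u0 : 0 <= u ^+ 2 by exact: sqr_ge0.
have gTB : `|gT * gB - gS| <= u ^+ 2 * (p%:R * tau q).
  rewrite /gT /gB -expRD -opprD; have h a : 0 <= a -> 0 <= u ^+ 2 * a / 2 by move=> a0; rewrite divr_ge0// mulr_ge0.
  apply: (le_trans (expN_lip (addr_ge0 (h _ vT0) (h _ vB0)) (h _ vS0))).
  rewrite VS [X in `|X|](_ : _ = - (u ^+ 2 * x)); last by field.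
  by rewrite normrN normrM (ger0_norm u0) ler_wpM2l.
have gB1 : 0 <= gB <= 1.
  rewrite /gB expR_ge0/= -expR0 ler_expR oppr_le0 divr_ge0// mulr_ge0//.
have -> : e1 - e4 - gS = (e1 - e2 * e3) - (e4 - e5 * e6) + (e2 * (e3 - gB) - e5 * e6)
   + ((e2 - gT) * gB + (gT * gB - gS)) by ring.
have n1 : `|e2 * (e3 - gB)| <= `|e3 - gB| by rewrite normrM ler_piMl.
have n2 : `|e5 * e6| <= `|e6| by rewrite normrM ler_piMl.
have n3 : `|(e2 - gT) * gB| <= `|e2 - gT|.
  by case/andP: gB1 => g0 g1; rewrite normrM ler_piMr// ger0_norm.
rewrite (_ : _ + block_err = 4 * beta q + 4 * beta q + (W + (u ^+ 2 * (tau 0 * p%:R)) ^+ 2 + W)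
  + (`|e2 - gT| + u ^+ 2 * (p%:R * tau q))); last by rewrite /block_err; ring.
apply: (le_trans (ler_normD _ _)); apply: lerD; last first.
  by apply: (le_trans (ler_normD _ _)); exact: lerD.
apply: (le_trans (ler_normD _ _)); apply: lerD.
  by apply: (le_trans (ler_normB _ _)); exact: lerD.
apply: (le_trans (ler_normB _ _)); apply: lerD; first exact: le_trans n1 bc.
exact: le_trans n2 bs.
Qed.

Let Tb0 w : Tb 0 w = 0.
Proof. by rewrite /Tb /psum mul0n big_geq. Qed.

Lemma block_gap k : cosgap P u (Tb k) <= k%:R * block_err /\ singap P u (Tb k) <= k%:R * block_err.
Proof.
elim: k => [|k [IHc IHs]].
  rewrite /cosgap /singap mul0r (eq_Ex (cst 1)) ?(Ex_cst 1); last by move=> w; rewrite Tb0 mulr0 cos0.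
  rewrite (eq_Ex (cst 0)) ?(Ex_cst 0); last by move=> w; rewrite Tb0 expr0n.
  rewrite mulr0 mul0r oppr0 expR0 subrr normr0; split=> //.
  by rewrite (eq_Ex (cst 0)) ?(Ex_cst 0) ?normr0// => w; rewrite Tb0 mulr0 sin0.
rewrite -natr1 mulrDl mul1r; split.
  by apply: (le_trans (block_cos_step k)); rewrite lerD2r.
by apply: (le_trans (block_sin_step k)); rewrite lerD2r.
Qed.

(** What is missing consists of the gaps and the incomplete last period. The 4 is 2 from the square
    of a sum of two terms and 2 from [psum_var]. *)
Lemma block_rest n k : (k * s <= n)%N ->
  Ex P (fun w => (psum X predT 0 n w - Tb k w) ^+ 2) <= 4 * tau 0 * ((k * q)%:R + (n - k * s)%:R).
Proof.
move=> kn; pose R1 := psum X (predC Q) 0 (k * s); pose R2 := psum X predT (k * s) n.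
have E w : psum X predT 0 n w - Tb k w = R1 w + R2 w.
  rewrite /Tb /R1 /R2 /psum (@big_cat_nat _ _ _ (k * s) _ n)//=.
  by rewrite (bigID Q (fun=> true))/=; ring.
under eq_Ex do rewrite E.
have L1' : L1 P (fun w => R1 w ^+ 2) by exact: L1_psum2.
have L2' : L1 P (fun w => R2 w ^+ 2) by exact: L1_psum2.
apply: (@le_trans _ _ (Ex P (fun w => 2 * R1 w ^+ 2 + 2 * R2 w ^+ 2))).
  apply: Ex_le.
  - by apply: L1_sqD => //; exact: measurable_psum.
  - exact: L1D (L1Z _ _) (L1Z _ _).
  - by move=> w; have := sqr_ge0 (R1 w - R2 w); nra.
rewrite (ExD (L1Z 2 L1') (L1Z 2 L2')) (ExZ _ L1') (ExZ _ L2').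
have := psum_var mX X2 c0 Xc ctau (predC Q) 0 (k * s).
have := psum_var mX X2 c0 Xc ctau predT (k * s) n.
rewrite -/R1 -/R2 count_all count_gap.
by move=> *; lra.
Qed.

(** Here [rest] is the price, through [cosgap_compare], of putting the gaps and the incomplete last
    period back. *)
Lemma clt_bound n eta : 0 < eta ->
  let k := (n %/ s)%N in
  let rest := eta + 2 * (u ^+ 2 * (4 * tau 0 * ((k * q)%:R + s%:R)) / eta) + eta * u ^+ 2 * (2 * tau 0 * n%:R) in
  cosgap P u (psum X predT 0 n) <= k%:R * block_err + rest /\
  singap P u (psum X predT 0 n) <= k%:R * block_err + rest.
Proof.
move=> eta0 k rest.
have s0 : (0 < s)%N by rewrite addn_gt0 p0 orbT.
have kn : (k * s <= n)%N by exact: leq_divM.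
have D : Ex P (fun w => (psum X predT 0 n w - Tb k w) ^+ 2) <= 4 * tau 0 * ((k * q)%:R + s%:R).
  apply: (le_trans (block_rest kn)); rewrite ler_wpM2l ?mulr_ge0// lerD2l ler_nat.
  by rewrite leq_subLR {1}(divn_eq n s) leq_add2l ltnW// ltn_pmod.
have VS : Ex P (fun w => psum X predT 0 n w ^+ 2) <= 2 * tau 0 * n%:R.
  apply: (le_trans (psum_var mX X2 c0 Xc ctau _ _ _)).
  by rewrite ler_wpM2l ?mulr_ge0// count_le.
have VT : Ex P (fun w => Tb k w ^+ 2) <= 2 * tau 0 * n%:R.
  apply: (le_trans (psum_var mX X2 c0 Xc ctau _ _ _)).
  by rewrite ler_wpM2l ?mulr_ge0// (le_trans (count_le _ _))// ler_nat.
have [gc gs] := block_gap k.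
have mS : measurable_fun setT (psum X predT 0 n) by exact: measurable_psum.
have LS : L1 P (fun w => psum X predT 0 n w ^+ 2) by exact: L1_psum2.
split.
  apply: (le_trans (cosgap_compare u mS (mT k) LS (LT2 k) eta0 D VS VT)).
  by rewrite lerD2r.
apply: (le_trans (singap_compare u mS (mT k) LS (LT2 k) eta0 D)).
apply: lerD => //; rewrite /rest -!addrA lerD2l.
have V0 : 0 <= eta * u ^+ 2 * (2 * tau 0 * n%:R).
  by apply: mulr_ge0; [apply: mulr_ge0; [exact: ltW|exact: sqr_ge0]|rewrite !mulr_ge0].
have D0 : 0 <= u ^+ 2 * (4 * tau 0 * ((k * q)%:R + s%:R)) / eta.
  by rewrite divr_ge0 ?(ltW eta0)// mulr_ge0 ?sqr_ge0// mulr_ge0// mulr_ge0.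
by lra.
Qed.

End Blocks.

Lemma ex_sqrt_ge {R : realType} (x : R) : exists N, forall n, (N <= n)%N -> x <= Num.sqrt n%:R.
Proof.
exists (Num.truncn (x ^+ 2)).+1 => n Nn.
have x2 : x ^+ 2 <= n%:R.
  apply: ltW; apply: lt_le_trans (truncnS_gt (x ^+ 2)) _; by rewrite ler_nat.
by apply: le_trans (ler_norm x) _; rewrite -sqrtr_sqr ler_wsqrtr.
Qed.

Lemma ex_nat_ge {R : realType} (x : R) : exists a, (0 < a)%N /\ x <= a%:R.
Proof. by exists (Num.truncn x).+1; split=> //; exact: ltW (truncnS_gt x). Qed.

(** * Bounded variables: choice of the block lengths *)

Section BoundedCLT.
Context {d : measure_display} {T : measurableType d} {R : realType}.
Variable P : probability T R.
Variables (X : nat -> T -> R) (beta c tau : nat -> R) (M : R).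
Hypothesis mX : forall i, measurable_fun setT (X i).
Hypothesis M0 : 0 < M.
Hypothesis XM : forall i w, `|X i w| <= M.
Hypothesis X0 : forall i, Ex P (X i) = 0.
Hypothesis c0 : forall k, 0 <= c k.
Hypothesis Xc : forall i j, (i <= j)%N -> `|Ex P (fun w => X i w * X j w)| <= c (j - i).
Hypothesis ctau : forall q N, \sum_(q <= k < N) c k <= tau q.
Hypothesis mix : forall Q m q l,
  amix P (beta q) (psum X Q 0 m) (psum X predT (m + q) (m + q + l)).
Hypothesis beta_lim : tends0 (fun q => q%:R * beta q).
Hypothesis tau_lim : tends0 tau.

(** With gaps of length q close to r / a^2 and blocks of length a q, every error is of one of four
    kinds: a multiple of [eta], of 1/a, of 1/r, or, for fixed [a], a quantity that vanishes as [q]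
    grows. *)
Lemma block_total (t eta : R) (a n : nat) (r := Num.sqrt n%:R : R) (q := Num.truncn (r / a%:R ^+ 2))
  (k := (n %/ (q + a * q))%N) (u := t / r) :
  0 < eta -> (0 < a)%N -> 1 <= r -> (0 < q)%N ->
  k%:R * block_err beta tau M u (a * q) q +
    (eta + 2 * (u ^+ 2 * (4 * tau 0 * ((k * q)%:R + (q + a * q)%:R)) / eta) + eta * u ^+ 2 * (2 * tau 0 * n%:R))
  <= 32 * a%:R ^+ 3 * (q%:R * beta q) + t ^+ 2 * tau q + (1 + 2 * tau 0 * t ^+ 2) * eta
     + (4 * `|t| ^+ 3 * M * tau 0 + 8 * tau 0 * t ^+ 2 / eta) / a%:R
     + (t ^+ 4 * tau 0 ^+ 2 + 16 * tau 0 * t ^+ 2 / eta) / r.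
Proof.
move=> eta0 a0 r1 q0.
have t0 : 0 <= tau 0 by have := ctau 0 0; rewrite big_geq.
have tq0 : 0 <= tau q by have := ctau q q; rewrite big_geq.
have b0 : 0 <= beta q by have := mix predT 0 q 0 measurable0 measurable0; apply: le_trans.
have r0 : 0 < r by apply: lt_le_trans r1.
have A0 : 0 < a%:R :> R by rewrite ltr0n.
have A1 : 1 <= a%:R :> R by rewrite ler1n.
have Q0 : 0 < q%:R :> R by rewrite ltr0n.
have Q1 : 1 <= q%:R :> R by rewrite ler1n.
have rn : r ^+ 2 = n%:R by rewrite sqr_sqrtr.
have x0 : 0 <= r / a%:R ^+ 2 by rewrite divr_ge0// ltW.
have qle : q%:R * a%:R ^+ 2 <= r.
  by rewrite -ler_pdivlMr ?exprn_gt0// /q truncn_le.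
(* Since q >= 1, the integer part loses at most a factor 2. The matching lower bound on [q] is what
   makes the number of blocks at most 4 a^3 q. *)
have qgt : r <= 2 * q%:R * a%:R ^+ 2.
  rewrite -ler_pdivrMr ?exprn_gt0//; apply: ltW.
  apply: (lt_le_trans (truncnS_gt _)); rewrite -/q -natr1; lra.
have kn : k%:R * (q%:R + a%:R * q%:R) <= r ^+ 2.
  by rewrite rn -natrM -natrD -natrM ler_nat leq_divM.
have K0 : 0 <= k%:R :> R by [].
have ir0 : 0 < r^-1 by rewrite invr_gt0.
have ia0 : 0 < a%:R^-1 :> R by rewrite invr_gt0.
(* Share of the n indices lying in blocks. *)
pose y := k%:R * (a%:R * q%:R) / r ^+ 2.
have y0 : 0 <= y by rewrite /y divr_ge0 ?mulr_ge0 ?exprn_ge0 ?(ltW r0).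
have y1 : y <= 1.
  rewrite /y ler_pdivrMr ?exprn_gt0// mul1r; apply: le_trans kn.
  by rewrite ler_wpM2l// ler_wpDl.
(* Block length relative to sqrt n. The third-order errors are proportional to z y, hence at most of
   order 1/a. *)
pose z := a%:R * q%:R / r.
have z0 : 0 <= z by rewrite /z divr_ge0 ?mulr_ge0 ?(ltW r0).
have za : z <= a%:R^-1.
  rewrite /z ler_pdivrMr// ler_pdivlMl//; apply: le_trans qle.
  by rewrite le_eqVlt; apply/orP; left; apply/eqP; ring.
have z1 : z <= 1 by apply: (le_trans za); rewrite invf_le1.
have kq : k%:R <= 4 * a%:R ^+ 3 * q%:R :> R.
  have h : k%:R * (a%:R * q%:R) <= 4 * a%:R ^+ 3 * q%:R * (a%:R * q%:R) :> R.
    apply: (@le_trans _ _ (r ^+ 2)).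
      by apply: le_trans kn; rewrite ler_wpM2l// ler_wpDl.
    apply: (@le_trans _ _ ((2 * q%:R * a%:R ^+ 2) ^+ 2)).
      by rewrite ler_sqr ?nnegrE ?mulr_ge0 ?exprn_ge0 ?(ltW r0) ?(ltW A0).
    by rewrite le_eqVlt; apply/orP; left; apply/eqP; ring.
  by move: h; rewrite ler_pM2r// mulr_gt0.
have E1 : 8 * (k%:R * beta q) <= 32 * a%:R ^+ 3 * (q%:R * beta q).
  by have := ler_wpM2r b0 kq; lra.
have unr : u ^+ 2 * n%:R = t ^+ 2 by rewrite -rn /u; field; rewrite gt_eqF.
have E2 : k%:R * (2 * (`|u| ^+ 3 * ((a * q)%:R * M * (2 * tau 0 * (a * q)%:R)))) <=
   4 * `|t| ^+ 3 * M * tau 0 / a%:R.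
  rewrite /u normrM normrV ?unitfE ?gt_eqF// (gtr0_norm r0) natrM.
  have -> : k%:R * (2 * ((`|t| / r) ^+ 3 * (a%:R * q%:R * M * (2 * tau 0 * (a%:R * q%:R)))))
     = 4 * `|t| ^+ 3 * M * tau 0 * (z * y) by rewrite /z /y; field; rewrite gt_eqF.
  apply: ler_wpM2l; first by rewrite !mulr_ge0 ?exprn_ge0// ltW.
  by apply: le_trans za; rewrite ler_piMr.
have E3 : k%:R * (u ^+ 2 * (tau 0 * (a * q)%:R)) ^+ 2 <= t ^+ 4 * tau 0 ^+ 2 / r.
  rewrite natrM /u.
  have -> : k%:R * ((t / r) ^+ 2 * (tau 0 * (a%:R * q%:R))) ^+ 2 = t ^+ 4 * tau 0 ^+ 2 / r * (z * y).
    by rewrite /z /y; field; rewrite gt_eqF.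
  apply: ler_piMr; last by apply: mulr_ile1.
  by rewrite divr_ge0 ?(ltW r0)// mulr_ge0 ?sqr_ge0//; rewrite (_ : 4 = 2 * 2)%N// exprM sqr_ge0.
have E4 : k%:R * (u ^+ 2 * ((a * q)%:R * tau q)) <= t ^+ 2 * tau q.
  rewrite natrM /u.
  have -> : k%:R * ((t / r) ^+ 2 * (a%:R * q%:R * tau q)) = t ^+ 2 * tau q * y.
    by rewrite /y; field; rewrite gt_eqF.
  by apply: ler_piMr => //; rewrite mulr_ge0// sqr_ge0.
have E5 : 2 * (u ^+ 2 * (4 * tau 0 * ((k * q)%:R + (q + a * q)%:R)) / eta) <=
   8 * tau 0 * t ^+ 2 / eta * (a%:R^-1 + 2 / r).
  rewrite natrD !natrM /u.
  have -> : 2 * ((t / r) ^+ 2 * (4 * tau 0 * (k%:R * q%:R + (q%:R + a%:R * q%:R))) / eta) =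
     8 * tau 0 * t ^+ 2 / eta * (y / a%:R + (z / a%:R + z) / r).
    by rewrite /y /z; field; rewrite ?gt_eqF.
  apply: ler_wpM2l; first by apply: divr_ge0 (ltW eta0); apply: mulr_ge0 (sqr_ge0 t); exact: mulr_ge0.
  apply: lerD; first by rewrite ler_piMl// ltW.
  apply: ler_wpM2r; first exact: ltW.
  have : z / a%:R <= 1 by rewrite mulr_ile1 ?invf_le1 ?(ltW ia0).
  by lra.
have E6 : eta * u ^+ 2 * (2 * tau 0 * n%:R) = 2 * tau 0 * t ^+ 2 * eta.
  by rewrite -unr; ring.
rewrite /block_err E6.
rewrite [leLHS](_ : _ = 8 * (k%:R * beta q) + k%:R * (2 * (`|u| ^+ 3 * ((a * q)%:R * M * (2 * tau 0 * (a * q)%:R))))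
   + k%:R * (u ^+ 2 * (tau 0 * (a * q)%:R)) ^+ 2 + k%:R * (u ^+ 2 * ((a * q)%:R * tau q))
   + 2 * (u ^+ 2 * (4 * tau 0 * ((k * q)%:R + (q + a * q)%:R)) / eta) + (eta + 2 * tau 0 * t ^+ 2 * eta)); last by ring.
rewrite [leRHS](_ : _ = 32 * a%:R ^+ 3 * (q%:R * beta q) + 4 * `|t| ^+ 3 * M * tau 0 / a%:R
   + t ^+ 4 * tau 0 ^+ 2 / r + t ^+ 2 * tau q + 8 * tau 0 * t ^+ 2 / eta * (a%:R^-1 + 2 / r)
   + (eta + 2 * tau 0 * t ^+ 2 * eta)); last by ring.
by do 5 (apply: lerD => //).
Qed.

Lemma bounded_clt (t e : R) : 0 < e -> exists N, forall n, (N <= n)%N ->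
  cosgap P (t / Num.sqrt n%:R) (psum X predT 0 n) <= e /\
  singap P (t / Num.sqrt n%:R) (psum X predT 0 n) <= e.
Proof.
move=> e0.
have t0 : 0 <= tau 0 by have := ctau 0 0; rewrite big_geq.
have K0 : 0 < 1 + 2 * tau 0 * t ^+ 2 by rewrite ltr_wpDr//; apply: mulr_ge0 (sqr_ge0 t); exact: mulr_ge0.
(* The order of choice matters: [eta] first, then [a] from [K1], which contains 1/eta, and the rank
   of n last, since a^3 multiplies q beta(q). Five terms of size e/6 result. *)
pose eta := e / 6 / (1 + 2 * tau 0 * t ^+ 2).
have eta0 : 0 < eta by rewrite !divr_gt0.
pose K1 := 4 * `|t| ^+ 3 * M * tau 0 + 8 * tau 0 * t ^+ 2 / eta.
pose K2 := t ^+ 4 * tau 0 ^+ 2 + 16 * tau 0 * t ^+ 2 / eta.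
have [a [a0 aK]] := ex_nat_ge (K1 / (e / 6)).
have A0 : 0 < a%:R :> R by rewrite ltr0n.
have e1 : 0 < e / 6 / (32 * a%:R ^+ 3) by rewrite divr_gt0// ?mulr_gt0 ?exprn_gt0// divr_gt0.
have e2 : 0 < e / 6 / (t ^+ 2 + 1) by rewrite divr_gt0// ?divr_gt0// ltr_wpDl// sqr_ge0.
have [q1 Hq1] := beta_lim e1; have [q2 Hq2] := tau_lim e2.
have [N1 HN1] := ex_sqrt_ge (K2 / (e / 6)).
have [N2 HN2] := ex_sqrt_ge ((q1 + q2).+1%:R * a%:R ^+ 2 : R).
have [N3 HN3] := ex_sqrt_ge (1 : R).
exists (N1 + N2 + N3)%N => n Nn.
have n1 := HN1 n (leq_trans (leq_trans (leq_addr N2 N1) (leq_addr N3 _)) Nn).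
have n2 := HN2 n (leq_trans (leq_trans (leq_addl N1 N2) (leq_addr N3 _)) Nn).
have n3 := HN3 n (leq_trans (leq_addl (N1 + N2) N3) Nn).
pose r : R := Num.sqrt n%:R; pose q := Num.truncn (r / a%:R ^+ 2).
have r0 : 0 < r by apply: lt_le_trans n3.
have qq : ((q1 + q2).+1 <= q)%N.
  by rewrite /q truncn_ge_nat ?divr_ge0 ?exprn_ge0 ?(ltW r0) ?(ltW A0)// ler_pdivlMr ?exprn_gt0.
have q0 : (0 < q)%N by apply: leq_trans qq.
have aq0 : (0 < a * q)%N by rewrite muln_gt0 a0.
have := @block_total t eta a n eta0 a0 n3 q0.
set bnd := (X in X -> _) => H.
have [gc gs] := clt_bound mX M0 XM X0 c0 Xc ctau mix (t / r) q aq0 n eta0.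
have rhs : 32 * a%:R ^+ 3 * (q%:R * beta q) + t ^+ 2 * tau q + (1 + 2 * tau 0 * t ^+ 2) * eta
     + K1 / a%:R + K2 / r <= e.
  have h1 : 32 * a%:R ^+ 3 * (q%:R * beta q) <= e / 6.
    rewrite mulrC -ler_pdivlMr ?mulr_gt0 ?exprn_gt0//; apply: le_trans (ler_norm _) _.
    by apply: Hq1; rewrite (leq_trans _ qq)// leqW// leq_addr.
  have h2 : t ^+ 2 * tau q <= e / 6.
    have tq : 0 <= tau q by have := ctau q q; rewrite big_geq.
    apply: (@le_trans _ _ ((t ^+ 2 + 1) * tau q)); first by rewrite ler_wpM2r// lerDl.
    rewrite mulrC -ler_pdivlMr ?ltr_wpDl ?sqr_ge0//; apply: le_trans (ler_norm _) _.
    by apply: Hq2; rewrite (leq_trans _ qq)// leqW// leq_addl.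
  have h3 : (1 + 2 * tau 0 * t ^+ 2) * eta = e / 6.
    by rewrite /eta; field; rewrite gt_eqF.
  have h4 : K1 / a%:R <= e / 6.
    by rewrite ler_pdivrMr// mulrC -ler_pdivrMr// divr_gt0.
  have h5 : K2 / r <= e / 6.
    by rewrite ler_pdivrMr// mulrC -ler_pdivrMr// divr_gt0.
  by lra.
have tot := le_trans H rhs.
by split; [exact: le_trans gc tot|exact: le_trans gs tot].
Qed.

End BoundedCLT.

(** * Unbounded variables, by truncation *)

Section MomentCLT.
Context {d : measure_display} {T : measurableType d} {R : realType}.
Variable P : probability T R.
Variables (X : nat -> T -> R) (beta gam : nat -> R) (s B : R).
Hypothesis s2 : 2 < s.
Local Notation ex := (1 - 2 / s).
Hypothesis mX : forall i, measurable_fun setT (X i).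
Hypothesis X0 : forall i, Ex P (X i) = 0.
Hypothesis XL : forall i, L1 P (fun w => `|X i w| `^ s).
Hypothesis XB : forall i, Ex P (fun w => `|X i w| `^ s) <= B.
Hypothesis mixall : forall f : nat -> R -> R, (forall i, measurable_fun setT (f i)) ->
  forall Q m q l, amix P (beta q) (psum (fun i => f i \o X i) Q 0 m)
                                  (psum (fun i => f i \o X i) predT (m + q) (m + q + l)).
Hypothesis beta1 : forall k, beta k <= 1.
Hypothesis beta_lim : tends0 (fun q => q%:R * beta q).
Hypothesis gamE : forall q N, \sum_(q <= k < N) beta k `^ ex <= gam q.
Hypothesis gam_lim : tends0 gam.

Let mid : measurable_fun setT (@id R).
Proof. exact: measurable_id. Qed.

Let beta0 q : 0 <= beta q.
Proof.
have := mixall (f := fun=> id) (fun=> mid) predT 0 q 0 measurable0 measurable0.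
by apply: le_trans.
Qed.

Let gam0 q : 0 <= gam q.
Proof. by have := gamE q q; rewrite big_geq. Qed.

Let B0 : 0 <= B.
Proof. by apply: le_trans (XB 0%N); apply: Ex_ge0 => w; exact: powR_ge0. Qed.

Let ex0 : 0 < ex.
Proof. by have s0 : 0 < s := lt_trans (ltr0n R 2) s2; rewrite subr_gt0 ltr_pdivrMr// mul1r. Qed.

Let ex1 : ex <= 1.
Proof. by have s0 : 0 < s := lt_trans (ltr0n R 2) s2; rewrite lerBlDr lerDl divr_ge0// ltW. Qed.

Lemma beta_le_pow k : beta k <= beta k `^ ex.
Proof.
have [->|b0] := eqVneq (beta k) 0; first exact: powR_ge0.
have bk : 0 < beta k by rewrite lt_def b0 beta0.
rewrite -{1}(powRr1 (beta0 k)) /powR (negbTE b0) ler_expR ler_wnM2r//.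
by rewrite ln_le0.
Qed.

(** A selector reduced to [i] and a future of length 1 isolate one term on each side. The past stops
    at i + 1, so the gap is j - i - 1 and not j - i. *)
Lemma pair_amix (f : nat -> R -> R) i j : (forall i, measurable_fun setT (f i)) ->
  (i < j)%N -> amix P (beta (j - i.+1)) (f i \o X i) (f j \o X j).
Proof.
move=> mf ij; have := mixall mf (pred1 i) i.+1 (j - i.+1) 1.
rewrite subnKC// addn1.
rewrite (_ : psum _ (pred1 i) 0 i.+1 = f i \o X i); last first.
  apply/funext => w; rewrite /psum big_mkcond/= big_nat_recr//= eqxx big_nat_cond big1 ?add0r//.
  by move=> l; rewrite andbT => /andP[_ li]; rewrite (ltn_eqF li).
rewrite (_ : psum _ predT j j.+1 = f j \o X j)//.
by apply/funext => w; rewrite /psum big_nat1.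
Qed.

(** Lag k + 1 leaves a gap of [k], whence the shift. Lag 0 gets no help from mixing and has its own
    constant; [lagtail] bounds the tail sums. *)
Definition lagbound (K0 K1 : R) (k : nat) : R := if k is k'.+1 then K1 * beta k' `^ ex else K0.

Definition lagtail (K0 K1 : R) (q : nat) : R := if q is q'.+1 then K1 * gam q' else K0 + K1 * gam 0.

Lemma lagbound_ge0 K0 K1 k : 0 <= K0 -> 0 <= K1 -> 0 <= lagbound K0 K1 k.
Proof. by case: k => //= k K00 K10; rewrite mulr_ge0// powR_ge0. Qed.

Lemma lagtailE K0 K1 q N : 0 <= K0 -> 0 <= K1 ->
  \sum_(q <= k < N) lagbound K0 K1 k <= lagtail K0 K1 q.
Proof.
move=> K00 K10.
have H q' N' : \sum_(q'.+1 <= k < N'.+1) lagbound K0 K1 k <= K1 * gam q'.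
  by rewrite big_add1/= -mulr_sumr ler_wpM2l.
case: q N => [|q] [|N].
- by rewrite big_geq//= addr_ge0// mulr_ge0.
- by rewrite big_ltn//= lerD2l H.
- by rewrite big_geq//= mulr_ge0.
- exact: H.
Qed.

Lemma lagtail_lim K0 K1 : 0 <= K1 -> tends0 (lagtail K0 K1).
Proof.
move=> K10 e e0; have [N HN] : exists N, forall n, (N <= n)%N -> `|gam n| <= e / (K1 + 1).
  by apply: gam_lim; rewrite divr_gt0//; lra.
exists N.+1 => -[//|n] Nn /=; rewrite normrM (ger0_norm K10).
have := HN n Nn; rewrite ler_pdivlMr; last by lra.
by have := normr_ge0 (gam n); nra.
Qed.

Let X2 i : L1 P (fun w => X i w ^+ 2).
Proof. exact: L1_powR_sq (ltW s2) (mX i) (XL i). Qed.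

Let LX i : L1 P (X i).
Proof. exact: L1_sq. Qed.

Local Notation K := (4 + 6 * B).

Let K_ge0 : 0 <= K.
Proof. by have := B0; lra. Qed.

Lemma moment_cov i j : (i <= j)%N ->
  `|Ex P (fun w => X i w * X j w)| <= lagbound (1 + B) K (j - i).
Proof.
rewrite leq_eqVlt => /predU1P[<-|ij].
  rewrite subnn /= (eq_Ex (fun w => X i w ^+ 2)) => [|w]; last by rewrite expr2.
  rewrite ger0_norm; last by apply: Ex_ge0 => w; exact: sqr_ge0.
  apply: (@le_trans _ _ (Ex P (fun w => cst 1 w + `|X i w| `^ s))).
    apply: Ex_le => //; first by apply: L1D => //; exact: L1_cst.
    by move=> w; exact/sq_le_powR/ltW.
  by rewrite (ExD (L1_cst 1) (XL i)) (Ex_cst 1) lerD2l.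
have -> : Ex P (fun w => X i w * X j w) = cov P (X i) (X j) by rewrite /cov !X0 mul0r subr0.
rewrite -(subnSK ij) /=; apply: davydov => //.
exact: (pair_amix (f := fun=> id) (fun=> mid) ij).
Qed.

Section Truncated.
Variables (M : R) (M0 : 0 < M).

Definition trunc i w : R := clip M (X i w) - Ex P (fun w => clip M (X i w)).
Definition remdr i w : R := X i w - clip M (X i w).

Let mC i : measurable_fun setT (fun w => clip M (X i w)).
Proof. exact: measurableT_comp (measurable_clip _) (mX i). Qed.

Let CM i w : `|clip M (X i w)| <= M.
Proof. exact/clip_bdd/ltW. Qed.

Let LC i : L1 P (fun w => clip M (X i w)).
Proof. exact: L1_bdd (CM i). Qed.

Lemma measurable_trunc i : measurable_fun setT (trunc i).
Proof. exact: measurable_funB. Qed.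

Lemma trunc_bdd i w : `|trunc i w| <= 2 * M.
Proof.
rewrite /trunc; apply: (le_trans (ler_normB _ _)); rewrite mulrDl mul1r lerD//.
exact: Ex_bdd.
Qed.

Lemma trunc_mean i : Ex P (trunc i) = 0.
Proof. by rewrite /trunc (ExB (LC i) (L1_cst _)) (Ex_cst (Ex P _)) subrr. Qed.

Lemma mix_trunc Q m q l : amix P (beta q) (psum trunc Q 0 m) (psum trunc predT (m + q) (m + q + l)).
Proof.
apply: (mixall (f := fun i x => clip M x - Ex P (fun w => clip M (X i w)))) => i.
by apply: measurable_funB => //; exact: measurable_clip.
Qed.

Lemma trunc_cov i j : (i <= j)%N ->
  `|Ex P (fun w => trunc i w * trunc j w)| <= lagbound (4 * M ^+ 2) (16 * M ^+ 2) (j - i).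
Proof.
rewrite leq_eqVlt => /predU1P[<-|ij].
  rewrite subnn/= (_ : 4 * M ^+ 2 = (2 * M) ^+ 2); last by ring.
  apply: Ex_bdd; first by apply: measurable_funM; exact: measurable_trunc.
  by move=> w; rewrite -expr2 normrX lerXn2r ?nnegrE ?trunc_bdd// mulr_ge0// ltW.
have -> : Ex P (fun w => trunc i w * trunc j w) = cov P (trunc i) (trunc j).
  by rewrite /cov !trunc_mean mul0r subr0.
have M20 : 0 < 2 * M by rewrite mulr_gt0.
have am : amix P (beta (j - i.+1)) (trunc i) (trunc j).
  apply: (pair_amix (f := fun i x => clip M x - Ex P (fun w => clip M (X i w)))) => // k.
  by apply: measurable_funB => //; exact: measurable_clip.
have := cov_bdd M20 M20 (measurable_trunc i) (measurable_trunc j) (trunc_bdd i) (trunc_bdd j) am.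
rewrite -(subnSK ij) /= => /le_trans; apply.
rewrite (_ : 4 * _ * _ * _ = 16 * M ^+ 2 * beta (j - i.+1)); last by ring.
by rewrite ler_wpM2l ?beta_le_pow// mulr_ge0// sqr_ge0.
Qed.

Lemma trunc_clt (t e : R) : 0 < e -> exists N, forall n, (N <= n)%N ->
  cosgap P (t / Num.sqrt n%:R) (psum trunc predT 0 n) <= e /\
  singap P (t / Num.sqrt n%:R) (psum trunc predT 0 n) <= e.
Proof.
have a0 : 0 <= 4 * M ^+ 2 by rewrite mulr_ge0// sqr_ge0.
have b0 : 0 <= 16 * M ^+ 2 by rewrite mulr_ge0// sqr_ge0.
apply: (@bounded_clt _ _ _ P trunc beta (lagbound (4 * M ^+ 2) (16 * M ^+ 2))
  (lagtail (4 * M ^+ 2) (16 * M ^+ 2)) (2 * M)).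
- exact: measurable_trunc.
- by rewrite mulr_gt0.
- exact: trunc_bdd.
- exact: trunc_mean.
- by move=> k; exact: lagbound_ge0.
- exact: trunc_cov.
- by move=> q N; exact: lagtailE.
- exact: mix_trunc.
- exact: beta_lim.
- exact: lagtail_lim.
Qed.

Let mR i : measurable_fun setT (remdr i).
Proof. exact: measurable_clip_rem. Qed.

Let R2 i : L1 P (fun w => remdr i w ^+ 2).
Proof. exact: (L1_clip_rem2 M0 (ltW s2) (mX i) (XL i)). Qed.

Let LR i : L1 P (remdr i).
Proof. exact: L1_sq. Qed.

(** The centred remainder, so that [X = trunc + crem] with both parts centred. Its covariances are
    those of [remdr]. *)
Definition crem i w : R := X i w - trunc i w.

Lemma cremE i : crem i = fun w => remdr i w - Ex P (remdr i).
Proof.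
apply/funext => w; rewrite /crem /trunc /remdr (ExB (LX i) (LC i)) X0.
by ring.
Qed.

Lemma measurable_crem i : measurable_fun setT (crem i).
Proof. by apply: measurable_funB => //; exact: measurable_trunc. Qed.

Lemma crem_cov i j : Ex P (fun w => crem i w * crem j w) = cov P (remdr i) (remdr j).
Proof.
have L := L1_sqM (mR i) (mR j) (R2 i) (R2 j).
have mean k : Ex P (crem k) = 0.
  by rewrite cremE (ExB (LR k) (L1_cst _)) (Ex_cst (Ex P _)) subrr.
rewrite -[RHS]mul1r -[X in X * _](mulr1 1).
rewrite -(cov_affine 1 (- Ex P (remdr i)) 1 (- Ex P (remdr j)) (LR i) (LR j) L).
have E k : (fun w => 1 * remdr k w + - Ex P (remdr k)) = crem k.
  by rewrite cremE; apply/funext => w; rewrite mul1r.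
by rewrite !E /cov !mean mul0r subr0.
Qed.

Variables (rho : R) (L : nat).
Hypothesis rhoE : B <= rho * M `^ (s - 2).

Let remdr2_le i : Ex P (fun w => remdr i w ^+ 2) <= rho.
Proof.
have p0 : 0 < M `^ (s - 2) by exact: powR_gt0.
have := Ex_clip_rem2 M0 (ltW s2) (mX i) (XL i) (XB i).
by move=> /le_trans/(_ rhoE); rewrite ler_pM2r.
Qed.

Let rho0 : 0 <= rho.
Proof. by apply: le_trans (remdr2_le 0); apply: Ex_ge0 => w; exact: sqr_ge0. Qed.

(** Lags up to [L] use the second moment [rho] of the remainder, small for a high truncation level.
    Longer lags use Davydov's inequality, whose constant does not depend on [M] because the
    remainder is dominated by [X]. Their total is thus small uniformly in n. *)
Definition remlag (k : nat) : R := if (k <= L)%N then 2 * rho else lagbound 0 K k.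

Lemma crem_cov_le i j : (i <= j)%N -> `|Ex P (fun w => crem i w * crem j w)| <= remlag (j - i).
Proof.
rewrite crem_cov /remlag; case: ifPn => [_ _|].
  apply: (le_trans (cov_le_sq (mR i) (mR j) (R2 i) (R2 j))).
  by rewrite mulrDl mul1r lerD.
rewrite -ltnNge => Lk _; have ij : (i < j)%N by rewrite -subn_gt0 (leq_trans _ Lk).
rewrite -(subnSK ij) /=.
have s0 : 0 <= s := ltW (lt_trans (ltr0n R 2) s2).
have Rp k : L1 P (fun w => `|remdr k w| `^ s).
  apply: (L1_dom _ _ (XL k)).
    by apply: (measurableT_comp (f := fun x => x `^ s)); [exact: measurable_powR|exact: measurableT_comp].
  move=> w; rewrite ger0_norm ?powR_ge0// ge0_ler_powR ?nnegrE//.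
  exact/clip_dist/ltW.
have RB k : Ex P (fun w => `|remdr k w| `^ s) <= B.
  apply: le_trans (XB k); apply: Ex_le => // w.
  by rewrite ge0_ler_powR ?nnegrE// clip_dist// ltW.
apply: davydov => //.
apply: (pair_amix (f := fun=> fun x => x - clip M x)) => // k.
by apply: measurable_funB => //; exact: measurable_clip.
Qed.

Lemma remlag_sum q N : \sum_(q <= k < N) remlag k <= 2 * rho * L.+1%:R + K * gam L.
Proof.
have r0 k : 0 <= remlag k.
  by rewrite /remlag; case: ifP => _; [rewrite mulr_ge0|exact: lagbound_ge0].
have b0 : 0 <= 2 * rho * L.+1%:R + K * gam L by rewrite addr_ge0 ?mulr_ge0.
have low m : (m <= L.+1)%N -> \sum_(0 <= k < m) remlag k <= 2 * rho * L.+1%:R.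
  move=> mL; apply: (@le_trans _ _ (\sum_(0 <= k < m) (2 * rho))).
    by apply: ler_sum_nat => k /andP[_ km]; rewrite /remlag -ltnS (leq_trans km mL).
  by rewrite sumr_const_nat subn0 -[leLHS]mulr_natr ler_wpM2l ?ler_nat// mulr_ge0.
apply: (@le_trans _ _ (\sum_(0 <= k < N) remlag k)).
  have [qN|Nq] := leqP q N; last by rewrite [leLHS]big_geq ?(ltnW Nq)//; apply: sumr_ge0.
  by rewrite [leRHS](@big_cat_nat _ _ _ q)//= lerDr; apply: sumr_ge0.
have [NL|LN] := leqP N L.+1.
  by apply: (le_trans (low N NL)); rewrite lerDl mulr_ge0.
rewrite (@big_cat_nat _ _ _ L.+1)//=; last exact: ltnW.
apply: lerD; first exact: low.
apply: (@le_trans _ _ (\sum_(L.+1 <= k < N) lagbound 0 K k)).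
  by apply: ler_sum_nat => k /andP[Lk _]; rewrite /remlag leqNgt Lk.
exact: (lagtailE L.+1 N (lexx 0) K_ge0).
Qed.

Lemma trunc_diff n : Ex P (fun w => (psum X predT 0 n w - psum trunc predT 0 n w) ^+ 2) <=
  2 * (2 * rho * L.+1%:R + K * gam L) * n%:R.
Proof.
have r0 k : 0 <= remlag k.
  by rewrite /remlag; case: ifP => _; [rewrite mulr_ge0|exact: lagbound_ge0].
have c2 i : L1 P (fun w => crem i w ^+ 2).
  rewrite cremE; apply: (@eq_L1 _ _ _ _ (fun w => (remdr i w + - Ex P (remdr i)) ^+ 2)) => //.
  by apply: L1_sqD => //; exact: L1_cst.
have := psum_var measurable_crem c2 r0 crem_cov_le (tau := fun=> 2 * rho * L.+1%:R + K * gam L)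
  (fun q N => remlag_sum q N) predT 0 n.
rewrite count_all subn0; apply: le_trans.
rewrite le_eqVlt; apply/orP; left; apply/eqP; apply: eq_Ex => w.
by rewrite /psum -sumrB.
Qed.

End Truncated.

Theorem moment_clt (t e : R) : 0 < e -> exists N, forall n, (N <= n)%N ->
  cosgap P (t / Num.sqrt n%:R) (psum X predT 0 n) <= e /\
  singap P (t / Num.sqrt n%:R) (psum X predT 0 n) <= e.
Proof.
move=> e0; have Bp := B0; have Kp := K_ge0; pose tau0 : R := lagtail (1 + B) K 0.
have t0 : 0 <= tau0 by rewrite /tau0/= addr_ge0 ?mulr_ge0//; lra.
have V0 : 0 < 1 + t ^+ 2 * (4 * tau0 + 2).
  by rewrite ltr_wpDr// mulr_ge0 ?sqr_ge0// addr_ge0// mulr_ge0.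
(* The factor 4 tau0 + 2 bounds, per index, the second moments of both sums: the truncated one is at
   most 2 (2 tau0) + 2 del, and [del] is capped at 1 so that [eta] can be fixed before it. *)
pose eta : R := e / 3 / (1 + t ^+ 2 * (4 * tau0 + 2)).
have eta0 : 0 < eta by rewrite !divr_gt0.
have T0 : 0 < 1 + 2 * t ^+ 2 / eta.
  by rewrite ltr_wpDr// divr_ge0 ?(ltW eta0)// mulr_ge0// sqr_ge0.
pose del : R := Num.min 1 (e / 3 / (1 + 2 * t ^+ 2 / eta)).
have del0 : 0 < del by rewrite lt_min ltr01 !divr_gt0.
have [L HL] : exists L, forall n, (L <= n)%N -> `|gam n| <= del / 4 / (K + 1).
  by apply: gam_lim; rewrite !divr_gt0//; lra.
have {}HL : K * gam L <= del / 4.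
  have := HL L (leqnn L); rewrite ger0_norm// ler_pdivlMr; last by lra.
  by have := gam0 L; nra.
(* Then 2 rho (L + 1) = del / 4 for the short lags, to be added to del / 4 for the long ones and
   doubled by [trunc_diff]. The level [M] is solved from M^(s-2) = B / rho + 1. *)
pose rho : R := del / 8 / L.+1%:R.
have rho0 : 0 < rho by rewrite !divr_gt0.
pose M : R := (B / rho + 1) `^ (s - 2)^-1.
have q0 : 0 < B / rho + 1 by rewrite ltr_wpDl// divr_ge0// ltW.
have M0 : 0 < M by exact: powR_gt0.
have rhoE : B <= rho * M `^ (s - 2).
  rewrite /M -powRrM mulVf ?powRr1 ?(ltW q0)//; last by rewrite subr_eq0 gt_eqF.
  rewrite [leRHS](_ : _ = B + rho); first by rewrite lerDl ltW.
  by field; rewrite gt_eqF.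
have [N HN] := trunc_clt M0 t (divr_gt0 e0 (ltr0n _ 3)).
exists N.+1 => n Nn; have [gc gs] := HN n (ltnW Nn).
have n0 : 0 < n%:R :> R by rewrite ltr0n (leq_trans _ Nn).
have D := trunc_diff M0 L rhoE n.
have del_le : 2 * (2 * rho * L.+1%:R + K * gam L) <= del.
  have -> : 2 * rho * L.+1%:R = del / 4.
    have l0 : L.+1%:R != 0 :> R by rewrite pnatr_eq0.
    by rewrite /rho; move: L.+1%:R l0 => l l0; field.
  by lra.
have {}D : Ex P (fun w => (psum X predT 0 n w - psum (trunc M) predT 0 n w) ^+ 2) <= del * n%:R.
  by apply: (le_trans D); rewrite ler_wpM2r.
have mS : measurable_fun setT (psum X predT 0 n) by exact: measurable_psum.
have mU : measurable_fun setT (psum (trunc M) predT 0 n).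
  by apply: measurable_psum => i; exact: measurable_trunc.
have LS : L1 P (fun w => psum X predT 0 n w ^+ 2) by exact: L1_psum2.
have LU : L1 P (fun w => psum (trunc M) predT 0 n w ^+ 2).
  apply: L1_psum2 => i; first exact: measurable_trunc.
  apply: (L1_bdd ((2 * M) ^+ 2)); first by apply: measurable_funX; exact: measurable_trunc.
  by move=> w; rewrite normrX lerXn2r ?nnegrE ?trunc_bdd// mulr_ge0// ltW.
have VS : Ex P (fun w => psum X predT 0 n w ^+ 2) <= 2 * tau0 * n%:R.
  have lb k : 0 <= lagbound (1 + B) K k by apply: lagbound_ge0 => //; rewrite addr_ge0.
  have lt q N' : \sum_(q <= k < N') lagbound (1 + B) K k <= lagtail (1 + B) K q.
    by apply: lagtailE => //; rewrite addr_ge0.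
  apply: (le_trans (psum_var mX X2 lb moment_cov lt predT 0 n)).
  by rewrite count_all subn0.
have d1 : del <= 1 by rewrite ge_min lexx.
have LD : L1 P (fun w => (psum X predT 0 n w - psum (trunc M) predT 0 n w) ^+ 2).
  apply: (@eq_L1 _ _ _ _ (fun w => (psum X predT 0 n w + - psum (trunc M) predT 0 n w) ^+ 2)) => //.
  apply: L1_sqD => //; first exact: measurableT_comp.
  by apply: (eq_L1 LU) => w; rewrite sqrrN.
have VU : Ex P (fun w => psum (trunc M) predT 0 n w ^+ 2) <= (4 * tau0 + 2) * n%:R.
  apply: (@le_trans _ _ (Ex P (fun w => 2 * psum X predT 0 n w ^+ 2 +
    2 * (psum X predT 0 n w - psum (trunc M) predT 0 n w) ^+ 2))).
    apply: Ex_le => //; first exact: L1D (L1Z _ LS) (L1Z _ LD).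
    by move=> w; move: (psum _ _ _ _ _) (psum _ _ _ _ _) => a b; have := sqr_ge0 (2 * a - b); nra.
  rewrite (ExD (L1Z 2 LS) (L1Z 2 LD)) (ExZ _ LS) (ExZ _ LD).
  have dn : del * n%:R <= 1 * n%:R by rewrite ler_wpM2r.
  by lra.
have VS' : Ex P (fun w => psum X predT 0 n w ^+ 2) <= (4 * tau0 + 2) * n%:R.
  apply: (le_trans VS); rewrite ler_wpM2r//; lra.
set u := t / _.
have un : u ^+ 2 * n%:R = t ^+ 2.
  rewrite /u expr_div_n sqr_sqrtr ?(ltW n0)//; field; rewrite gt_eqF//.
have y0 : 0 <= 2 * t ^+ 2 / eta by apply: divr_ge0 (ltW eta0); exact: mulr_ge0 (sqr_ge0 t).
have e1 : 2 * (u ^+ 2 * (del * n%:R) / eta) <= e / 3 * (2 * t ^+ 2 / eta / (1 + 2 * t ^+ 2 / eta)).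
  rewrite (_ : 2 * (u ^+ 2 * (del * n%:R) / eta) = 2 * (u ^+ 2 * n%:R) / eta * del); last by ring.
  rewrite un [leRHS](_ : _ = 2 * t ^+ 2 / eta * (e / 3 / (1 + 2 * t ^+ 2 / eta))); last by ring.
  by apply: ler_wpM2l => //; rewrite ge_min lexx orbT.
have e1' : 2 * (u ^+ 2 * (del * n%:R) / eta) <= e / 3.
  apply: (le_trans e1); rewrite ler_piMr ?divr_ge0 ?(ltW e0)//.
  by rewrite ler_pdivrMr// mul1r lerDr.
have e2 : eta + eta * u ^+ 2 * ((4 * tau0 + 2) * n%:R) = e / 3.
  rewrite (_ : eta + _ = eta * (1 + u ^+ 2 * n%:R * (4 * tau0 + 2))); last by ring.
  by rewrite un /eta divfK ?gt_eqF.
have p1 : 0 <= eta * u ^+ 2 * ((4 * tau0 + 2) * n%:R).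
  apply: mulr_ge0; first by apply: mulr_ge0 (sqr_ge0 u); exact: ltW.
  by apply: mulr_ge0; [lra|exact: ltW].
have p2 : 0 <= u ^+ 2 * (del * n%:R) / eta.
  apply: divr_ge0 (ltW eta0); apply: mulr_ge0 (sqr_ge0 u) _.
  by apply: mulr_ge0; exact: ltW.
split.
  apply: (le_trans (cosgap_compare u mS mU LS LU eta0 D VS' VU)).
  by rewrite -/u in gc; lra.
apply: (le_trans (singap_compare u mS mU LS LU eta0 D)).
by rewrite -/u in gs; lra.
Qed.

End MomentCLT.

(** * Weak convergence of random vectors *)

Section BorelMatrices.
Context {R : realType}.

Lemma mx_ballI m n (x y : 'M[R]_(m, n)) (e : R) : 0 < e ->
  (forall i j, `|x i j - y i j| < e) -> ball x e y.
Proof. by move=> e0 xy; split=> // i j; exact: xy. Qed.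

Lemma mx_ballD m n (x y : 'M[R]_(m, n)) (e : R) : ball x e y ->
  forall i j, `|x i j - y i j| < e.
Proof. by case. Qed.

Lemma continuous_borelM m n (f : 'M[R]_(m, n) -> R) : continuous f ->
  measurable_fun setT (f : borelM R m n -> R).
Proof.
move=> cf; apply: (measurability (@RGenOpens.G R)); first exact: RGenOpens.measurableE.
move=> _ [_ [a [b ->] <-]]; rewrite setTI.
apply: sub_sigma_algebra; apply: (open_comp (f := f)) => [x _|]; first exact: cf.
exact: interval_open.
Qed.

Lemma measurable_coord m n i j : measurable_fun setT ((fun M => M i j) : borelM R m n -> R).
Proof. by apply: continuous_borelM; exact: coord_continuous. Qed.

(** An open set is the union of the countably many boxes with rational centre and radius 1/(N+1)
    that it contains, and the preimage of a box involves finitely many entries. *)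
Lemma measurable_borelM d (T : measurableType d) m n (X : T -> 'M[R]_(m, n)) :
  (forall i j, measurable_fun setT (fun w => X w i j)) ->
  measurable_fun setT (X : T -> borelM R m n).
Proof.
move=> mX; apply: (@measurability _ _ T (borelM R m n) setT X (@open 'M[R]_(m, n))) => //.
move=> _ [A oA <-]; rewrite setTI.
pose B (q : 'M[rat]_(m, n) * nat) : set 'M[R]_(m, n) :=
  [set x | forall i j, `|x i j - ratr (q.1 i j)| < q.2.+1%:R^-1].
rewrite (_ : X @^-1` A = \bigcup_(q : 'M[rat]_(m, n) * nat) (if `[< B q `<=` A >] then X @^-1` B q else set0)).
  apply: countable_bigcupT_measurable => // q; case: ifP => // _.
  rewrite (_ : X @^-1` B q = \big[setI/setT]_i \big[setI/setT]_j
      ((fun w => `|X w i j - ratr (q.1 i j)|) @^-1` `]-oo, q.2.+1%:R^-1[)).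
    apply: bigsetI_measurable => i _; apply: bigsetI_measurable => j _.
    rewrite -[X in measurable X]setTI.
    have : measurable_fun setT (fun w => `|X w i j - ratr (q.1 i j)|).
      by apply: measurableT_comp => //; exact: measurable_funB.
    by apply => //.
  apply/seteqP; split => [w Bw|w].
    rewrite -!bigcap_seq => i /= _; rewrite -bigcap_seq => j /= _.
    by rewrite in_itv/=; exact: Bw.
  rewrite -bigcap_seq => Bw i j; have := Bw i (mem_index_enum i).
  rewrite -bigcap_seq => /(_ j (mem_index_enum j)).
  by rewrite /= in_itv.
apply/seteqP; split => [w Aw|w [q _]]; last first.
  by case: ifPn => // /asboolP BA; exact: BA.
have /nbhs_ballP[e /= e0 eA] := open_nbhs_nbhs (conj oA Aw).
(* Two points of a box of radius below e/2 are within [e] of each other, so the box around [X w]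
   stays in the ball of radius [e]. *)
have [N Ne] : exists N, N.+1%:R^-1 < e / 2 by apply: ex_natSinv_lt; rewrite divr_gt0.
have i0 : 0 < N.+1%:R^-1 :> R by rewrite invr_gt0.
have /choice[f fE] : forall ij : 'I_m * 'I_n, exists q : rat, `|X w ij.1 ij.2 - ratr q| < N.+1%:R^-1.
  move=> [i j]; have h0 : X w i j < X w i j + N.+1%:R^-1 by rewrite ltrDl.
  have [q] := rat_in_itvoo h0; rewrite in_itv/= => /andP[h1 h2]; exists q.
  by rewrite distrC ger0_norm ?subr_ge0 ?(ltW h1)// ltrBlDl.
pose q : 'M[rat]_(m, n) := \matrix_(i, j) f (i, j).
have BX : B (q, N) (X w) by move=> i j; rewrite mxE; exact: (fE (i, j)).
exists (q, N) => //; rewrite ifT//; apply/asboolP => x Bx; apply: eA; apply: mx_ballI => // i j.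
have h1 := BX i j; have h2 := Bx i j; rewrite /= in h1 h2.
rewrite (_ : X w i j - x i j = (X w i j - ratr (q i j)) - (x i j - ratr (q i j))); last by ring.
apply: (le_lt_trans (ler_normB _ _)).
by have := lt_trans h1 Ne; have := lt_trans h2 Ne; lra.
Qed.

(** Uniform continuity near a compact cube where only [x] is confined: [y] may leave the cube, as
    the random walk of [walk] does. Vectors are transposed because [rV_compact] speaks of rows. *)
Lemma box_modulus k (f : 'cV[R]_k -> R) (K e : R) : continuous f -> 0 < e ->
  exists2 del : R, 0 < del & forall x y : 'cV[R]_k, (forall i, `|x i 0| <= K) ->
    (forall i, `|x i 0 - y i 0| < del) -> `|f x - f y| <= e.
Proof.
move=> cf e0.
have cK : compact [set v : 'rV[R]_k | forall i, `[- K, K]%classic (v ord0 i)].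
  exact: (@rV_compact R k (fun=> `[- K, K]%classic) (fun=> @segment_compact R _ _)).
move/compact_near_coveringP in cK.
pose Q (del : R) (x : 'rV[R]_k) := forall y : 'cV[R]_k,
  (forall i, `|x 0 i - y i 0| < del) -> `|f x^T - f y| <= e.
have := cK R 0^'+ Q _ _; case => // [x _|del /= del0 H].
  have e20 : 0 < e / 2 by rewrite divr_gt0.
  have /nbhs_ballP [r /= r0 Hr] := cf x^T _ (nbhsx_ballx (f x^T) (e / 2) e20).
  near=> x' del => y xy.
  have bx : ball x (r / 2) x' by near: x'; apply: nbhsx_ballx; rewrite divr_gt0.
  have dr : del < r / 2 by near: del; apply: nbhs_right_lt; rewrite divr_gt0.
  have b1 : `|f x^T - f x'^T| < e / 2.
    apply: Hr; apply: mx_ballI => // i j; rewrite !mxE (ord1 j).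
    by apply: (lt_le_trans (mx_ballD bx 0 i)); lra.
  have b2 : `|f x^T - f y| < e / 2.
    apply: Hr; apply: mx_ballI => // i j; rewrite !mxE (ord1 j).
    rewrite (_ : x 0 i - y i 0 = (x 0 i - x' 0 i) + (x' 0 i - y i 0)); last by ring.
    apply: (le_lt_trans (ler_normD _ _)).
    by rewrite [ltRHS]splitr ltrD// ?(mx_ballD bx)//; exact: lt_trans (xy i) dr.
  rewrite (_ : f x'^T - f y = (f x^T - f y) - (f x^T - f x'^T)); last by ring.
  by apply: (le_trans (ler_normB _ _)); lra.
exists (del / 2); first by rewrite divr_gt0.
move=> x y xK xy; have := H (del / 2).
rewrite /= sub0r normrN gtr0_norm ?divr_gt0// ltr_pdivrMr// ltr_pMr// ltr1n.
move=> /(_ isT isT x^T) Q1; rewrite -(trmxK x); apply: Q1.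
  by move=> i; rewrite mxE in_itv/= -ler_norml.
by move=> i; rewrite mxE.
Unshelve. all: by end_near. Qed.

End BorelMatrices.

(** * Trigonometric polynomials and the Bernstein operator *)

Section TrigPoly.
Context {R : realType} {k : nat}.
Implicit Types (x y a : 'cV[R]_k) (f g h : 'cV[R]_k -> R).

Lemma dotvE a x : dotv a x = \sum_i a i 0 * x i 0.
Proof. by rewrite /dotv mxE; apply: eq_bigr => i _; rewrite mxE. Qed.

Lemma dotvDl a b x : dotv (a + b) x = dotv a x + dotv b x.
Proof. by rewrite /dotv linearD mulmxDl mxE. Qed.

Lemma dotvNl a x : dotv (- a) x = - dotv a x.
Proof. by rewrite /dotv linearN mulNmx mxE. Qed.

Lemma dotv0l x : dotv 0 x = 0.
Proof. by rewrite /dotv trmx0 mul0mx mxE. Qed.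

(** Trigonometric polynomials with arbitrary real frequencies. Their expectations are controlled by
    E cos and E sin of linear forms, and product-to-sum formulas make them an algebra. *)
Inductive trig : ('cV[R]_k -> R) -> Prop :=
| trig_cos c a : trig (fun x => c * cos (dotv a x))
| trig_sin c a : trig (fun x => c * sin (dotv a x))
| trig_add f g : trig f -> trig g -> trig (fun x => f x + g x).

Lemma eq_trig f g : trig f -> f =1 g -> trig g.
Proof. by move=> tf /funext <-. Qed.

Lemma trig_cst c : trig (fun=> c).
Proof. by apply: (eq_trig (trig_cos c 0)) => x; rewrite dotv0l cos0 mulr1. Qed.

Lemma trig_mul f g : trig f -> trig g -> trig (fun x => f x * g x).
Proof.
move=> tf tg; elim: tf => [c a|c a|f1 f2 _ t1 _ t2]; last first.
  by apply: (eq_trig (trig_add t1 t2)) => x; rewrite mulrDl.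
- elim: tg => [e b|e b|g1 g2 _ t1 _ t2]; last first.
  + by apply: (eq_trig (trig_add t1 t2)) => x; rewrite mulrDr.
  + apply: (eq_trig (trig_add (trig_cos (c * e / 2) (a - b)) (trig_cos (- (c * e / 2)) (a + b)))) => x.
    by rewrite !dotvDl dotvNl !cosD cosN sinN; field.
  + apply: (eq_trig (trig_add (trig_sin (c * e / 2) (a + b)) (trig_sin (c * e / 2) (a - b)))) => x.
    by rewrite !dotvDl dotvNl !sinD cosN sinN; field.
- elim: tg => [e b|e b|g1 g2 _ t1 _ t2]; last first.
  + by apply: (eq_trig (trig_add t1 t2)) => x; rewrite mulrDr.
  + apply: (eq_trig (trig_add (trig_sin (c * e / 2) (a + b)) (trig_sin (- (c * e / 2)) (a - b)))) => x.
    by rewrite !dotvDl dotvNl !sinD cosN sinN; field.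
  + apply: (eq_trig (trig_add (trig_cos (c * e / 2) (a + b)) (trig_cos (c * e / 2) (a - b)))) => x.
    by rewrite !dotvDl dotvNl !cosD cosN sinN; field.
Qed.

Lemma trig_bdd f : trig f -> exists M : R, forall x, `|f x| <= M.
Proof.
elim=> [c a|c a|f1 f2 _ [M1 H1] _ [M2 H2]].
- by exists `|c| => x; rewrite normrM ler_piMr// cos_le1'.
- by exists `|c| => x; rewrite normrM ler_piMr// sin_le1'.
- by exists (M1 + M2) => x; apply: (le_trans (ler_normD _ _)); exact: lerD.
Qed.

Lemma measurable_dotv d (T : measurableType d) a (Y : T -> 'cV[R]_k) :
  (forall i, measurable_fun setT (fun w => Y w i 0)) ->
  measurable_fun setT (fun w => dotv a (Y w)).
Proof.
move=> mY; under eq_fun do rewrite dotvE; apply: measurable_sum => i.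
exact: measurable_funM.
Qed.

Lemma measurable_trig d (T : measurableType d) f (Y : T -> 'cV[R]_k) :
  (forall i, measurable_fun setT (fun w => Y w i 0)) -> trig f ->
  measurable_fun setT (fun w => f (Y w)).
Proof.
move=> mY; elim=> [c a|c a|f1 f2 _ H1 _ H2].
- apply: measurable_funM => //; apply: (measurableT_comp (f := cos)); last exact: measurable_dotv.
  by apply: continuous_measurable_fun; exact: continuous_cos.
- apply: measurable_funM => //; apply: (measurableT_comp (f := sin)); last exact: measurable_dotv.
  by apply: continuous_measurable_fun; exact: continuous_sin.
- exact: measurable_funD.
Qed.

Lemma measurable_continuous_vec d (T : measurableType d) f (Y : T -> 'cV[R]_k) :
  (forall i, measurable_fun setT (fun w => Y w i 0)) -> continuous f ->
  measurable_fun setT (fun w => f (Y w)).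
Proof.
move=> mY cf; apply: (measurableT_comp (f := (f : borelM R k 1 -> R))).
  exact: continuous_borelM.
by apply: measurable_borelM => i j; rewrite (ord1 j).
Qed.

(* Expectation of [h] after a random walk started at [y] whose step for each
   index [j] of the list is [c] or [-c] along the [j]-th axis, with mean
   [c * sin (x j / L)]: the Bernstein operator, with coefficients that are
   trigonometric in [x]. *)
Fixpoint walk (c L : R) (js : seq 'I_k) x h y : R :=
  if js is j :: js' then
    (1 + sin (L^-1 * x j 0)) / 2 * walk c L js' x h (y + c *: delta_mx j 0) +
    (1 - sin (L^-1 * x j 0)) / 2 * walk c L js' x h (y - c *: delta_mx j 0)
  else h y.

Variables (c L : R).

Lemma trig_walk js h y : trig (fun x => walk c L js x h y).
Proof.
elim: js y => [|j js IH] y /=; first exact: trig_cst.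
have S (e : R) : trig (fun x => (1 + e * sin (L^-1 * x j 0)) / 2).
  apply: (eq_trig (trig_add (trig_cst 2^-1) (trig_sin (e / 2) (L^-1 *: delta_mx j 0)))) => x.
  rewrite dotvE (bigD1 j)//= big1 ?addr0 => [|i ij]; last by rewrite !mxE (negbTE ij) mulr0 mul0r.
  by rewrite !mxE !eqxx mulr1; field.
apply: trig_add; apply: trig_mul => //.
  by apply: (eq_trig (S 1)) => x; rewrite mul1r.
by apply: (eq_trig (S (-1))) => x; rewrite mulN1r.
Qed.

Let wt (x : 'cV[R]_k) j : 0 <= (1 + sin (L^-1 * x j 0)) / 2 /\ 0 <= (1 - sin (L^-1 * x j 0)) / 2.
Proof.
have h1 := sin_geN1 (L^-1 * x j 0); have h2 := sin_le1 (L^-1 * x j 0).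
by split; lra.
Qed.

Lemma walk_le js x f g y : (forall z, f z <= g z) -> walk c L js x f y <= walk c L js x g y.
Proof.
move=> fg; elim: js y => [|j js IH] y //=; have [w1 w2] := wt x j.
by apply: lerD; exact: ler_wpM2l.
Qed.

Lemma walk_affine js x f (a b : R) y :
  walk c L js x (fun z => a + b * f z) y = a + b * walk c L js x f y.
Proof. by elim: js y => [|j js IH] y //=; rewrite !IH; field. Qed.

Lemma walkD js x f g y :
  walk c L js x (fun z => f z + g z) y = walk c L js x f y + walk c L js x g y.
Proof. by elim: js y => [|j js IH] y //=; rewrite !IH; ring. Qed.

Lemma walk_cst js x (a : R) y : walk c L js x (fun=> a) y = a.
Proof. by elim: js y => [|j js IH] y //=; rewrite !IH; field. Qed.

Lemma walk_sum (I : Type) (s : seq I) (F : I -> 'cV[R]_k -> R) js x y :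
  walk c L js x (fun z => \sum_(i <- s) F i z) y = \sum_(i <- s) walk c L js x (F i) y.
Proof.
elim: s => [|i s IH].
  rewrite big_nil -[RHS](walk_cst js x 0 y); congr walk.
  by apply/funext => z; rewrite big_nil.
by rewrite big_cons -IH -walkD; congr walk; apply/funext => z; rewrite big_cons.
Qed.

Lemma walk_bdd js x f (M : R) y : (forall z, `|f z| <= M) -> `|walk c L js x f y| <= M.
Proof.
move=> fM; rewrite ler_norml -{1}(walk_cst js x (- M) y) -{2}(walk_cst js x M y).
apply/andP; split; apply: walk_le => z; have := fM z; by rewrite ler_norml => /andP[].
Qed.

(** Squared bias plus variance: only the steps along axis [i] move the coordinate, each with mean c
    u and variance c^2 (1 - u^2). *)
Lemma walk_var js x i (a : R) y : let u := sin (L^-1 * x i 0) in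
  walk c L js x (fun z => (z i 0 - a) ^+ 2) y =
  (y i 0 + c * (count_mem i js)%:R * u - a) ^+ 2 + (count_mem i js)%:R * c ^+ 2 * (1 - u ^+ 2).
Proof.
move=> u; elim: js y => [|j js IH] y /=; first by rewrite mulr0 !mul0r !addr0.
rewrite !IH !mxE; case: (eqVneq j i) => [->|ji].
  by rewrite !eqxx/= -/u natrD mulr1; field.
rewrite /= mulr0 subr0 addr0 add0n.
by field.
Qed.

End TrigPoly.

Section Levy.
Context {R : realType} {k : nat}.

(** Bernstein's proof: |f z - f x| is at most e/3 plus a multiple of |z - x|^2, and the walk has
    small mean square distance to [x]. As an average of values of [f], the approximant keeps the
    bound [M] everywhere, also off the box, where it is not close to [f]. *)
Lemma trig_approx (f : 'cV[R]_k -> R) (M K e : R) : continuous f -> (forall x, `|f x| <= M) ->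
  0 < e -> 0 < K ->
  exists g : 'cV[R]_k -> R, [/\ trig g, forall x, `|g x| <= M &
    forall x : 'cV[R]_k, (forall i, `|x i 0| <= K) -> `|g x - f x| <= e].
Proof.
move=> cf fM e0 K0.
have M0 : 0 <= M by apply: le_trans (fM 0).
have e30 : 0 < e / 3 by rewrite divr_gt0.
have [del del0 Hdel] := box_modulus K cf e30.
pose A : R := 2 * M / del ^+ 2 * k%:R.
have A0 : 0 <= A by rewrite mulr_ge0// divr_ge0 ?sqr_ge0// mulr_ge0.
(* The mean position L sin(x / L) differs from x by at most K^3 / L^2. This [L] makes the resulting
   bias term small; its final + 1 ensures L >= 1. *)
pose L : R := (A * 3 / e + 1) * K ^+ 3 + 1.
have L1 : 1 <= L by rewrite lerDr mulr_ge0 ?exprn_ge0 ?(ltW K0)// addr_ge0// divr_ge0 ?(ltW e0)// mulr_ge0.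
have L0 : 0 < L by lra.
have [N [N0 HN]] := ex_nat_ge (A * L ^+ 2 / (e / 3)).
pose c : R := L / N%:R.
have NR : 0 < N%:R :> R by rewrite ltr0n.
(* [N] steps along each axis, of size L / N, so the mean is L sin(x / L) and the variance at most
   L^2 / N. *)
pose js := flatten (nseq N (enum 'I_k)).
have cnt i : count_mem i js = N.
  rewrite /js count_flatten map_nseq sumn_nseq count_uniq_mem ?enum_uniq// mem_enum mul1n//.
exists (fun x => walk c L js x f 0); split.
- exact: trig_walk.
- by move=> x; exact: walk_bdd.
move=> x xK.
pose F (z : 'cV[R]_k) : R := \sum_i (z i 0 - x i 0) ^+ 2.
have F0 (z : 'cV[R]_k) i : (z i 0 - x i 0) ^+ 2 <= F z.
  by rewrite /F (bigD1 i)//= lerDl sumr_ge0// => *; exact: sqr_ge0.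
have pt (z : 'cV[R]_k) : `|f z - f x| <= e / 3 + 2 * M / del ^+ 2 * F z.
  have d20 : 0 < del ^+ 2 by rewrite exprn_gt0.
  have FF : 0 <= F z by apply: sumr_ge0 => *; exact: sqr_ge0.
  have [H|] := pselect (forall i, `|x i 0 - z i 0| < del).
    by rewrite distrC (le_trans (Hdel _ _ xK H))// lerDl mulr_ge0// divr_ge0 ?mulr_ge0// ltW.
  move=> /existsNP[i /negP]; rewrite -leNgt => zi.
  have dF : del ^+ 2 <= F z.
    apply: le_trans (F0 z i); rewrite -[leRHS]real_normK ?num_real// distrC.
    by rewrite ler_sqr ?nnegrE// ltW.
  apply: (@le_trans _ _ (2 * M)).
    by apply: (le_trans (ler_normB _ _)); rewrite mulrDl mul1r lerD.
  apply: (@le_trans _ _ (2 * M / del ^+ 2 * F z)); last by rewrite lerDr ltW.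
  by rewrite -mulrA ler_peMr ?mulr_ge0// mulrC ler_pdivlMr// mul1r.
have W : walk c L js x (fun z => e / 3 + 2 * M / del ^+ 2 * F z) 0 <= e.
  rewrite walk_affine /F walk_sum.
  have term i : walk c L js x (fun z => (z i 0 - x i 0) ^+ 2) 0 <= (K ^+ 3 / L ^+ 2) ^+ 2 + L ^+ 2 / N%:R.
    rewrite walk_var cnt mxE add0r; set u := sin _.
    rewrite (_ : c * N%:R = L); last by rewrite /c divfK// gt_eqF.
    apply: lerD.
      have h : L * u - x i 0 = L * (sin (L^-1 * x i 0) - L^-1 * x i 0).
        by rewrite mulrBr mulrA divff ?gt_eqF// mul1r.
      rewrite -real_normK ?num_real// ler_sqr ?nnegrE ?divr_ge0 ?exprn_ge0 ?(ltW K0) ?(ltW L0)//.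
      rewrite h normrM (gtr0_norm L0).
      apply: (@le_trans _ _ (L * (L^-1 * K) ^+ 3)).
        rewrite ler_wpM2l ?(ltW L0)//; apply: (le_trans (sin_lin _).2).
        rewrite lerXn2r ?nnegrE ?mulr_ge0 ?invr_ge0 ?(ltW K0) ?(ltW L0)//.
        by rewrite normrM gtr0_norm ?invr_gt0// ler_wpM2l ?invr_ge0 ?(ltW L0).
      by rewrite le_eqVlt; apply/orP; left; apply/eqP; field; rewrite gt_eqF.
    rewrite (_ : N%:R * c ^+ 2 = L ^+ 2 / N%:R); last by rewrite /c; field; rewrite gt_eqF.
    by rewrite ler_piMr ?divr_ge0 ?sqr_ge0// lerBlDr lerDl sqr_ge0.
  apply: (@le_trans _ _ (e / 3 + A * ((K ^+ 3 / L ^+ 2) ^+ 2 + L ^+ 2 / N%:R))).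
    rewrite lerD2l /A -[leRHS]mulrA; apply: ler_wpM2l; first by rewrite divr_ge0 ?sqr_ge0// mulr_ge0.
    rewrite mulr_natl -[X in _ *+ X]card_ord -sumr_const; exact: ler_sum.
  have h1 : A * (L ^+ 2 / N%:R) <= e / 3.
    by rewrite mulrA ler_pdivrMr// [leRHS]mulrC -ler_pdivrMr.
  have h2 : A * (K ^+ 3 / L ^+ 2) ^+ 2 <= e / 3.
    have s1 : K ^+ 3 / L ^+ 2 <= K ^+ 3 / L.
      rewrite ler_wpM2l ?exprn_ge0 ?(ltW K0)// lef_pV2 ?posrE ?exprn_gt0//.
      by rewrite expr2 ler_peMr// ltW.
    have K3 : 0 < K ^+ 3 by rewrite exprn_gt0.
    pose B : R := A * 3 / e.
    have B0 : 0 <= B by rewrite /B divr_ge0 ?(ltW e0)// mulr_ge0.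
    have s2 : K ^+ 3 / L <= (B + 1)^-1.
      rewrite ler_pdivrMr// ler_pdivlMl; last by lra.
      by rewrite /L -/B; lra.
    have s3 : 0 <= K ^+ 3 / L ^+ 2 by rewrite divr_ge0 ?sqr_ge0// ltW.
    have s4 : K ^+ 3 / L ^+ 2 <= (B + 1)^-1 by apply: le_trans s1 s2.
    have B1 : 0 < B + 1 by lra.
    have s5 : (B + 1)^-1 <= 1 by rewrite invf_le1//; lra.
    have s6 : (K ^+ 3 / L ^+ 2) ^+ 2 <= (B + 1)^-1.
      rewrite expr2 -[leRHS]mul1r; apply: ler_pM => //; exact: le_trans s4 s5.
    apply: (le_trans (ler_wpM2l A0 s6)); rewrite ler_pdivrMr//.
    rewrite (_ : e / 3 * (B + 1) = A + e / 3); last by rewrite /B; field; rewrite gt_eqF.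
    by lra.
  by rewrite mulrDr; lra.
apply: le_trans W; rewrite ler_norml.
have E1 : walk c L js x (fun z => f z - f x) 0 = walk c L js x f 0 - f x.
  by rewrite walkD walk_cst.
rewrite -E1; apply/andP; split; last first.
  by apply: walk_le => z; apply: le_trans (pt z); exact: ler_norm.
rewrite -mulN1r -[X in X <= _]add0r -walk_affine; apply: walk_le => z.
by rewrite add0r mulN1r lerNl (le_trans _ (pt z))// -normrN ler_norm.
Qed.

End Levy.

(** * Null sequences, tightness and Levy's theorem *)

Section Tends.
Context {R : realType}.
Implicit Types u v : nat -> R.

Lemma tends0P u (l : R) : tends0 (fun n => u n - l) <-> (u @ \oo --> l).
Proof.
split=> [ul|/cvgrPdist_le ul e e0].
  apply/cvgrPdist_le => e e0; have [N HN] := ul e e0.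
  by exists N => // n /= Nn; rewrite distrC; exact: HN.
by have [N _ HN] := ul e e0; exists N => n Nn; rewrite distrC; exact: HN.
Qed.

Lemma tends0D u v : tends0 u -> tends0 v -> tends0 (fun n => u n + v n).
Proof.
move=> tu tv e e0; have e2 : 0 < e / 2 by rewrite divr_gt0.
have [N1 H1] := tu _ e2; have [N2 H2] := tv _ e2; exists (N1 + N2)%N => n Nn.
apply: (le_trans (ler_normD _ _)); rewrite [leRHS]splitr lerD//.
  by apply: H1; rewrite (leq_trans _ Nn)// leq_addr.
by apply: H2; rewrite (leq_trans _ Nn)// leq_addl.
Qed.

Lemma tends0Z c u : tends0 u -> tends0 (fun n => c * u n).
Proof.
move=> tu e e0; have c1 : 0 < `|c| + 1 by rewrite ltr_wpDl.
have [N H] := tu _ (divr_gt0 e0 c1); exists N => n Nn.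
have := H n Nn; rewrite normrM ler_pdivlMr// => h.
by have := normr_ge0 (u n); nra.
Qed.

Lemma tends0_le u v : (forall n, `|u n| <= v n) -> tends0 v -> tends0 u.
Proof.
move=> uv tv e e0; have [N H] := tv e e0; exists N => n Nn.
by apply: (le_trans (uv n)); apply: le_trans (ler_norm _) (H n Nn).
Qed.

End Tends.

Section DCT.
Context {d : measure_display} {T : measurableType d} {R : realType}.
Variable P : probability T R.

Lemma Ex_dct (f_ : nat -> T -> R) (f : T -> R) (M : R) :
  (forall n, measurable_fun setT (f_ n)) -> measurable_fun setT f ->
  (forall n w, `|f_ n w| <= M) -> (forall w, f_ ^~ w @ \oo --> f w) ->
  tends0 (fun n => Ex P (f_ n) - Ex P f).
Proof.
move=> mf_ mf fM ff; have lf : L1 P f.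
  apply: (L1_bdd M mf) => w.
  have : `|f_ n w| @[n --> \oo] --> `|f w| by apply: cvg_norm; exact: ff.
  move=> /cvgP c; have := c; rewrite -(cvg_lim _ (cvg_norm (ff w)))// => c'.
  by apply: limr_le => //; apply: nearW => n; exact: fM.
apply/tends0P; have := @dominated_convergence _ _ R P setT measurableT (fun n => EFin \o f_ n) (EFin \o f) (cst M%:E).
case.
- by move=> n; apply/measurable_EFinP.
- exact/measurable_EFinP.
- by apply: aeW => w _; apply: cvg_EFin; [exact: nearW|exact: ff].
- exact: finite_measure_integrable_cst.
- by apply: aeW => w n _ /=; rewrite lee_fin.
move=> _ _ H; apply: (fine_cvg (a := Ex P f)).
by rewrite /Ex /Rintegral fineK //; exact: integrable_fin_num.
Qed.

Lemma tail_real (V : T -> R) (e : R) : measurable_fun setT V -> 0 < e ->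
  exists2 K : R, 0 < K & forall K' : R, K <= K' -> fine (P [set w | K' < `|V w|]) <= e.
Proof.
move=> mV e0.
have mA (K : R) : measurable [set w | K < `|V w|].
  have m : measurable_fun setT (fun w => `|V w|) by exact: measurableT_comp.
  rewrite (_ : [set w | _] = (fun w => `|V w|) @^-1` `]K, +oo[); first by rewrite -[X in measurable X]setTI; exact: m.
  by apply/seteqP; split => w /=; rewrite in_itv/= andbT.
have := @Ex_dct (fun n => \1_[set w | n%:R < `|V w|]) (cst 0) 1.
case/(_ _ _ _ _ e e0).
- by move=> n; exact: measurable_indic.
- exact: measurable_cst.
- by move=> n w; rewrite indicE; case: (_ \in _); rewrite ?normr1 ?normr0.
- move=> w; apply: cvg_near_cst; exists (Num.truncn `|V w|).+1 => // n /= Nn.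
  rewrite indicE memNset//= => h.
  have nn : (Num.truncn `|V w|).+1%:R <= n%:R :> R by rewrite ler_nat.
  by have := lt_trans (truncnS_gt `|V w|) (le_lt_trans nn h); rewrite ltxx.
move=> N /(_ N (leqnn N)); rewrite (Ex_cst 0) subr0 Ex_indic// => H.
exists N.+1%:R => [|K' NK]; first by rewrite ltr0n.
apply: le_trans (le_trans (ler_norm _) H).
apply: fine_le; rewrite ?fin_num_measure//; apply: le_measure; rewrite ?inE//.
by move=> w /=; apply: lt_trans; rewrite (lt_le_trans _ NK)// ltr_nat.
Qed.

End DCT.

Section Levy.
Context {R : realType} {k : nat}.

(** Union bound for the probability of leaving the box of half-side [K]. *)
Definition tailp {d} {T : measurableType d} (P : probability T R) (Y : T -> 'cV[R]_k) (K : R) : R :=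
  \sum_i fine (P [set w | K < `|Y w i 0|]).

Section One.
Context {d : measure_display} {T : measurableType d}.
Variables (P : probability T R) (Y : T -> 'cV[R]_k).
Hypothesis mY : forall i, measurable_fun setT (fun w => Y w i 0).

Lemma measurable_tail i (K : R) : measurable [set w | K < `|Y w i 0|].
Proof.
have m : measurable_fun setT (fun w => `|Y w i 0|) by exact: measurableT_comp.
rewrite (_ : [set w | _] = (fun w => `|Y w i 0|) @^-1` `]K, +oo[); first by rewrite -[X in measurable X]setTI; exact: m.
by apply/seteqP; split => w /=; rewrite in_itv/= andbT.
Qed.

Lemma tailp_le K K' : K <= K' -> tailp P Y K' <= tailp P Y K.
Proof.
move=> KK; apply: ler_sum => i _; apply: fine_le; rewrite ?fin_num_measure//; try exact: measurable_tail.
apply: le_measure; rewrite ?inE; try exact: measurable_tail.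
by move=> w /=; exact: le_lt_trans.
Qed.

Lemma tailp_small e : 0 < e -> exists2 K, 0 < K & tailp P Y K <= e.
Proof.
move=> e0; have ek : 0 < e / (k%:R + 1) by rewrite divr_gt0// ltr_wpDl.
have /choice[K HK] : forall i : 'I_k, exists K : R, 0 < K /\ forall K' : R, K <= K' ->
    fine (P [set w | K' < `|Y w i 0|]) <= e / (k%:R + 1).
  by move=> i; have [K K0 HK] := tail_real P (mY i) ek; exists K.
have K0 i : 0 <= K i by have [/ltW] := HK i.
exists (\sum_i K i + 1); first by rewrite ltr_wpDl// sumr_ge0.
apply: (@le_trans _ _ (\sum_(i < k) e / (k%:R + 1))).
  apply: ler_sum => i _; have [_] := HK i; apply.
  by rewrite (bigD1 i)//= -addrA lerDl addr_ge0// sumr_ge0.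
rewrite sumr_const card_ord -[leLHS]mulr_natr mulrAC ler_pdivrMr ?ltr_wpDl//.
by rewrite ler_wpM2l ?(ltW e0)// lerDl.
Qed.

Lemma approx_Ex (f g : 'cV[R]_k -> R) (M K e : R) : continuous f -> (forall x, `|f x| <= M) ->
  trig g -> (forall x, `|g x| <= M) -> 0 <= e ->
  (forall x : 'cV[R]_k, (forall i, `|x i 0| <= K) -> `|g x - f x| <= e) ->
  `|Ex P (fun w => f (Y w)) - Ex P (fun w => g (Y w))| <= e + 2 * M * tailp P Y K.
Proof.
move=> cf fM tg gM e0 fg.
have mf := measurable_continuous_vec mY cf; have mg := measurable_trig mY tg.
rewrite -(ExB (L1_bdd M mf (fun w => fM _)) (L1_bdd M mg (fun w => gM _))).
have Li i : L1 P (\1_[set w | K < `|Y w i 0|]) by apply: L1_indic; exact: measurable_tail.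
have Ls : L1 P (fun w => \sum_i \1_[set w | K < `|Y w i 0|] w) by apply: L1_sum => i _.
have L := L1D (L1_cst (P := P) e) (L1Z (2 * M) Ls).
apply: (@le_trans _ _ (Ex P (fun w => cst e w + 2 * M * \sum_i \1_[set w | K < `|Y w i 0|] w))).
  apply: Ex_abs_le => //; first exact: measurable_funB.
  move=> w; have M0 : 0 <= M by apply: le_trans (fM 0).
  have s0 : 0 <= \sum_i \1_[set w | K < `|Y w i 0|] w :> R.
    by apply: sumr_ge0 => i _; rewrite indicE.
  have [H|] := pselect (forall i, `|Y w i 0| <= K).
    by rewrite distrC (le_trans (fg _ H))// lerDl mulr_ge0// mulr_ge0.
  move=> /existsNP[i /negP]; rewrite -ltNge => Ki.
  apply: (@le_trans _ _ (2 * M)).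
    by apply: (le_trans (ler_normB _ _)); rewrite mulrDl mul1r lerD.
  apply: (@le_trans _ _ (2 * M * \sum_i \1_[set w | K < `|Y w i 0|] w)); last by rewrite lerDr.
  rewrite ler_peMr ?mulr_ge0// (bigD1 i)//= indicE mem_set// lerDl.
  by apply: sumr_ge0 => j _; rewrite indicE.
rewrite (ExD (L1_cst e) (L1Z _ Ls)) (Ex_cst e) (ExZ _ Ls) (Ex_sum (P := P)) => [|i _]; last exact: Li.
rewrite le_eqVlt; apply/orP; left; apply/eqP; congr (_ + _ * _); apply: eq_bigr => i _.
by rewrite Ex_indic//; exact: measurable_tail.
Qed.

End One.

(** On a large box [f] is exchanged for a trigonometric polynomial with the same global bound;
    outside, the cost is 2M times the tail, small by tightness. The limit is represented by a
    variable on its own space, so the statement also serves for the constant sequences of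
    [cf_unique_continuous]. *)
Theorem levy {d d'} {T : measurableType d} {T' : measurableType d'} (P : probability T R)
  (mu : probability T' R) (X : nat -> T -> 'cV[R]_k) (Y : T' -> 'cV[R]_k) :
  (forall n i, measurable_fun setT (fun w => X n w i 0)) ->
  (forall i, measurable_fun setT (fun w => Y w i 0)) ->
  (forall a, tends0 (fun n => Ex P (fun w => cos (dotv a (X n w))) - Ex mu (fun w => cos (dotv a (Y w))))) ->
  (forall a, tends0 (fun n => Ex P (fun w => sin (dotv a (X n w))) - Ex mu (fun w => sin (dotv a (Y w))))) ->
  (forall e, 0 < e -> exists K N, forall n, (N <= n)%N -> tailp P (X n) K <= e) ->
  forall (f : 'cV[R]_k -> R) (M : R), continuous f -> (forall x, `|f x| <= M) ->
  tends0 (fun n => Ex P (fun w => f (X n w)) - Ex mu (fun w => f (Y w))).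
Proof.
move=> mX mY Hc Hs tight f M cf fM.
have L1t (d0 : measure_display) (T0 : measurableType d0) (Q : probability T0 R) (Z : T0 -> 'cV[R]_k) h :
    (forall i, measurable_fun setT (fun w => Z w i 0)) -> trig h -> L1 Q (fun w => h (Z w)).
  by move=> mZ th; have [B HB] := trig_bdd th; apply: (L1_bdd B (measurable_trig mZ th)).
have tc a : trig (fun x : 'cV[R]_k => cos (dotv a x)).
  by apply: (eq_trig (trig_cos 1 a)) => x; rewrite mul1r.
have ts a : trig (fun x : 'cV[R]_k => sin (dotv a x)).
  by apply: (eq_trig (trig_sin 1 a)) => x; rewrite mul1r.
have Ht g : trig g -> tends0 (fun n => Ex P (fun w => g (X n w)) - Ex mu (fun w => g (Y w))).
  elim=> [c a|c a|g1 g2 t1 H1 t2 H2].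
  - rewrite (_ : (fun n => _) = fun n => c * (Ex P (fun w => cos (dotv a (X n w))) - Ex mu (fun w => cos (dotv a (Y w))))).
      exact: tends0Z.
    apply/funext => n; rewrite (ExZ c (L1t _ _ _ _ _ (mX n) (tc a))) (ExZ c (L1t _ _ _ _ _ mY (tc a))).
    by rewrite mulrBr.
  - rewrite (_ : (fun n => _) = fun n => c * (Ex P (fun w => sin (dotv a (X n w))) - Ex mu (fun w => sin (dotv a (Y w))))).
      exact: tends0Z.
    apply/funext => n; rewrite (ExZ c (L1t _ _ _ _ _ (mX n) (ts a))) (ExZ c (L1t _ _ _ _ _ mY (ts a))).
    by rewrite mulrBr.
  - rewrite (_ : (fun n => _) = fun n => (Ex P (fun w => g1 (X n w)) - Ex mu (fun w => g1 (Y w))) +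
      (Ex P (fun w => g2 (X n w)) - Ex mu (fun w => g2 (Y w)))).
      exact: tends0D.
    apply/funext => n; rewrite (ExD (L1t _ _ _ _ _ (mX n) t1) (L1t _ _ _ _ _ (mX n) t2)).
    by rewrite (ExD (L1t _ _ _ _ _ mY t1) (L1t _ _ _ _ _ mY t2)); ring.
move=> e e0.
have M0 : 0 <= M by apply: le_trans (fM 0).
have e5 : 0 < e / 5 by rewrite divr_gt0.
have M1 : 0 < 2 * M + 1 by lra.
have eM : 0 < e / 5 / (2 * M + 1) by rewrite divr_gt0.
have [K1 [N1 HK1]] := tight _ eM.
have [K2 K20 HK2] := tailp_small mu mY eM.
(* Tightness gives a level [K1] of unknown sign; this sum is positive and dominates both levels. *)
pose K : R := K2 + `|K1|.
have K0 : 0 < K by rewrite ltr_wpDr.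
have KK1 : K1 <= K by rewrite /K (le_trans (ler_norm K1))// lerDr ltW.
have KK2 : K2 <= K by rewrite lerDl.
have [g [tg gM gf]] := trig_approx cf fM e5 K0.
have [N2 HN2] := Ht g tg _ e5.
exists (N1 + N2)%N => n Nn.
have a1 := approx_Ex P (mX n) cf fM tg gM (ltW e5) gf.
have a2 := approx_Ex mu mY cf fM tg gM (ltW e5) gf.
have a3 := HN2 n (leq_trans (leq_addl _ _) Nn).
have t1 := le_trans (tailp_le P (mX n) KK1) (HK1 n (leq_trans (leq_addr _ _) Nn)).
have t2 := le_trans (tailp_le mu mY KK2) HK2.
have sm t : t <= e / 5 / (2 * M + 1) -> 2 * M * t <= e / 5.
  move=> h; apply: (@le_trans _ _ (2 * M * (e / 5 / (2 * M + 1)))); first by rewrite ler_wpM2l// mulr_ge0.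
  rewrite mulrA ler_pdivrMr// mulrC ler_wpM2l ?(ltW e5)//; lra.
have {}t1 := sm _ t1; have {}t2 := sm _ t2.
set f1 := Ex P _ in a1 *; set f2 := Ex mu _ in a2 *; set g1 := Ex P _ in a1 a3; set g2 := Ex mu _ in a2 a3.
have -> : f1 - f2 = (f1 - g1) - (f2 - g2) + (g1 - g2) by ring.
apply: (le_trans (ler_normD _ _)); have := ler_normB (f1 - g1) (f2 - g2).
by move: a1 a2 a3 t1 t2; lra.
Qed.

End Levy.

(** * A law on the line is determined by its transform *)

Section CfUnique.
Context {R : realType}.

Definition vec1 (x : R) : 'cV[R]_1 := const_mx x.

Lemma dotv_vec1 (a : 'cV[R]_1) x : dotv a (vec1 x) = a 0 0 * x.
Proof. by rewrite dotvE big_ord1 mxE. Qed.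

Lemma measurable_vec1 i : measurable_fun setT (fun x : R => vec1 x i 0).
Proof. by under eq_fun do rewrite mxE; exact: measurable_id. Qed.

(** [levy] applied to a constant sequence: a constant that tends to 0 is 0. *)
Lemma cf_unique_continuous (m1 m2 : probability R R) (f : R -> R) (M : R) :
  (forall t, Ex m1 (fun x => cos (t * x)) = Ex m2 (fun x => cos (t * x))) ->
  (forall t, Ex m1 (fun x => sin (t * x)) = Ex m2 (fun x => sin (t * x))) ->
  continuous f -> (forall x, `|f x| <= M) -> Ex m1 f = Ex m2 f.
Proof.
move=> hc hs cf fM; pose F (v : 'cV[R]_1) := f (v 0 0).
have cF : continuous F.
  by move=> v; apply: (continuous_comp (f := fun v : 'cV[R]_1 => v 0 0)); [exact: coord_continuous|exact: cf].
have E m : Ex m (fun x => F (vec1 x)) = Ex m f by apply: eq_Ex => x; rewrite /F mxE.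
have z0 (u : R) : tends0 (fun=> u - u) by move=> e e0; exists 0%N => n _; rewrite subrr normr0 ltW.
have Ec m a : Ex m (fun x => cos (dotv a (vec1 x))) = Ex m (fun x => cos (a 0 0 * x)).
  by apply: eq_Ex => x; rewrite dotv_vec1.
have Es m a : Ex m (fun x => sin (dotv a (vec1 x))) = Ex m (fun x => sin (a 0 0 * x)).
  by apply: eq_Ex => x; rewrite dotv_vec1.
have H : tends0 (fun=> Ex m1 (fun x => F (vec1 x)) - Ex m2 (fun x => F (vec1 x))).
  apply: (@levy R 1 _ _ _ _ m1 m2 (fun=> vec1) vec1 (fun=> measurable_vec1) measurable_vec1 _ _ _ F M) => //.
  - by move=> a; rewrite !Ec hc.
  - by move=> a; rewrite !Es hs.
  - by move=> e e0; have [K _ HK] := tailp_small m1 measurable_vec1 e0; exists K, 0%N.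
  - by move=> v; exact: fM.
apply/eqP; rewrite -subr_eq0 -normr_le0; apply/ler_addgt0Pr => e e0; rewrite add0r.
by have [N HN] := H e e0; have := HN N (leqnn N); rewrite !E.
Qed.

(** Continuous functions converging pointwise to the indicator of ]a, b[, the open interval being
    the set where the inner minimum is positive. *)
Definition bump (a b : R) (n : nat) (x : R) : R :=
  Num.min 1 (n%:R * Num.max 0 (Num.min (x - a) (b - x))).

Lemma continuous_bump a b n : continuous (bump a b n).
Proof.
have c1 : continuous (fun x : R => Num.min (x - a) (b - x)).
  move=> x; apply: (@continuous_min R R (fun x => x - a) (fun x => b - x)).
    by apply: cvgB; [exact: cvg_id|exact: cvg_cst].
  by apply: cvgB; [exact: cvg_cst|exact: cvg_id].
have c2 : continuous (fun x : R => Num.max 0 (Num.min (x - a) (b - x))).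
  by move=> x; apply: (@continuous_max R R (fun=> 0) _ x); [exact: cvg_cst|exact: c1].
have c3 : continuous (fun x : R => n%:R * Num.max 0 (Num.min (x - a) (b - x))).
  by move=> x; apply: cvgM; [exact: cvg_cst|exact: c2].
by move=> x; apply: (@continuous_min R R (fun=> 1) _ x); [exact: cvg_cst|exact: c3].
Qed.

Lemma bump_bdd a b n x : `|bump a b n x| <= 1.
Proof.
by rewrite ger0_norm ?ge_min ?lexx// le_min ler01/= mulr_ge0// le_max lexx.
Qed.

Lemma bump_cvg a b x : bump a b n x @[n --> \oo] --> (\1_(`]a, b[%classic) x : R).
Proof.
rewrite indicE; have [|xN] := boolP (x \in _).
  move=> /set_mem; rewrite /= in_itv/= => /andP[ax xb].
  have m0 : 0 < Num.min (x - a) (b - x) by rewrite lt_min !subr_gt0 ax.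
  have [N [N0 HN]] := ex_nat_ge (Num.min (x - a) (b - x))^-1.
  apply: cvg_near_cst; exists N => // n /= Nn; rewrite /bump max_r ?(ltW m0)// min_l//.
  rewrite -ler_pdivrMr// div1r (le_trans HN)// ler_nat//.
suff m0 : Num.min (x - a) (b - x) <= 0.
  by apply: cvg_near_cst; apply: nearW => n; rewrite /bump (max_l m0) mulr0 min_r.
rewrite leNgt; apply/negP; rewrite lt_min !subr_gt0 => /andP[ax xb].
by move/negP: xN; apply; apply/mem_set; rewrite /= in_itv/= ax.
Qed.

(** Equality on bounded continuous functions passes to open intervals through [bump] and dominated
    convergence, then to Borel sets because open intervals are stable under intersection and
    generate them. *)
Theorem cf_unique (m1 m2 : probability R R) :
  (forall t, Ex m1 (fun x => cos (t * x)) = Ex m2 (fun x => cos (t * x))) ->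
  (forall t, Ex m1 (fun x => sin (t * x)) = Ex m2 (fun x => sin (t * x))) ->
  forall A : set R, measurable A -> m1 A = m2 A.
Proof.
move=> hc hs.
have oo a b : m1 `]a, b[%classic = m2 `]a, b[%classic.
  have mb n : measurable_fun setT (bump a b n).
    by apply: continuous_measurable_fun; exact: continuous_bump.
  have mi : measurable_fun setT (\1_(`]a, b[%classic) : R -> R) by exact: measurable_indic.
  have D m := @Ex_dct _ _ _ m (bump a b) (\1_(`]a, b[%classic)) 1 mb mi (fun n x => bump_bdd a b n x) (fun x => @bump_cvg a b x).
  have := D m1; have := D m2; rewrite !Ex_indic// => /tends0P H2 /tends0P H1.
  have E : (fun n => Ex m1 (bump a b n)) = (fun n => Ex m2 (bump a b n)).
    apply/funext => n; apply: cf_unique_continuous hc hs _ (bump_bdd a b n).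
    exact: continuous_bump.
  rewrite E in H1; have := cvg_unique _ H1 H2 => H.
  by rewrite -[LHS]fineK ?fin_num_measure// -[RHS]fineK ?fin_num_measure// H.
move=> A mA; have sG : measurable = <<s @RGenOpens.G R >> by exact: RGenOpens.measurableE.
apply: (@g_sigma_algebra_measure_unique _ _ _ (@RGenOpens.G R) _ (fun k => `]- k%:R, k%:R[%classic)).
- by move=> _ [a [b ->]].
- by move=> k; exists (- k%:R), k%:R.
- rewrite -subTset => x _; exists (Num.truncn `|x|).+1 => //=.
  by rewrite in_itv/= -ltr_norml truncnS_gt.
- move=> _ _ [a [b ->]] [c [e ->]]; exists (Num.max a c), (Num.min b e).
  apply/seteqP; split => x /=; rewrite !in_itv/= gt_max lt_min.
    by move=> [/andP[-> ->] /andP[-> ->]].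
  by move=> /andP[/andP[-> ->] /andP[-> ->]].
- by move=> _ [a [b ->]]; exact: oo.
- by move=> k; rewrite (le_lt_trans (probability_le1 _ _))// ltry.
- by rewrite -sG.
Qed.

End CfUnique.

(** * Gaussian laws *)

Section DeriveQuadratic.
Context {R : realType}.

(** An explicit quadratic remainder identifies the derivative, which spares a theorem on
    differentiation under the integral sign. *)
Lemma is_derive_quad (f : R -> R) (t l C : R) :
  (forall h, `|f (t + h) - f t - h * l| <= C * h ^+ 2) -> is_derive t (1 : R) f l.
Proof.
move=> H; have lim : h^-1 *: (f (h *: (1 : R) + t) - f t) @[h --> (0 : R)^'] --> (l : R).
  apply/cvgrPdist_le => e e0.
  have C0 : 0 < `|C| + 1 by rewrite ltr_wpDl.
  near=> h.
  have h0 : h != 0 by near: h; exact: nbhs_dnbhs_neq.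
  have hh : 0 < `|h| by rewrite normr_gt0.
  have he : `|h| <= e / (`|C| + 1).
    near: h; apply: dnbhs0_le; exact: divr_gt0.
  rewrite distrC /GRing.scale/= mulr1.
  have -> : h^-1 * (f (h + t) - f t) - l = h^-1 * (f (t + h) - f t - h * l).
    by rewrite (addrC h t); field.
  rewrite normrM normrV ?unitfE// ler_pdivrMl//; apply: (le_trans (H h)).
  rewrite -(real_normK (num_real h)) expr2 mulrA [leRHS]mulrC ler_wpM2r//.
  move: he; rewrite ler_pdivlMr// => he; apply: le_trans he.
  by rewrite mulrC ler_wpM2l// (le_trans (ler_norm C))// lerDl.
apply: DeriveDef; first by apply/cvg_ex; exists l; exact: lim.
by apply/cvg_lim.
Unshelve. all: by end_near. Qed.

End DeriveQuadratic.

(** * Transform of the centred normal law *)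

Section GaussianCf.
Context {R : realType}.
Variable s : R.
Hypothesis s0 : 0 < s.
Let mu := @lebesgue_measure R.
Let c : R := (s ^+ 2)^-1.
Let c0 : 0 < c. Proof. by rewrite invr_gt0 exprn_gt0. Qed.
Let sn0 : s != 0. Proof. by rewrite gt_eqF. Qed.
Local Notation g h := (normal_pdf h s).
Local Notation LI f := (mu.-integrable setT (EFin \o f)).
Local Notation I f := (\int[mu]_x (f x)).

Let mg h : measurable_fun setT (g h). Proof. exact: measurable_normal_pdf. Qed.

Let g_ge0 h x : 0 <= g h x. Proof. exact: normal_pdf_ge0. Qed.

Let Lg h : LI (g h). Proof. exact: integrable_normal_pdf. Qed.

(** Translating the density amounts to multiplying it by an exponential tilt, with [c] the inverse
    variance. *)
Lemma normal_pdf_shift h x : g h x = g 0 x * expR (c * h * x - c * h ^+ 2 / 2).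
Proof.
rewrite !normal_pdfE// -[RHS]mulrA; congr (_ * _).
rewrite /normal_fun -expRD; congr expR; rewrite subr0 /c.
by field.
Qed.

Lemma normal_pdf_center h x : g 0 (x - h) = g h x.
Proof. by rewrite !normal_pdfE// [in RHS]normal_fun_center /normal_fun/= subr0. Qed.

Lemma LI_dom (f k : R -> R) : measurable_fun setT f -> (forall x, `|f x| <= k x) -> LI k -> LI f.
Proof.
move=> mf fk; apply: le_integrable => //; first exact/measurable_EFinP.
by move=> x _ /=; rewrite lee_fin (le_trans (fk x))// ler_norm.
Qed.

Lemma LIZ (a : R) (f : R -> R) : LI f -> LI (fun x : R => a * f x).
Proof. by move=> lf; apply: eq_integrable (integrableZl _ a lf). Qed.

Lemma LIB (f k : R -> R) : LI f -> LI k -> LI (fun x : R => f x - k x).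
Proof. by move=> lf lk; apply: eq_integrable (integrableB _ lf lk). Qed.

Lemma LI_bddM (f k : R -> R) (M : R) : measurable_fun setT f -> (forall x, `|f x| <= M) ->
  LI k -> LI (fun x : R => f x * k x).
Proof.
move=> mf fM lk.
apply: (@LI_dom _ (fun x : R => M * `|k x|)).
- by apply: measurable_funM => //; apply/measurable_EFinP; exact: measurable_int lk.
- by move=> x; rewrite normrM ler_wpM2r.
- by apply: eq_integrable (integrableZl _ M (integrable_norm lk)).
Qed.

Lemma normal_translate (f : R -> R) h : continuous f -> (forall x, `|f x| <= 1) ->
  I (fun x : R => f x * g h x) = I (fun x : R => f (x + h) * g 0 x).
Proof.
move=> cf f1.
(* The substitution theorem asks for a nonnegative integrand, hence the added 1. It contributes the
   total mass of a density on both sides and cancels. *)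
pose G x := (1 + f (x + h)) * g 0 x; pose F (x : R) := x - h.
have F'E : F^`()%classic = cst 1.
  by apply/funext => x; rewrite /F derive1E deriveB// derive_id derive_cst subr0.
have cfh : continuous (fun x : R => f (x + h)).
  move=> x; apply: (continuous_comp (f := fun x => x + h)); last exact: cf.
  by apply: cvgD; [exact: cvg_id|exact: cvg_cst].
have mf : measurable_fun setT f by exact: continuous_measurable_fun.
have mfh : measurable_fun setT (fun x : R => f (x + h)) by exact: continuous_measurable_fun.
have S : (\int[mu]_x (G x)%:E = \int[mu]_x ((1 + f x) * g h x)%:E)%E.
  rewrite (@increasing_ge0_integration_by_substitutionT R F G).
  - apply: eq_integral => x _; rewrite F'E !fctE /G /F /cst mulr1 subrK.
    by rewrite normal_pdf_center.
  - by move=> x y xy; rewrite /F ltrD2r.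
  - by rewrite F'E => ?; exact: cvg_cst.
  - by rewrite F'E; exact: is_cvg_cst.
  - by rewrite F'E; exact: is_cvg_cst.
  - by move=> x; exact: derivableB.
  - exact: cvg_addrr_Ny.
  - exact: cvg_addrr.
  - move=> x; apply: cvgM; last exact: continuous_normal_pdf.
    by apply: cvgD; [exact: cvg_cst|exact: cfh].
  - move=> x; rewrite mulr_ge0//; have := f1 (x + h).
    by rewrite ler_norml => /andP[? ?]; lra.
have L1' : LI (fun x : R => f (x + h) * g 0 x) by exact: LI_bddM (fun x : R => f1 _) (Lg 0).
have L2' : LI (fun x : R => f x * g h x) by exact: LI_bddM (fun x : R => f1 _) (Lg h).
have E1 : I (fun x : R => (1 + f (x + h)) * g 0 x) = 1 + I (fun x : R => f (x + h) * g 0 x).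
  rewrite (_ : 1 = I (g 0)); last by rewrite /Rintegral integral_normal_pdf.
  by rewrite -RintegralD//; apply: eq_Rintegral => x _; rewrite mulrDl /Rintegral integral_normal_pdf mul1r.
have E2 : I (fun x : R => (1 + f x) * g h x) = 1 + I (fun x : R => f x * g h x).
  rewrite (_ : 1 = I (g h)); last by rewrite /Rintegral integral_normal_pdf.
  by rewrite -RintegralD//; apply: eq_Rintegral => x _; rewrite mulrDl /Rintegral integral_normal_pdf mul1r.
have S' : I (fun x : R => (1 + f (x + h)) * g 0 x) = I (fun x : R => (1 + f x) * g h x).
  by rewrite /Rintegral; congr fine; exact: S.
by move: S'; rewrite E1 E2 => /addrI.
Qed.

Lemma Ex_normal (f : R -> R) (M : R) : measurable_fun setT f -> (forall x, `|f x| <= M) ->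
  Ex (normal_prob 0 s) f = I (fun x : R => f x * g 0 x).
Proof.
move=> mf fM; rewrite /Ex /Rintegral; congr fine.
have lf : L1 (normal_prob 0 s) f by exact: (L1_bdd M).
rewrite -(Radon_Nikodym_change_of_variables (normal_prob_dominates 0 s))//=.
under [RHS]eq_integral do rewrite EFinM.
apply: ae_eq_integral => //.
- apply: emeasurable_funM => //; first exact/measurable_EFinP.
  apply: (measurable_int mu).
  by apply: Radon_Nikodym_integrable; exact: normal_prob_dominates.
- by apply: emeasurable_funM; apply/measurable_EFinP => //; exact: mg.
- apply: ae_eqe_mul2l => /=.
  rewrite Radon_NikodymE//=; first exact: normal_prob_dominates.
  move=> abmu; case: cid => /= h [h1 h2 h3].
  apply: integral_ae_eq => //=.
  + by apply/measurable_EFinP; exact: mg.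
  + by move=> E _ mE; rewrite -h3.
Qed.

Lemma sq_le_exp (z : R) : 0 <= z -> z ^+ 2 <= 4 * expR z.
Proof.
move=> z0; have h := expR_ge1Dx (z / 2).
have -> : expR z = expR (z / 2) ^+ 2 by rewrite expr2 -expRD -splitr.
by nra.
Qed.

Lemma expR_lin (y : R) : `|expR y - 1 - y| <= y ^+ 2 * expR `|y|.
Proof.
have e1 (z : R) : `|expR z - 1| <= `|z| * expR `|z|.
  have := @mvt_bound R expR expR 0 z (expR `|z|).
  rewrite expR0 subr0 mulrC; apply => u; rewrite subr0 => uz.
  rewrite ger0_norm ?expR_ge0// ler_expR; exact: le_trans (ler_norm u) uz.
have := @mvt_bound R (fun z => expR z - z) (fun z => expR z - 1) 0 y (`|y| * expR `|y|).
rewrite expR0 !subr0 mulrAC -expr2 real_normK ?num_real//.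
rewrite (_ : expR y - y - 1 = expR y - 1 - y); last by ring.
apply => u; rewrite subr0 => uy; apply: (le_trans (e1 u)).
by apply: ler_pM; rewrite ?expR_ge0 ?ler_expR.
Qed.

(** A weight that dominates x^2 and the Taylor remainder of the tilt, while its product with the
    density stays integrable: it is a combination of the densities translated by 2 and -2. *)
Let E (x : R) := expR (c * 2 * x) + expR (c * (-2) * x).

Let mE : measurable_fun setT E.
Proof.
by apply: measurable_funD; apply: (measurableT_comp (f := expR)) => //; exact: measurable_funM.
Qed.

Let E_ge (x : R) : expR (2 * c * `|x|) <= E x.
Proof.
rewrite /E; case: (ger0P x) => x0.
  by rewrite (mulrC 2) lerDl expR_ge0.
by rewrite (_ : 2 * c * - x = c * (-2) * x) ?lerDr ?expR_ge0//; ring.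
Qed.

Let E_ge1 (x : R) : 1 <= E x.
Proof.
apply: le_trans (E_ge x); rewrite -expR0 ler_expR !mulr_ge0// ltW//.
Qed.

Let LE : LI (fun x : R => E x * g 0 x).
Proof.
apply: (@LI_dom _ (fun x : R => expR (c * 2 ^+ 2 / 2) * g 2 x + expR (c * (-2) ^+ 2 / 2) * g (-2) x)).
- exact: measurable_funM.
- move=> x; rewrite ger0_norm; last by rewrite mulr_ge0// (le_trans _ (E_ge1 x)).
  rewrite (normal_pdf_shift 2 x) (normal_pdf_shift (-2) x) /E mulrDl !expRD !expRN.
  have e1 := expR_gt0 (c * 2 ^+ 2 / 2); have e2 := expR_gt0 (c * (-2) ^+ 2 / 2).
  rewrite le_eqVlt; apply/orP; left; apply/eqP; field.
  by rewrite !gt_eqF.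
- by apply: eq_integrable (integrableD _ (integrableZl _ (expR (c * 2 ^+ 2 / 2)) (Lg 2))
    (integrableZl _ (expR (c * (-2) ^+ 2 / 2)) (Lg (-2)))).
Qed.

Let KE := I (fun x : R => E x * g 0 x).

Lemma I_bound (f : R -> R) (C : R) : measurable_fun setT f ->
  (forall x, `|f x| <= C * E x) ->
  LI (fun x : R => f x * g 0 x) /\ `|I (fun x : R => f x * g 0 x)| <= C * KE.
Proof.
move=> mf fC.
have LC : LI (fun x : R => C * (E x * g 0 x)) := LIZ C LE.
have dom x : `|f x * g 0 x| <= C * (E x * g 0 x).
  by rewrite normrM (ger0_norm (g_ge0 0 x)) mulrA ler_wpM2r.
have L : LI (fun x : R => f x * g 0 x).
  by apply: (LI_dom _ dom LC); exact: measurable_funM.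
split=> //; apply: (le_trans (le_normr_Rintegral _ L)) => //.
rewrite /KE -RintegralZl//; apply: le_Rintegral => //.
exact: integrable_norm.
Qed.

Let sq_E (x : R) : x ^+ 2 <= 4 / c ^+ 2 * E x.
Proof.
have h := sq_le_exp (mulr_ge0 (ltW c0) (normr_ge0 x)).
have h2 : expR (c * `|x|) <= E x.
  apply: le_trans (E_ge x); rewrite ler_expR -mulrA ler_peMl ?mulr_ge0 ?(ltW c0)//; lra.
rewrite mulrAC ler_pdivlMr ?exprn_gt0// -(real_normK (num_real x)) -exprMn mulrC.
by apply: (le_trans h); rewrite ler_wpM2l.
Qed.

Lemma shift_quad (h x : R) : `|h| <= 1 ->
  `|expR (c * h * x - c * h ^+ 2 / 2) - 1 - c * h * x| <= (4 * expR (2 * c) + c) * h ^+ 2 * E x.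
Proof.
move=> h1; set y := c * h * x - c * h ^+ 2 / 2; pose w : R := c * (`|x| + 1).
have w0 : 0 <= w by rewrite mulr_ge0 ?(ltW c0)// addr_ge0.
have hh : h ^+ 2 = `|h| ^+ 2 by rewrite real_normK ?num_real.
have yw : `|y| <= `|h| * w.
  have t1 : `|c * h * x| = c * `|h| * `|x| by rewrite !normrM (gtr0_norm c0).
  have t2 : `|c * h ^+ 2 / 2| = c * `|h| ^+ 2 / 2.
    by rewrite ger0_norm ?hh// divr_ge0// mulr_ge0 ?sqr_ge0// ltW.
  apply: (le_trans (ler_normB _ _)); rewrite t1 t2 /w.
  have : 0 <= c * `|h| by rewrite mulr_ge0// ltW.
  by have := normr_ge0 h; have := normr_ge0 x; nra.
have yw1 : `|y| <= w by apply: (le_trans yw); rewrite ler_piMl.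
have b1 : y ^+ 2 * expR `|y| <= h ^+ 2 * (4 * expR (2 * c) * E x).
  apply: (@le_trans _ _ ((`|h| * w) ^+ 2 * expR w)).
    apply: ler_pM; rewrite ?sqr_ge0 ?expR_ge0 ?ler_expR//.
    by rewrite -real_normK ?num_real// ler_sqr ?nnegrE// mulr_ge0.
  rewrite exprMn -hh -[leLHS]mulrA; apply: ler_wpM2l; first exact: sqr_ge0.
  (* One factor exp w comes from the exponential remainder, the other from w^2 <= 4 exp w. Together
     they give the exponent 2c |x|, which fixes the rate 2 in [E]. *)
  apply: (@le_trans _ _ (4 * expR w * expR w)).
    by rewrite ler_wpM2r ?expR_ge0// sq_le_exp.
  rewrite -!mulrA ler_wpM2l// -expRD (_ : w + w = 2 * c + 2 * c * `|x|); last by rewrite /w; ring.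
  by rewrite expRD ler_wpM2l ?expR_ge0.
have b2 := expR_lin y.
have E1 := E_ge1 x.
have -> : expR y - 1 - c * h * x = (expR y - 1 - y) - c * h ^+ 2 / 2 by rewrite /y; ring.
apply: (le_trans (ler_normB _ _)).
have b3 : `|c * h ^+ 2 / 2| <= c * h ^+ 2 * E x.
  have ch : 0 <= c * h ^+ 2 by rewrite mulr_ge0 ?sqr_ge0// ltW.
  by rewrite ger0_norm ?divr_ge0//; nra.
by have := le_trans b2 b1; nra.
Qed.

Let C1 : R := 4 * expR (2 * c) + c.
(** Translating [f] is the same as tilting the density by 1 + c h x + O(h^2). This is Stein's
    identity in integrated form, without a derivative of [f]. *)
Lemma stein_bound (f : R -> R) h : continuous f -> (forall x, `|f x| <= 1) -> `|h| <= 1 ->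
  `|I (fun x : R => f (x + h) * g 0 x) - I (fun x : R => f x * g 0 x)
    - c * h * I (fun x : R => (f x * x) * g 0 x)| <= C1 * h ^+ 2 * KE.
Proof.
move=> cf f1 h1; rewrite -normal_translate//.
have mf : measurable_fun setT f by exact: continuous_measurable_fun.
have Lf : LI (fun x : R => f x * g 0 x) by exact: LI_bddM f1 (Lg 0).
have Lfh : LI (fun x : R => f x * g h x) by exact: LI_bddM f1 (Lg h).
have [Lx _] : LI (fun x : R => (f x * x) * g 0 x) /\ `|I (fun x : R => (f x * x) * g 0 x)| <= (1 + 4 / c ^+ 2) * KE.
  apply: I_bound; first exact: measurable_funM.
  move=> x; rewrite normrM; apply: (@le_trans _ _ `|x|); first by rewrite ler_piMl.
  have := sq_E x; have := E_ge1 x; rewrite -{1}(real_normK (num_real x)).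
  by have := sqr_ge0 (`|x| - 1); nra.
have Lx' : LI (fun x : R => c * h * ((f x * x) * g 0 x)) := LIZ (c * h) Lx.
pose k (x : R) := f x * (expR (c * h * x - c * h ^+ 2 / 2) - 1 - c * h * x).
have mk : measurable_fun setT k.
  apply: measurable_funM => //; apply: measurable_funB; last exact: measurable_funM.
  apply: measurable_funB => //; apply: (measurableT_comp (f := expR)) => //.
  by apply: measurable_funB => //; exact: measurable_funM.
have kb x : `|k x| <= C1 * h ^+ 2 * E x.
  rewrite /k normrM; apply: le_trans (shift_quad x h1); by rewrite ler_piMl.
have [_ Hk] := I_bound mk kb.
rewrite -RintegralZl// -RintegralB// -RintegralB//; last exact: LIB.
apply: le_trans Hk; rewrite le_eqVlt; apply/orP; left; apply/eqP; congr `|_|.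
by apply: eq_Rintegral => x _; rewrite normal_pdf_shift /k; ring.
Qed.

Let phi t := I (fun x : R => cos (t * x) * g 0 x).
Let psi t := I (fun x : R => sin (t * x) * g 0 x).
Let xs t := I (fun x : R => (sin (t * x) * x) * g 0 x).
Let xc t := I (fun x : R => (cos (t * x) * x) * g 0 x).

Let ccos t : continuous (fun x : R => cos (t * x)).
Proof.
move=> x; apply: (continuous_comp (f := fun x : R => t * x)); last exact: continuous_cos.
by apply: cvgM; [exact: cvg_cst|exact: cvg_id].
Qed.

Let csin t : continuous (fun x : R => sin (t * x)).
Proof.
move=> x; apply: (continuous_comp (f := fun x : R => t * x)); last exact: continuous_sin.
by apply: cvgM; [exact: cvg_cst|exact: cvg_id].
Qed.

Let mc t : measurable_fun setT (fun x : R => cos (t * x)).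
Proof. exact: continuous_measurable_fun. Qed.
Let ms t : measurable_fun setT (fun x : R => sin (t * x)).
Proof. exact: continuous_measurable_fun. Qed.

Let cl t (x : R) : `|cos (t * x)| <= 1. Proof. exact: cos_le1'. Qed.
Let sl t (x : R) : `|sin (t * x)| <= 1. Proof. exact: sin_le1'. Qed.

Let Lc t : LI (fun x : R => cos (t * x) * g 0 x).
Proof. by apply: (LI_bddM (M := 1)) (Lg 0) => // x; exact: cos_le1'. Qed.
Let Ls t : LI (fun x : R => sin (t * x) * g 0 x).
Proof. by apply: (LI_bddM (M := 1)) (Lg 0) => // x; exact: sin_le1'. Qed.

Let Lx (f : R -> R) : measurable_fun setT f -> (forall x, `|f x| <= 1) ->
  LI (fun x : R => (f x * x) * g 0 x).
Proof.
move=> mf f1; apply: (proj1 (I_bound (C := 1 + 4 / c ^+ 2) _ _)); first exact: measurable_funM.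
move=> x; rewrite normrM; apply: (@le_trans _ _ `|x|); first by rewrite ler_piMl.
have := sq_E x; have := E_ge1 x; rewrite -{1}(real_normK (num_real x)).
by have := sqr_ge0 (`|x| - 1); nra.
Qed.

Lemma small_eq0 (a C : R) : (forall h : R, 0 < h -> h <= 1 -> h * `|a| <= C * h ^+ 2) -> a = 0.
Proof.
move=> H; apply/eqP; rewrite -normr_le0; apply/ler_addgt0Pr => e e0; rewrite add0r.
pose h : R := Num.min 1 (e / (`|C| + 1)).
have C0 : 0 < `|C| + 1 by rewrite ltr_wpDl.
have h0 : 0 < h by rewrite lt_min ltr01 divr_gt0.
have h1 : h <= 1 by rewrite ge_min lexx.
have he : h <= e / (`|C| + 1) by rewrite ge_min lexx orbT.
have := H h h0 h1; rewrite expr2 mulrCA ler_pM2l// => /le_trans; apply.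
move: he; rewrite ler_pdivlMr// => he; apply: le_trans he.
by rewrite mulrC ler_wpM2l ?(ltW h0)// (le_trans (ler_norm C))// lerDl.
Qed.

Let trans_cos (t h : R) : I (fun x : R => cos (t * (x + h)) * g 0 x) = cos (t * h) * phi t - sin (t * h) * psi t.
Proof.
rewrite /phi /psi -!RintegralZl// -RintegralB//; try exact: LIZ.
by apply: eq_Rintegral => x _; rewrite mulrDr cosD; ring.
Qed.

Let trans_sin (t h : R) : I (fun x : R => sin (t * (x + h)) * g 0 x) = cos (t * h) * psi t + sin (t * h) * phi t.
Proof.
rewrite /phi /psi -!RintegralZl// -RintegralD//; try exact: LIZ.
by apply: eq_Rintegral => x _; rewrite mulrDr sinD; ring.
Qed.

Let trig_small (t h : R) : 0 < h -> `|sin (t * h) - t * h| <= t ^+ 2 * h ^+ 2 /\ `|cos (t * h) - 1| <= t ^+ 2 * h ^+ 2.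
Proof.
move=> h0; rewrite -exprMn -(real_normK (num_real (t * h))); split; last exact: cos1_sq.
exact: (sin_lin _).1.
Qed.

(** The addition formula expands the translated sine as t h [phi t] up to O(h^2); comparing the
    terms of first order in [h] with [stein_bound] leaves the identity. *)
Let stein_sin (t : R) : t * phi t = c * xs t.
Proof.
apply/eqP; rewrite -subr_eq0; apply/eqP.
apply: (@small_eq0 _ (t ^+ 2 * `|phi t| + t ^+ 2 * `|psi t| + C1 * KE)) => h h0 h1.
have nh : `|h| <= 1 by rewrite gtr0_norm.
have := stein_bound (@csin t) (sl t) nh; rewrite trans_sin -/(psi t) -/(xs t) => H.
have [s1 s2] := trig_small t h0.
rewrite -{1}(gtr0_norm h0) -normrM.
rewrite (_ : h * (t * phi t - c * xs t) = (cos (t * h) * psi t + sin (t * h) * phi t - psi t - c * h * xs t)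
  - ((sin (t * h) - t * h) * phi t) - ((cos (t * h) - 1) * psi t)); last by ring.
apply: (le_trans (ler_normB _ _)); apply: (le_trans (lerD (ler_normB _ _) (lexx _))).
rewrite !normrM.
have := ler_wpM2r (normr_ge0 (phi t)) s1; have := ler_wpM2r (normr_ge0 (psi t)) s2.
by lra.
Qed.

Let stein_cos (t : R) : - t * psi t = c * xc t.
Proof.
apply/eqP; rewrite -subr_eq0; apply/eqP.
apply: (@small_eq0 _ (t ^+ 2 * `|phi t| + t ^+ 2 * `|psi t| + C1 * KE)) => h h0 h1.
have nh : `|h| <= 1 by rewrite gtr0_norm.
have := stein_bound (@ccos t) (cl t) nh; rewrite trans_cos -/(phi t) -/(xc t) => H.
have [s1 s2] := trig_small t h0.
rewrite -{1}(gtr0_norm h0) -normrM.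
rewrite (_ : h * (- t * psi t - c * xc t) = (cos (t * h) * phi t - sin (t * h) * psi t - phi t - c * h * xc t)
  + ((sin (t * h) - t * h) * psi t) - ((cos (t * h) - 1) * phi t)); last by ring.
apply: (le_trans (ler_normB _ _)); apply: (le_trans (lerD (ler_normD _ _) (lexx _))).
rewrite !normrM.
have := ler_wpM2r (normr_ge0 (psi t)) s1; have := ler_wpM2r (normr_ge0 (phi t)) s2.
by lra.
Qed.

Let cos_add_quad (a b : R) : `|cos (a + b) - cos a + b * sin a| <= 2 * b ^+ 2.
Proof.
rewrite cosD [X in `|X|](_ : _ = cos a * (cos b - 1) - sin a * (sin b - b)); last by ring.
apply: (le_trans (ler_normB _ _)); rewrite !normrM mulrDl mul1r -(real_normK (num_real b)).
have c2 := cos1_sq b; have s2 := (sin_lin b).1; have ca := cos_le1' a; have sa := sin_le1' a.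
by apply: lerD; rewrite -[leRHS]mul1r; apply: ler_pM.
Qed.

Let sin_add_quad (a b : R) : `|sin (a + b) - sin a - b * cos a| <= 2 * b ^+ 2.
Proof.
rewrite sinD [X in `|X|](_ : _ = sin a * (cos b - 1) + cos a * (sin b - b)); last by ring.
apply: (le_trans (ler_normD _ _)); rewrite !normrM mulrDl mul1r -(real_normK (num_real b)).
have c2 := cos1_sq b; have s2 := (sin_lin b).1; have ca := cos_le1' a; have sa := sin_le1' a.
by apply: lerD; rewrite -[leRHS]mul1r; apply: ler_pM.
Qed.

Let quad_int (f : R -> R) h : measurable_fun setT f -> (forall x, `|f x| <= 2 * (h * x) ^+ 2) ->
  `|I (fun x : R => f x * g 0 x)| <= 8 / c ^+ 2 * KE * h ^+ 2.
Proof.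
move=> mf fh; have [x|_ H] := @I_bound f (8 / c ^+ 2 * h ^+ 2) mf.
  apply: (le_trans (fh x)); rewrite exprMn; have := ler_wpM2l (sqr_ge0 h) (sq_E x); lra.
by apply: (le_trans H); rewrite le_eqVlt; apply/orP; left; apply/eqP; ring.
Qed.

(** The derivative is minus the mean of x sin(t x), which [stein_sin] expresses through [phi t]
    itself. This yields the linear differential equation solved in [ode]. *)
Let phi_derive (t : R) : is_derive t (1 : R) phi (- (t / c * phi t)).
Proof.
have -> : - (t / c * phi t) = - xs t.
  by rewrite mulrAC stein_sin; field; rewrite gt_eqF.
apply: (@is_derive_quad _ _ _ _ (8 / c ^+ 2 * KE)) => h.
have E1 : phi (t + h) - phi t - h * - xs t =
    I (fun x : R => (cos (t * x + h * x) - cos (t * x) + h * x * sin (t * x)) * g 0 x).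
  rewrite mulrN opprK /phi /xs -RintegralZl//; last exact: Lx (ms t) (sl t).
  rewrite -RintegralB// -RintegralD//; last 2 first.
  - exact: LIB.
  - by apply: LIZ; exact: Lx (ms t) (sl t).
  by apply: eq_Rintegral => x _; rewrite (mulrDl t h x); ring.
rewrite E1; apply: quad_int.
  apply: measurable_funD; last by apply: measurable_funM => //; exact: measurable_funM.
  by apply: measurable_funB => //; under eq_fun do rewrite -mulrDl; exact: mc.
by move=> x; exact: cos_add_quad.
Qed.

Let psi_derive (t : R) : is_derive t (1 : R) psi (- (t / c * psi t)).
Proof.
have -> : - (t / c * psi t) = xc t.
  by rewrite mulrAC -mulNr -mulNr stein_cos; field; rewrite gt_eqF.
apply: (@is_derive_quad _ _ _ _ (8 / c ^+ 2 * KE)) => h.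
have E1 : psi (t + h) - psi t - h * xc t =
    I (fun x : R => (sin (t * x + h * x) - sin (t * x) - h * x * cos (t * x)) * g 0 x).
  rewrite /psi /xc -RintegralZl//; last exact: Lx (mc t) (cl t).
  rewrite -RintegralB// -RintegralB//; last 2 first.
  - exact: LIB.
  - by apply: LIZ; exact: Lx (mc t) (cl t).
  by apply: eq_Rintegral => x _; rewrite (mulrDl t h x); ring.
rewrite E1; apply: quad_int.
  apply: measurable_funB; last by apply: measurable_funM => //; exact: measurable_funM.
  by apply: measurable_funB => //; under eq_fun do rewrite -mulrDl; exact: ms.
by move=> x; exact: sin_add_quad.
Qed.

Let ode (f : R -> R) t : (forall t, is_derive t (1 : R) f (- (t / c * f t))) ->
  f t = f 0 * expR (- (t ^+ 2 / (2 * c))).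
Proof.
move=> df; pose F u := f u * expR (u ^+ 2 / (2 * c)).
have FE : F t = F 0.
  apply: is_derive_0_is_cst => u; rewrite /F; apply: is_derive_eq.
  rewrite /GRing.scale/= ?expr1 ?scaler0 ?mulr1 ?addr0; field.
  by rewrite gt_eqF.
move: FE; rewrite /F expr0n/= mul0r expR0 mulr1 => <-.
by rewrite -mulrA -expRD subrr expR0 mulr1.
Qed.

Theorem normal_cos t : Ex (normal_prob 0 s) (fun x : R => cos (t * x)) = expR (- (t ^+ 2 * s ^+ 2 / 2)).
Proof.
rewrite (Ex_normal (mc t) (cl t)) -/(phi t) (ode t phi_derive).
rewrite (_ : phi 0 = 1) ?mul1r.
  by congr (expR (- _)); rewrite /c; field.
rewrite /phi (@eq_Rintegral _ _ _ mu setT (g 0)); first by rewrite /Rintegral integral_normal_pdf.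
by move=> x _; rewrite mul0r cos0 mul1r.
Qed.

Theorem normal_sin t : Ex (normal_prob 0 s) (fun x : R => sin (t * x)) = 0.
Proof.
rewrite (Ex_normal (ms t) (sl t)) -/(psi t) (ode t psi_derive).
rewrite (_ : psi 0 = 0) ?mul0r//.
rewrite /psi (@eq_Rintegral _ _ _ mu setT (cst 0)); first by rewrite /Rintegral integral0.
by move=> x _; rewrite mul0r sin0 mul0r.
Qed.

End GaussianCf.

(** * Construction of Gaussian vectors with a given covariance *)

Section PushProduct.
Context {R : realType}.

Lemma pushforward_probability d d' (T : measurableType d) (T' : measurableType d')
  (P : probability T R) (X : T -> T') : measurable_fun setT X ->
  exists mu : probability T' R, (forall A, mu A = P (X @^-1` A)) /\
   (forall (f : T' -> R) M, measurable_fun setT f -> (forall x, `|f x| <= M) ->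
      Ex mu f = Ex P (f \o X)).
Proof.
move=> mX; pose Y : {mfun T >-> T'} := mfun_Sub (mem_set mX).
exists (distribution P Y); split=> // f M mf fM.
rewrite /Ex /Rintegral; congr fine.
rewrite integral_distribution//; first exact/measurable_EFinP.
have : L1 P (f \o X) by apply: (L1_bdd M); [exact: measurableT_comp|move=> w; exact: fM].
by [].
Qed.

Lemma product_probability d1 d2 (T1 : measurableType d1) (T2 : measurableType d2)
  (m1 : probability T1 R) (m2 : probability T2 R) :
  exists m : probability (T1 * T2)%type R,
  forall (f : T1 -> R) (g : T2 -> R) (M N : R), measurable_fun setT f -> measurable_fun setT g ->
   (forall x, `|f x| <= M) -> (forall x, `|g x| <= N) ->
   Ex m (fun z => f z.1 * g z.2) = Ex m1 f * Ex m2 g.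
Proof.
have p1 : (m1 \x m2)%E setT = 1%E.
  rewrite -setXTT product_measure1E// -[RHS]mule1.
  by congr (_ * _)%E; exact: probability_setT.
pose mm := Measure_isProbability.Build _ _ _ (m1 \x m2)%E p1.
pose m : probability (T1 * T2)%type R := HB.pack (m1 \x m2)%E mm.
exists m => f g M N mf mg fM gN.
pose F (z : T1 * T2) := f z.1 * g z.2.
have mF : measurable_fun setT F.
  by apply: measurable_funM; apply: measurableT_comp => //.
have LF : (m1 \x m2)%E.-integrable setT (EFin \o F).
  have : L1 m F.
    by apply: (L1_bdd (M * N) mF) => z; rewrite normrM; apply: ler_pM.
  by [].
have Lf : L1 m1 f by exact: (L1_bdd M).
have Lg : L1 m2 g by exact: (L1_bdd N).
rewrite {1}/Ex /Rintegral.
have -> : (\int[m]_x (f x.1 * g x.2)%:E = \int[m1]_x \int[m2]_y (EFin \o F) (x, y))%E.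
  by rewrite (integral12_prod_meas1 LF).
rewrite (eq_integral (fun x => (f x * Ex m2 g)%:E)); last first.
  move=> x _; rewrite (eq_integral (fun y => (f x)%:E * (g y)%:E)%E) => [|y _]; last by rewrite /F/= EFinM.
  rewrite (integralZl measurableT Lg).
  rewrite EFinM; congr (_ * _)%E; rewrite /Ex /Rintegral fineK//; exact: integrable_fin_num.
rewrite (eq_integral (fun x => (Ex m2 g)%:E * (f x)%:E)%E) => [|x _]; last by rewrite mulrC EFinM.
rewrite (integralZl measurableT Lf).
by rewrite fineM//; [rewrite mulrC|exact: integrable_fin_num].
Qed.

End PushProduct.

Section Gram.
Context {R : realType}.

(** Cholesky factorisation by induction on the Schur complement. A zero pivot is allowed, because
    semidefiniteness then forces the rest of its row to vanish. *)
Lemma psd_gram n (S : 'M[R]_n) : S^T = S -> (forall a : 'cV[R]_n, 0 <= dotv a (S *m a)) ->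
  exists A : 'M[R]_n, S = A *m A^T.
Proof.
elim: n S => [|n IH] S Ssym Spsd.
  by exists 0; apply/matrixP => -[].
move: S Ssym Spsd; rewrite -[n.+1]/(1 + n)%N => S Ssym Spsd.
pose s := ulsubmx S 0 0; pose r := ursubmx S; pose S' := drsubmx S.
have ulE : ulsubmx S = s%:M by rewrite [LHS]mx11_scalar.
have dlE : dlsubmx S = r^T by rewrite /r -{1}Ssym trmx_ursub.
have S'sym : S'^T = S' by rewrite /S' trmx_drsub Ssym.
have SE : S = block_mx s%:M r r^T S' by rewrite -[LHS]submxK ulE dlE.
have quad (u : R) (v : 'cV[R]_n) : dotv (col_mx u%:M v) (S *m col_mx u%:M v) =
    s * u ^+ 2 + 2 * u * (r *m v) 0 0 + dotv v (S' *m v).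
  rewrite {1}SE /dotv mul_block_col tr_col_mx mul_row_col tr_scalar_mx.
  rewrite !mul_scalar_mx mul_mx_scalar mulmxDr -scalemxAr.
  have -> : v^T *m r^T = (r *m v)^T by rewrite trmx_mul.
  rewrite !mxE /= !mulr1n; ring.
clearbody s r S'.
have S'psd v : 0 <= dotv v (S' *m v).
  have := Spsd (col_mx 0%:M v); rewrite quad; lra.
have s0 : 0 <= s.
  have := Spsd (col_mx 1%:M 0); rewrite quad dotv0l mulmx0 mxE; lra.
have [sE|sn0] := eqVneq s 0.
  have r0 : r = 0.
    pose rho := (r *m r^T) 0 0.
    have rhoE : rho = \sum_j r 0 j ^+ 2 by rewrite /rho mxE; apply: eq_bigr => j _; rewrite mxE expr2.
    have rho0 : 0 <= rho by rewrite rhoE; apply: sumr_ge0 => j _; exact: sqr_ge0.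
    have : rho = 0.
      apply/eqP; rewrite eq_le rho0 andbT leNgt; apply/negP => rp.
      (* With zero pivot the form is affine in the first coordinate along (u, r^T); the coordinate
         chosen next gives it the value -1. *)
      pose Q := dotv r^T (S' *m r^T).
      have := Spsd (col_mx (- (Q + 1) / (2 * rho))%:M r^T); rewrite quad -/rho -/Q sE mul0r add0r.
      rewrite (_ : 2 * (- (Q + 1) / (2 * rho)) * rho + Q = -1); last by field; rewrite gt_eqF.
      by rewrite ler0N1.
    rewrite rhoE => /eqP; rewrite psumr_eq0 => [/allP rj|j _]; last exact: sqr_ge0.
    apply/rowP => j; have /implyP/(_ isT) := rj j (mem_index_enum j).
    by rewrite sqrf_eq0 mxE => /eqP.
  have [A AE] := IH S' S'sym S'psd.
  exists (block_mx 0 0 0 A); rewrite SE r0 sE tr_block_mx mulmx_block !trmx0 !mul0mx !mulmx0 !addr0 add0r -AE.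
  by rewrite raddf0.
have sp : 0 < s by rewrite lt_def sn0.
pose S2 := S' - s^-1 *: (r^T *m r).
have [A AE] : exists A : 'M[R]_n, S2 = A *m A^T.
  apply: IH; first by rewrite /S2 linearB linearZ /= trmx_mul trmxK S'sym.
  (* This first coordinate minimises the form for given [v], and the minimum is the form of the
     Schur complement. *)
  move=> v; have := Spsd (col_mx (- (r *m v) 0 0 / s)%:M v); rewrite quad.
  have -> : dotv v (S2 *m v) = dotv v (S' *m v) - s^-1 * (r *m v) 0 0 ^+ 2.
    rewrite /dotv /S2 mulmxBl mulmxBr [LHS]mxE [X in _ + X]mxE; congr (_ - _).
    rewrite -scalemxAl -scalemxAr mxE; congr (_ * _).
    have -> : v^T *m (r^T *m r *m v) = (r *m v)^T *m (r *m v) by rewrite trmx_mul !mulmxA.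
    by rewrite mxE big_ord1 [X in X * _]mxE expr2.
  by congr (_ <= _); field.
pose q := Num.sqrt s.
have q0 : 0 < q by rewrite sqrtr_gt0.
have qq : q * q = s by rewrite -expr2 sqr_sqrtr.
exists (block_mx q%:M 0 (q^-1 *: r^T) A).
rewrite SE tr_block_mx mulmx_block !trmx0 !mul0mx !mulmx0 !addr0 tr_scalar_mx linearZ/= trmxK -AE.
rewrite -scalar_mxM qq mul_scalar_mx mul_mx_scalar !scalerA mulfV ?mulVf ?gt_eqF// !scale1r.
congr block_mx; rewrite -scalemxAl -scalemxAr scalerA -invfM qq /S2.
by rewrite addrC subrK.
Qed.

End Gram.

Section GaussianVector.
Context {R : realType}.

(** The characteristic function of N(0, v), in real and imaginary parts, v = 0 included. *)
Definition gauss_cf {d} {T : measurableType d} (P : probability T R) (U : T -> R) (v : R) : Prop :=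
  (forall t, Ex P (fun w => cos (t * U w)) = expR (- (t ^+ 2 * v / 2))) /\
  (forall t, Ex P (fun w => sin (t * U w)) = 0).

Lemma normal1_cf (v : R) : 0 <= v -> exists m : probability R R,
  (forall B, m B = normal1 0 v B) /\ gauss_cf m id v.
Proof.
move=> v0; rewrite /normal1; have [->|vn0] := eqVneq v 0.
  exists \d_(0 : R); split => //; split => t; rewrite /Ex /Rintegral integral_dirac//=.
  - by rewrite indicT mul1r !mulr0 cos0 mul0r oppr0 expR0.
  - apply/measurable_EFinP; apply: measurable_cosu; exact: measurable_id.
  - by rewrite indicT mul1r mulr0 sin0.
  - apply/measurable_EFinP; apply: measurable_sinu; exact: measurable_id.
have vp : 0 < v by rewrite lt_def vn0.
have sp : 0 < Num.sqrt v by rewrite sqrtr_gt0.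
have mi : measurable_fun setT (id : measurableTypeR R -> R) by [].
(* The library puts the Borel sets of [measurableTypeR R] and those of [R] in
   different displays, hence the transfer along the identity. *)
have [m [mE mI]] := pushforward_probability (normal_prob 0 (Num.sqrt v)) mi.
exists m; split=> [B|]; first by rewrite mE.
split => t.
  rewrite (mI _ 1 (measurable_cosu t (@measurable_id _ _ setT)) (fun x => cos_le1' _)).
  by have := normal_cos sp t; rewrite (sqr_sqrtr v0) => <-.
rewrite (mI _ 1 (measurable_sinu t (@measurable_id _ _ setT)) (fun x => sin_le1' _)).
exact: (normal_sin sp t).
Qed.

Lemma gauss_cf_scale {d} {T : measurableType d} (P : probability T R) U v b :
  gauss_cf P U v -> gauss_cf P (fun w => b * U w) (b ^+ 2 * v).
Proof.
move=> [hc hs]; split => t.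
  rewrite (eq_Ex (fun w => cos (t * b * U w))) => [|w]; last by rewrite mulrA.
  by rewrite hc; congr (expR (- _)); ring.
by rewrite (eq_Ex (fun w => sin (t * b * U w))) => [|w]; [rewrite hs|rewrite mulrA].
Qed.

(** The measure is produced before [U] and [V], so that one product space serves all linear
    combinations simultaneously. *)
Lemma gauss_cf_product d1 d2 (T1 : measurableType d1) (T2 : measurableType d2)
  (m1 : probability T1 R) (m2 : probability T2 R) :
  exists m : probability (T1 * T2)%type R,
  forall (U : T1 -> R) (V : T2 -> R) (u v : R), measurable_fun setT U -> measurable_fun setT V ->
  gauss_cf m1 U u -> gauss_cf m2 V v -> gauss_cf m (fun z => U z.1 + V z.2) (u + v).
Proof.
have [m Hm] := product_probability m1 m2.
exists m => U V u v mU mV [Uc Us] [Vc Vs].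
have mU1 : measurable_fun setT (fun z : T1 * T2 => U z.1) by exact: measurableT_comp.
have mV2 : measurable_fun setT (fun z : T1 * T2 => V z.2) by exact: measurableT_comp.
have E (f g : R -> R) t : (forall x, `|f x| <= 1) -> (forall x, `|g x| <= 1) ->
   measurable_fun setT (fun x => f (t * U x)) -> measurable_fun setT (fun x => g (t * V x)) ->
   L1 m (fun z => f (t * U z.1) * g (t * V z.2)) /\
   Ex m (fun z => f (t * U z.1) * g (t * V z.2)) = Ex m1 (fun x => f (t * U x)) * Ex m2 (fun y => g (t * V y)).
  move=> f1 g1 mf mg; split.
    apply: (L1_bdd (1 * 1)).
      apply: measurable_funM.
        exact: (measurableT_comp mf measurable_fst).
      exact: (measurableT_comp mg measurable_snd).
    by move=> z; rewrite normrM; apply: ler_pM.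
  by apply: (Hm (fun x => f (t * U x)) (fun y => g (t * V y)) 1 1).
split => t.
  have [L1 E1] := E cos cos t (@cos_le1' R) (@cos_le1' R) (measurable_cosu t mU) (measurable_cosu t mV).
  have [L2 E2] := E sin sin t (@sin_le1' R) (@sin_le1' R) (measurable_sinu t mU) (measurable_sinu t mV).
  rewrite (eq_Ex (fun z => cos (t * U z.1) * cos (t * V z.2) - sin (t * U z.1) * sin (t * V z.2))).
    rewrite (ExB L1 L2) E1 E2 Uc Vc Us mul0r subr0 -expRD; congr expR; ring.
  by move=> z; rewrite mulrDr cosD.
have [L1 E1] := E sin cos t (@sin_le1' R) (@cos_le1' R) (measurable_sinu t mU) (measurable_cosu t mV).
have [L2 E2] := E cos sin t (@cos_le1' R) (@sin_le1' R) (measurable_cosu t mU) (measurable_sinu t mV).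
rewrite (eq_Ex (fun z => sin (t * U z.1) * cos (t * V z.2) + cos (t * U z.1) * sin (t * V z.2))).
  by rewrite (ExD L1 L2) E1 E2 Us Vs mul0r mulr0 addr0.
by move=> z; rewrite mulrDr sinD.
Qed.

Lemma mvnormal_exists (S : 'M[R]_3) : S^T = S -> (forall a : 'cV[R]_3, 0 <= dotv a (S *m a)) ->
  exists mu : probability (borelM R 3 1) R, is_mvnormal mu 0 S /\
  forall a, gauss_cf mu (fun x => dotv a x) (dotv a (S *m a)).
Proof.
move=> Ssym Spsd; have [A AE] := psd_gram Ssym Spsd.
have [n1 [_ n1cf]] := normal1_cf (ler01 : 0 <= 1 :> R).
have [m12 H12] := gauss_cf_product n1 n1.
have [m H] := gauss_cf_product m12 n1.
pose X (z : R * R * R) : 'cV[R]_3 := A *m col3 z.1.1 z.1.2 z.2.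
have lin (b : 'cV[R]_3) (z : R * R * R) : dotv b (col3 z.1.1 z.1.2 z.2) =
    b 0 0 * z.1.1 + b 1 0 * z.1.2 + b (2%:R) 0 * z.2.
  rewrite dotvE !big_ord_recl big_ord0 !mxE /= addr0 addrA.
  by congr (_ + b _ _ * _ + b _ _ * _); apply/val_inj.
have dX a z : dotv a (X z) = dotv (A^T *m a) (col3 z.1.1 z.1.2 z.2).
  by rewrite /dotv /X trmx_mul trmxK mulmxA.
have m11 : measurable_fun setT (fun z : R * R * R => z.1.1).
  exact: (measurableT_comp measurable_fst measurable_fst).
have m12' : measurable_fun setT (fun z : R * R * R => z.1.2).
  exact: (measurableT_comp measurable_snd measurable_fst).
have m2 : measurable_fun setT (fun z : R * R * R => z.2) by exact: measurable_snd.
have mlin b : measurable_fun setT (fun z : R * R * R => dotv b (col3 z.1.1 z.1.2 z.2)).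
  by under eq_fun do rewrite lin; apply: measurable_funD; [apply: measurable_funD|]; exact: measurable_funM.
have mX : measurable_fun setT (X : R * R * R -> borelM R 3 1).
  apply: measurable_borelM => i j.
  rewrite (_ : (fun z => X z i j) = fun z => dotv (A^T *m delta_mx i 0) (col3 z.1.1 z.1.2 z.2)); first exact: mlin.
  apply/funext => z; rewrite -dX dotvE (bigD1 i)//= big1 ?addr0 => [|l li].
    by rewrite [X in X * _]mxE !eqxx mul1r (ord1 j).
  by rewrite [X in X * _]mxE (negbTE li) mul0r.
have [mu [muE muI]] := pushforward_probability m mX.
have cfa a : gauss_cf m (fun z => dotv a (X z)) (dotv a (S *m a)).
  pose b := A^T *m a.
  have -> : (fun z => dotv a (X z)) = (fun z => (b 0 0 * z.1.1 + b 1 0 * z.1.2) + b (2%:R) 0 * z.2).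
    by apply/funext => z; rewrite dX lin.
  have -> : dotv a (S *m a) = (b 0 0 ^+ 2 * 1 + b 1 0 ^+ 2 * 1) + b (2%:R) 0 ^+ 2 * 1.
    rewrite (_ : dotv a _ = dotv b b).
      rewrite dotvE !big_ord_recl big_ord0 /= addr0 addrA !mulr1 !expr2.
      by congr (_ + b _ _ * b _ _ + b _ _ * b _ _); apply/val_inj.
    by rewrite /dotv AE /b trmx_mul trmxK !mulmxA.
  apply: (H (fun z => b 0 0 * z.1 + b 1 0 * z.2) (fun x => b (2%:R) 0 * x)).
  - by apply: measurable_funD; apply: measurable_funM.
  - exact: measurable_funM.
  - apply: (H12 (fun x => b 0 0 * x) (fun x => b 1 0 * x)); try exact: measurable_funM.
    + exact: gauss_cf_scale.
    + exact: gauss_cf_scale.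
  - exact: gauss_cf_scale.
have cfmu a : gauss_cf mu (fun x => dotv a x) (dotv a (S *m a)).
  have md : measurable_fun setT (fun x : borelM R 3 1 => dotv a x).
    by apply: measurable_dotv => i; exact: measurable_coord.
  have [hc hs] := cfa a; split => t.
    by rewrite (muI _ 1 (measurable_cosu t md) (fun x => cos_le1' _)) -hc.
  by rewrite (muI _ 1 (measurable_sinu t md) (fun x => sin_le1' _)); exact: hs.
exists mu; split => //; split => // a B mB.
have -> : dotv a 0 = 0 by rewrite /dotv mulmx0 mxE.
have [n [nE [nc ns]]] := normal1_cf (Spsd a).
rewrite -nE muE.
have mdX : measurable_fun setT (fun z => dotv a (X z)).
  by under eq_fun do rewrite dX; exact: mlin.
(* [is_mvnormal] speaks of the law of each linear form, not of its transform. The law [q] of the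
   form and the univariate normal [n] have equal transforms, so [cf_unique] identifies them. *)
have [q [qE qI]] := pushforward_probability m mdX.
have [hc hs] := cfa a.
rewrite (_ : m _ = q B); last by rewrite qE.
apply: cf_unique => // t.
  by rewrite (qI _ 1 (measurable_cosu t (@measurable_id _ _ setT)) (fun x => cos_le1' _)) nc -hc.
by rewrite (qI _ 1 (measurable_sinu t (@measurable_id _ _ setT)) (fun x => sin_le1' _)) ns; exact: hs.
Qed.

End GaussianVector.

(** * Stationary mixing processes *)

Section SameLaw.
Context {d d' : measure_display} {T : measurableType d} {T' : measurableType d'} {R : realType}.
Variables (P : probability T R) (X Y : {mfun T >-> T'}).
Hypothesis same : forall B, measurable B -> P (X @^-1` B) = P (Y @^-1` B).

Lemma same_law_ge0 (f : T' -> \bar R) : measurable_fun setT f -> (forall x, 0 <= f x)%E ->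
  (\int[P]_w f (X w) = \int[P]_w f (Y w))%E.
Proof.
move=> mf f0; rewrite -[LHS](ge0_integral_distribution X)// -[RHS](ge0_integral_distribution Y)//.
by apply: eq_measure_integral => A mA _; exact: same.
Qed.

Lemma same_law_Ex (F : T' -> R) : measurable_fun setT F -> L1 P (F \o Y) ->
  L1 P (F \o X) /\ Ex P (F \o X) = Ex P (F \o Y).
Proof.
move=> mF lF; have mFe : measurable_fun setT (EFin \o F) by exact/measurable_EFinP.
split.
  apply/integrableP; split; first by apply/measurable_EFinP; exact: measurableT_comp.
  rewrite (same_law_ge0 (f := fun x => `|(F x)%:E|%E))//; last exact: measurableT_comp.
  by move/integrableP : lF => [].
rewrite /Ex /Rintegral; congr fine; rewrite [LHS]integralE [RHS]integralE; congr (_ - _)%E.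
  rewrite (funepos_comp (EFin \o F) X) (funepos_comp (EFin \o F) Y); exact: (same_law_ge0 (measurable_funepos mFe)).
rewrite (funeneg_comp (EFin \o F) X) (funeneg_comp (EFin \o F) Y); exact: (same_law_ge0 (measurable_funeneg mFe)).
Qed.

End SameLaw.

Section Windows.
Context {d : measure_display} {T : measurableType d} {R : realType}.
Variables (P : probability T R) (p : nat) (y : int -> T -> 'cV[R]_p).
Hypothesis y_meas : forall t, measurable_fun setT (y t : T -> borelM R p 1).
Hypothesis stat : strictly_stationary P y.

Definition path m (s : 'I_m -> int) w : 'M[R]_(p, m) := \matrix_(i, j) y (s j) w i 0.

Lemma measurable_y t i : measurable_fun setT (fun w => y t w i 0).
Proof. exact: (measurableT_comp (measurable_coord i 0) (y_meas t)). Qed.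

Lemma measurable_path m (s : 'I_m -> int) : measurable_fun setT (path s : T -> borelM R p m).
Proof.
apply: measurable_borelM => i j; under eq_fun do rewrite mxE; exact: measurable_y.
Qed.

(** The path is measurable already when its source carries only the sigma-algebra generated by the
    times in [D]. *)
Lemma path_gen_sigma m (s : 'I_m -> int) (D : set int) (B : set (borelM R p m)) :
  (forall j, D (s j)) -> measurable B -> gen_sigma y D (path s @^-1` B).
Proof.
move=> Ds mB; pose G := [set A | exists2 t, D t &
  exists2 B : set (borelM R p 1), measurable B & A = y t @^-1` B].
have mpath : measurable_fun setT (path s : g_sigma_algebraType G -> borelM R p m).
  apply: measurable_borelM => i j _ C mC; rewrite setTI.
  apply: sub_sigma_algebra; exists (s j) => //.
  exists ((fun x : 'cV[R]_p => x i 0) @^-1` C); last first.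
    by apply/seteqP; split => w /=; rewrite mxE.
  have := @measurable_coord R p 1 i 0 measurableT C mC; by rewrite setTI.
by have := mpath measurableT B mB; rewrite setTI.
Qed.

Lemma path_shift m (s : 'I_m -> int) (h : int) (B : set (borelM R p m)) : measurable B ->
  P (path (fun j => s j + h) @^-1` B) = P (path s @^-1` B).
Proof. by move=> mB; exact: stat. Qed.

Lemma stat_Ex m (s : 'I_m -> int) (h : int) (F : 'M[R]_(p, m) -> R) :
  measurable_fun setT (F : borelM R p m -> R) -> L1 P (fun w => F (path s w)) ->
  L1 P (fun w => F (path (fun j => s j + h) w)) /\
  Ex P (fun w => F (path (fun j => s j + h) w)) = Ex P (fun w => F (path s w)).
Proof.
move=> mF lF; pose s' j := s j + h.
exact: (same_law_Ex (X := mfun_Sub (mem_set (measurable_path s')))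
  (Y := mfun_Sub (mem_set (measurable_path s))) (fun B => path_shift s h (B := B)) mF lF).
Qed.

Lemma gen_sigma_measurable (D : set int) (A : set T) : gen_sigma y D A -> measurable A.
Proof.
move=> gA; apply: (gA measurable); split.
  by split; [exact: measurable0|move=> B mB; rewrite setTD; exact: measurableC|exact: bigcupT_measurable].
move=> _ [t _ [B mB ->]]; have := y_meas t measurableT mB; by rewrite setTI.
Qed.

Definition alpha_set k := [set x : R | exists A B,
    [/\ gen_sigma y [set t | t <= 0] A, gen_sigma y [set t | k%:Z <= t] B &
        x = `|fine (P A) * fine (P B) - fine (P (A `&` B))|]].

Lemma measurable_fineP01 (A : set T) : measurable A -> 0 <= fine (P A) <= 1.
Proof.
move=> mA; rewrite fine_ge0 ?measure_ge0//=.
by rewrite -lee_fin fineK ?fin_num_measure// probability_le1.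
Qed.

Lemma alpha_set_le1 k x : alpha_set k x -> 0 <= x <= 1.
Proof.
move=> [A [B [gA gB ->]]]; have mA := gen_sigma_measurable gA; have mB := gen_sigma_measurable gB.
have /andP[a0 a1] := measurable_fineP01 mA; have /andP[b0 b1] := measurable_fineP01 mB.
have /andP[c0 c1] := measurable_fineP01 (measurableI _ _ mA mB).
rewrite normr_ge0 /= ler_norml; apply/andP; split; nra.
Qed.

(** Nonemptiness and boundedness ensure that [sup] in [alpha] is a genuine supremum rather than a
    default value. *)
Lemma alpha_set_has_sup k : has_sup (alpha_set k).
Proof.
split; last by exists 1 => x /alpha_set_le1/andP[].
exists `|fine (P set0) * fine (P set0) - fine (P (set0 `&` set0))|, set0, set0; split => //; exact: sigma_algebra0.
Qed.

Lemma alpha_ge k x : alpha_set k x -> x <= alpha P y k.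
Proof. by apply: ub_le_sup; have [] := alpha_set_has_sup k. Qed.

Lemma alpha_ge0 k : 0 <= alpha P y k.
Proof.
have [[x hx] _] := alpha_set_has_sup k.
by apply: le_trans (alpha_ge hx); have /andP[] := alpha_set_le1 hx.
Qed.

Lemma alpha_le1 k : alpha P y k <= 1.
Proof.
apply: ge_sup; first by have [] := alpha_set_has_sup k.
by move=> x /alpha_set_le1/andP[].
Qed.

Lemma gen_sigmaS (D D' : set int) : D `<=` D' -> gen_sigma y D `<=` gen_sigma y D'.
Proof.
move=> DD A gA; apply: (gA (gen_sigma y D')); split; first exact: smallest_sigma_algebra.
move=> _ [t Dt [B mB ->]]; apply: sub_sigma_algebra; exists t; [exact: DD|by exists B].
Qed.

Lemma alpha_nonincreasing k l : (k <= l)%N -> alpha P y l <= alpha P y k.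
Proof.
move=> kl; apply: sup_le_ub; first by have [] := alpha_set_has_sup l.
move=> x [A [B [gA gB ->]]]; apply: alpha_ge; exists A, B; split => //.
by apply: gen_sigmaS gB => t /=; apply: le_trans; rewrite lez_nat.
Qed.

(** The coefficient is defined with the past ending at time 0, so both paths are moved by -a. *)
Lemma path_amix m1 m2 (s1 : 'I_m1 -> int) (s2 : 'I_m2 -> int) (a : int) (k : nat)
  (u : 'M[R]_(p, m1) -> R) (v : 'M[R]_(p, m2) -> R) :
  measurable_fun setT (u : borelM R p m1 -> R) -> measurable_fun setT (v : borelM R p m2 -> R) ->
  (forall j, s1 j <= a) -> (forall j, a + k%:Z <= s2 j) ->
  amix P (alpha P y k) (u \o path s1) (v \o path s2).
Proof.
move=> mu mv h1 h2 C D mC mD.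
pose B1 : set (borelM R p m1) := u @^-1` C; pose B2 : set (borelM R p m2) := v @^-1` D.
have mB1 : measurable B1 by have := mu measurableT C mC; rewrite setTI.
have mB2 : measurable B2 by have := mv measurableT D mD; rewrite setTI.
pose s' j := s1 j - a; pose s'' j := s2 j - a.
have E1 : P ((u \o path s1) @^-1` C) = P (path s' @^-1` B1).
  by rewrite /s' path_shift.
have E2 : P ((v \o path s2) @^-1` D) = P (path s'' @^-1` B2).
  by rewrite /s'' path_shift.
(* The joint event must be shifted as a whole, so the two paths are concatenated into one before
   stationarity is applied. *)
pose s (j : 'I_(m1 + m2)) : int := match fintype.split j with inl i => s1 i | inr i => s2 i end.
pose B : set (borelM R p (m1 + m2)) := [set M | B1 (lsubmx M) /\ B2 (rsubmx M)].
have mB : measurable B.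
  have mL : measurable_fun setT (fun M : borelM R p (m1 + m2) => lsubmx M : borelM R p m1).
    by apply: measurable_borelM => i j; under eq_fun do rewrite mxE; exact: measurable_coord.
  have mR : measurable_fun setT (fun M : borelM R p (m1 + m2) => rsubmx M : borelM R p m2).
    by apply: measurable_borelM => i j; under eq_fun do rewrite mxE; exact: measurable_coord.
  have := measurableI _ _ (mL measurableT B1 mB1) (mR measurableT B2 mB2).
  by rewrite !setTI.
have pL (h : int) w : lsubmx (path (fun j => s j + h) w) = path (fun j => s1 j + h) w.
  by apply/matrixP => i j; rewrite !mxE /s (unsplitK (inl j)).
have pR (h : int) w : rsubmx (path (fun j => s j + h) w) = path (fun j => s2 j + h) w.
  by apply/matrixP => i j; rewrite !mxE /s (unsplitK (inr j)).
have E12 : P ((u \o path s1) @^-1` C `&` (v \o path s2) @^-1` D) =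
    P (path s' @^-1` B1 `&` path s'' @^-1` B2).
  have Bh h : path (fun j => s j + h) @^-1` B =
      path (fun j => s1 j + h) @^-1` B1 `&` path (fun j => s2 j + h) @^-1` B2.
    by apply/seteqP; split => w /=; rewrite /B /= pL pR.
  rewrite -(Bh (- a)) path_shift// -(path_shift s 0 mB) Bh.
  have a0 (m : nat) (r : 'I_m -> int) : (fun j => r j + 0) = r by apply/funext => j; rewrite addr0.
  by rewrite !a0.
rewrite E1 E2 E12 distrC.
apply: alpha_ge; exists (path s' @^-1` B1), (path s'' @^-1` B2); split => //.
- by apply: path_gen_sigma => // j; rewrite /s' /= subr_le0.
- by apply: path_gen_sigma => // j; rewrite /s'' /= lerBrDl.
Qed.

End Windows.

(** * Long-run variance *)

Section VarianceLimit.
Context {d : measure_display} {T : measurableType d} {R : realType}.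
Variable P : probability T R.
Variables (X : nat -> T -> R) (c : nat -> R) (K : R).
Hypothesis mX : forall i, measurable_fun setT (X i).
Hypothesis X2 : forall i, L1 P (fun w => X i w ^+ 2).
Hypothesis Xc : forall i j, (i <= j)%N -> Ex P (fun w => X i w * X j w) = c (j - i).
Hypothesis cK : forall N, \sum_(0 <= k < N) `|c k| <= K.

Lemma is_cvg_autocov : cvgn (fun n => \sum_(1 <= k < n) c k).
Proof.
have nE : [normed series c] = (fun n => \sum_(0 <= k < n) `|c k|).
  by apply/funext => n; rewrite /normed_series_of seriesEnat.
have h : cvgn (series c).
  apply: normed_cvg; rewrite nE; apply: nondecreasing_is_cvgn.
    by apply/nondecreasing_seqP => n; rewrite big_nat_recr//= lerDl.
  by exists K => _ [n _ <-]; exact: cK.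
have /cvg_ex[l hl] := h; apply/cvg_ex; exists (l - c 0).
rewrite -(cvg_shiftS (fun n => \sum_(1 <= k < n) c k)).
rewrite (_ : (fun n => _) = fun n => series c n.+1 - c 0).
  by apply: cvgB; [rewrite (cvg_shiftS (series c))|exact: cvg_cst].
by apply/funext => n; rewrite seriesEnat/= [in RHS]big_ltn// [in RHS]addrC addKr.
Qed.

Definition longrun_var := c 0 + 2 * limn (fun n => \sum_(1 <= k < n) c k).

Lemma psum_var_rec n : Ex P (fun w => psum X predT 0 n.+1 w ^+ 2) =
  Ex P (fun w => psum X predT 0 n w ^+ 2) + (c 0 + 2 * \sum_(1 <= k < n.+1) c k).
Proof.
have E w : psum X predT 0 n.+1 w ^+ 2 =
    psum X predT 0 n w ^+ 2 + (X n w ^+ 2 + 2 * (psum X predT 0 n w * psum X predT n n.+1 w)).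
  by rewrite /psum /= big_nat_recr//= big_nat1; ring.
have lA : L1 P (fun w => psum X predT 0 n w ^+ 2) by exact: L1_psum2.
have lB : L1 P (fun w => psum X predT 0 n w * psum X predT n n.+1 w) by exact: L1_psumM.
have lC : L1 P (fun w => 2 * (psum X predT 0 n w * psum X predT n n.+1 w)) by exact: L1Z.
rewrite (eq_Ex _ E) (ExD lA (L1D (X2 n) lC)) (ExD (X2 n) lC) (ExZ 2 lB) Ex_psumM//.
congr (_ + (_ + 2 * _)).
  by rewrite (eq_Ex (fun w => X n w * X n w)) => [|w]; rewrite ?expr2// Xc// subnn.
under eq_bigr do rewrite big_nat1.
rewrite (eq_big_nat _ _ (F2 := fun i => c (n - i)%N)) => [|i /andP[_ /ltnW]]; last exact: Xc.
by rewrite sum_rev_sub// subSnn.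
Qed.

(** By [psum_var_rec] the variance of the sum is a sum of increments converging to the long-run
    variance, so its quotient by n is a Cesaro mean. *)
Lemma var_cvg : (Ex P (fun w => psum X predT 0 n w ^+ 2) / n%:R) @[n --> \oo] --> longrun_var.
Proof.
pose D n := c 0 + 2 * \sum_(1 <= k < n.+1) c k.
have Dl : D @ \oo --> longrun_var.
  apply: cvgD; first exact: cvg_cst.
  apply: cvgM; first exact: cvg_cst.
  by rewrite (cvg_shiftS (fun n => \sum_(1 <= k < n) c k)); exact: is_cvg_autocov.
rewrite -(cvg_shiftS (fun n => Ex P (fun w => psum X predT 0 n w ^+ 2) / n%:R)).
apply: cvg_trans (cesaro Dl); apply: near_eq_cvg; near=> n.
rewrite /arithmetic_mean /= mulrC; congr (_ * _).
rewrite /series /=; move: n.+1 => m; elim: m => [|m IH].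
  rewrite big_geq// (eq_Ex (fun=> 0)) ?Ex_cst// => w.
  by rewrite /psum big_geq// expr0n.
by rewrite psum_var_rec big_nat_recr//= -IH.
Unshelve. all: by end_near. Qed.

End VarianceLimit.

(** * Functions of two consecutive observations *)

Section Stationary.
Context {d : measure_display} {T : measurableType d} {R : realType}.
Variables (P : probability T R) (p : nat) (y : int -> T -> 'cV[R]_p).
Hypothesis y_meas : forall t, measurable_fun setT (y t : T -> borelM R p 1).
Hypothesis stat : strictly_stationary P y.

(* Column 0 is y_t and column 1 is y_(t+1). *)
Definition win t : T -> 'M[R]_(p, 2) := path y (fun j : 'I_2 => t + j%:Z).

Lemma measurable_win t : measurable_fun setT (win t : T -> borelM R p 2).
Proof. exact: measurable_path. Qed.

Lemma win_Ex (F : 'M[R]_(p, 2) -> R) t t' : measurable_fun setT (F : borelM R p 2 -> R) ->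
  L1 P (F \o win t) -> L1 P (F \o win t') /\ Ex P (F \o win t') = Ex P (F \o win t).
Proof.
move=> mF lF; have := stat_Ex y_meas stat (t' - t) mF lF.
rewrite (_ : (fun j : 'I_2 => t + j%:Z + (t' - t)) = fun j : 'I_2 => t' + j%:Z)//.
by apply/funext => j; ring.
Qed.

Lemma win_Ex2 (F G : 'M[R]_(p, 2) -> R) t t' h : measurable_fun setT (F : borelM R p 2 -> R) ->
  measurable_fun setT (G : borelM R p 2 -> R) ->
  L1 P (fun w => F (win t w) * G (win t' w)) ->
  Ex P (fun w => F (win (t + h) w) * G (win (t' + h) w)) = Ex P (fun w => F (win t w) * G (win t' w)).
Proof.
move=> mF mG lF.
pose s (j : 'I_(2 + 2)) : int := match fintype.split j with inl i => t + i%:Z | inr i => t' + i%:Z end.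
have mL : measurable_fun setT ((fun M => lsubmx M) : borelM R p (2 + 2) -> borelM R p 2).
  by apply: measurable_borelM => i j; under eq_fun do rewrite mxE; exact: measurable_coord.
have mR : measurable_fun setT ((fun M => rsubmx M) : borelM R p (2 + 2) -> borelM R p 2).
  by apply: measurable_borelM => i j; under eq_fun do rewrite mxE; exact: measurable_coord.
pose H (M : 'M[R]_(p, 2 + 2)) := F (lsubmx M) * G (rsubmx M).
have mH : measurable_fun setT (H : borelM R p (2 + 2) -> R).
  by apply: measurable_funM; [exact: (measurableT_comp mF mL)|exact: (measurableT_comp mG mR)].
have E k w : H (path y (fun j => s j + k) w) = F (win (t + k) w) * G (win (t' + k) w).
  rewrite /H; congr (F _ * G _); apply/matrixP => i j; rewrite !mxE /s.
    by rewrite (unsplitK (inl j)) addrAC.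
  by rewrite (unsplitK (inr j)) addrAC.
have E0 w : H (path y s w) = F (win t w) * G (win t' w).
  rewrite -[t]addr0 -[t']addr0 -E; congr (H (path y _ w)); apply/funext => j; by rewrite addr0.
have lH : L1 P (fun w => H (path y s w)) by apply: (eq_L1 lF) => w; rewrite E0.
have [_ e] := stat_Ex y_meas stat h mH lH.
by rewrite -(eq_Ex _ E0) -e; apply: eq_Ex => w; rewrite E.
Qed.

(** A sum over window indices m, ..., n - 1 reads the observations at times m, ..., n, because a
    window has two columns: hence n - m + 1 columns. [inord] is only evaluated in range. *)
Lemma psum_path (g : nat -> 'M[R]_(p, 2) -> R) Q m n : (m <= n)%N ->
  (forall i, measurable_fun setT (g i : borelM R p 2 -> R)) ->
  exists2 u : 'M[R]_(p, (n - m).+1) -> R, measurable_fun setT (u : borelM R p (n - m).+1 -> R) &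
    psum (fun i => g i \o win i%:Z) Q m n = u \o path y (fun j : 'I_(n - m).+1 => (m + j)%:Z).
Proof.
move=> mn mg; pose sub i (M : 'M[R]_(p, (n - m).+1)) : 'M[R]_(p, 2) := \matrix_(a, j) M a (inord (i - m + j)).
have msub i : measurable_fun setT (sub i : borelM R p (n - m).+1 -> borelM R p 2).
  by apply: measurable_borelM => a j; under eq_fun do rewrite mxE; exact: measurable_coord.
exists (psum (fun i (M : borelM R p (n - m).+1) => g i (sub i M)) Q m n).
  apply: measurable_psum => i.
  exact: (measurableT_comp (mg i) (msub i)).
apply/funext => w; rewrite /psum /= big_nat_cond [RHS]big_nat_cond.
apply: eq_bigr => i /andP[/andP[mi ni] _]; congr (g i _); apply/matrixP => a j; rewrite !mxE.
rewrite inordK; last by have := ltn_ord j; lia.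
by congr (y _ w a 0); lia.
Qed.

(** The last past window ends at time m and the first future one starts at m + q: the lag is exactly
    [q], although windows overlap by one observation. *)
Lemma win_mix (g : nat -> 'M[R]_(p, 2) -> R) Q m q l :
  (forall i, measurable_fun setT (g i : borelM R p 2 -> R)) ->
  amix P (alpha P y q) (psum (fun i => g i \o win i%:Z) Q 0 m)
    (psum (fun i => g i \o win i%:Z) predT (m + q) (m + q + l)).
Proof.
move=> mg; have [u mu ->] := psum_path Q (leq0n m) mg.
have [v mv ->] := psum_path predT (leq_addr l (m + q)) mg.
apply: (path_amix y_meas stat (a := m%:Z)) => // j.
  by have := ltn_ord j; lia.
by lia.
Qed.

End Stationary.

(* n a_n <= 2 sum_(n/2 <= k < n) a_k by monotonicity, whence the last limit. *)
Lemma mixing_tail {R : realType} (a : nat -> R) (r : R) : (forall k, 0 <= a k <= 1) ->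
  (forall k l, (k <= l)%N -> a l <= a k) -> 0 < r <= 1 ->
  (\sum_(1 <= k <oo) (a k `^ r)%:E < +oo)%E ->
  exists gam : nat -> R, [/\ forall q N, \sum_(q <= k < N) a k `^ r <= gam q, tends0 gam &
    tends0 (fun n => n%:R * a n)].
Proof.
move=> a01 amono /andP[r0 r1] asum.
have b0 k : 0 <= a k `^ r by exact: powR_ge0.
have ab k : a k <= a k `^ r.
  have /andP[a0 a1] := a01 k; have [->|an0] := eqVneq (a k) 0; first exact: powR_ge0.
  have ak : 0 < a k by rewrite lt_def an0.
  by rewrite -{1}(powRr1 a0) /powR (negbTE an0) ler_expR ler_wnM2r// ln_le0.
pose S := fine (\sum_(1 <= k <oo) (a k `^ r)%:E).
have SE : (\sum_(1 <= k <oo) (a k `^ r)%:E = S%:E)%E.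
  rewrite fineK// ge0_fin_numE//; apply: nneseries_ge0 => k _ _; by rewrite lee_fin.
(* The given series starts at index 1; the term of index 0 is added so that tails can start
   anywhere. *)
pose u N := \sum_(0 <= k < N) a k `^ r.
have uS N : u N <= a 0 `^ r + S.
  apply: (@le_trans _ _ (u N.+1)); first by rewrite /u big_nat_recr//= lerDl.
  rewrite /u big_ltn// lerD2l -lee_fin -SE -sumEFin; apply: nneseries_lim_ge => k _ _.
  by rewrite lee_fin.
have u_mono : {homo u : n m / (n <= m)%N >-> n <= m}.
  by apply/nondecreasing_seqP => n; rewrite /u big_nat_recr//= lerDl.
have ucvg : cvgn u by apply: nondecreasing_is_cvgn => //; exists (a 0 `^ r + S) => _ [n _ <-].
pose gam q := limn u - u q.
have gamE q N : \sum_(q <= k < N) a k `^ r <= gam q.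
  rewrite /gam; have [qN|Nq] := leqP q N.
    have -> : \sum_(q <= k < N) a k `^ r = u N - u q.
      by rewrite /u (@big_cat_nat _ _ _ q 0 N)//= addrAC subrr add0r.
    by rewrite lerD2r; exact: nondecreasing_cvgn_le.
  by rewrite big_geq ?(ltnW Nq)// subr_ge0; exact: nondecreasing_cvgn_le.
have gam_lim : tends0 gam.
  have /tends0P h := ucvg => e e0; have [N HN] := h e e0; exists N => n Nn.
  by rewrite /gam distrC; exact: HN.
exists gam; split=> // e e0.
have [N HN] := gam_lim (e / 2) (divr_gt0 e0 (ltr0n _ 2)); exists N.*2 => n Nn.
have Nn2 : (N <= n./2)%N by lia.
have := HN _ Nn2; have := gamE n./2 n => h1 h2.
have /andP[an0 _] := a01 n.
rewrite ger0_norm ?mulr_ge0//.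
have : (n - n./2)%:R * a n <= \sum_(n./2 <= k < n) a k `^ r.
  rewrite mulr_natl -sumr_const_nat; apply: ler_sum_nat => k /andP[_ /ltnW kn].
  exact: le_trans (amono _ _ kn) (ab k).
have : n%:R * a n <= 2 * (n - n./2)%:R * a n.
  by apply: ler_wpM2r => //; rewrite -natrM ler_nat; lia.
have := ler_norm (gam n./2); lra.
Qed.

(** * Central limit theorem for a function of windows *)

Section WindowCLT.
Context {d : measure_display} {T : measurableType d} {R : realType}.
Variables (P : probability T R) (p : nat) (y : int -> T -> 'cV[R]_p).
Hypothesis y_meas : forall t, measurable_fun setT (y t : T -> borelM R p 1).
Hypothesis stat : strictly_stationary P y.
Variable gamma : R.
Hypothesis gamma0 : 0 < gamma.
Hypothesis mixsum : (\sum_(1 <= k <oo) (alpha P y k `^ (gamma / (4 + gamma)))%:E < +oo)%E.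
Variable g : 'M[R]_(p, 2) -> R.
Hypothesis mg : measurable_fun setT (g : borelM R p 2 -> R).
Local Notation s := ((4 + gamma) / 2).
Hypothesis gs : L1 P (fun w => `|g (win y 0 w)| `^ s).
Hypothesis g0 : Ex P (fun w => g (win y 0 w)) = 0.

Definition obs (i : nat) : T -> R := g \o win y i%:Z.
Definition autocov (k : nat) : R := Ex P (fun w => obs k w * obs 0 w).

Lemma measurable_obs i : measurable_fun setT (obs i).
Proof. exact: (measurableT_comp mg (measurable_win y_meas _)). Qed.

Let s2 : 2 < s.
Proof. by rewrite ltr_pdivlMr//; have := gamma0; lra. Qed.

Let msg : measurable_fun setT ((fun M => `|g M| `^ s) : borelM R p 2 -> R).
Proof.
have m : measurable_fun setT ((fun M => `|g M|) : borelM R p 2 -> R) by exact: measurableT_comp.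
exact: (measurableT_comp (measurable_powR s) m).
Qed.

Let B := Ex P (fun w => `|g (win y 0 w)| `^ s).

Lemma obs_moment i : L1 P (fun w => `|obs i w| `^ s) /\ Ex P (fun w => `|obs i w| `^ s) = B.
Proof. exact: (win_Ex y_meas stat i%:Z msg gs). Qed.

Lemma obs_L1sq i : L1 P (fun w => obs i w ^+ 2).
Proof. apply: L1_powR_sq (ltW s2) (measurable_obs i) _; by have [] := obs_moment i. Qed.

Lemma obs_mean i : Ex P (obs i) = 0.
Proof.
have l0 : L1 P (g \o win y 0) by have := L1_sq (measurable_obs 0) (obs_L1sq 0).
by have [_ ->] := win_Ex y_meas stat i%:Z mg l0.
Qed.

Lemma obs_autocov i j : (i <= j)%N -> Ex P (fun w => obs i w * obs j w) = autocov (j - i).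
Proof.
move=> ij; rewrite (eq_Ex (fun w => obs j w * obs i w)) => [|w]; last by rewrite mulrC.
have l : L1 P (fun w => g (win y (j - i)%N%:Z w) * g (win y 0 w)).
  exact: (L1_sqM (measurable_obs (j - i)) (measurable_obs 0) (obs_L1sq _) (obs_L1sq _)).
rewrite /autocov -[RHS](win_Ex2 y_meas stat i%:Z mg mg l).
by apply: eq_Ex => w; rewrite /obs/= add0r -PoszD subnK.
Qed.

Lemma window_clt : exists K : R, [/\ 0 <= K,
  forall N, \sum_(0 <= k < N) `|autocov k| <= K,
  forall n, Ex P (fun w => psum obs predT 0 n w ^+ 2) <= K * n%:R &
  forall t : R, tends0 (fun n => cosgap P (t / Num.sqrt n%:R) (psum obs predT 0 n)) /\
    tends0 (fun n => singap P (t / Num.sqrt n%:R) (psum obs predT 0 n))].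
Proof.
have a01 k : 0 <= alpha P y k <= 1 by rewrite alpha_ge0// alpha_le1.
have g4 : 0 < 4 + gamma by have := gamma0; lra.
have r01 : 0 < gamma / (4 + gamma) <= 1.
  by rewrite divr_gt0//= ler_pdivrMr// mul1r lerDr.
have [gam [gamE gam_lim na]] := mixing_tail a01 (alpha_nonincreasing P y_meas) r01 mixsum.
(* Davydov's exponent for moments of order (4 + gamma) / 2 is the exponent under which the
   coefficients are summable. *)
have exE : 1 - 2 / s = gamma / (4 + gamma) by field; rewrite gt_eqF.
rewrite -exE in gamE.
have XL i : L1 P (fun w => `|obs i w| `^ s) by have [] := obs_moment i.
have XB i : Ex P (fun w => `|obs i w| `^ s) <= B by have [_ ->] := obs_moment i.
have mixall f : (forall i : nat, measurable_fun setT (f i : R -> R)) -> forall Q m q l,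
    amix P (alpha P y q) (psum (fun i => f i \o obs i) Q 0 m)
      (psum (fun i => f i \o obs i) predT (m + q) (m + q + l)).
  move=> mf Q m q l; apply: (win_mix y_meas stat (g := fun i => f i \o g)) => i.
  exact: measurableT_comp.
have a1 k : alpha P y k <= 1 by exact: alpha_le1.
have B0 : 0 <= B by apply: Ex_ge0 => w; exact: powR_ge0.
pose K0 := 1 + B; pose K1 := 4 + 6 * B.
have K00 : 0 <= K0 by rewrite addr_ge0.
have K10 : 0 <= K1 by rewrite addr_ge0// mulr_ge0.
have mc := moment_cov s2 measurable_obs obs_mean XL XB mixall.
pose c := lagbound (alpha P y) s K0 K1.
have ctau q N : \sum_(q <= k < N) c k <= lagtail gam K0 K1 q.
  exact: lagtailE.
have c0 k : 0 <= c k by exact: lagbound_ge0.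
have t0 : 0 <= lagtail gam K0 K1 0 by apply: le_trans (ctau 0%N 0%N); rewrite big_geq.
exists (2 * lagtail gam K0 K1 0); split.
- by rewrite mulr_ge0.
- move=> N; apply: (@le_trans _ _ (lagtail gam K0 K1 0)); last by lra.
  apply: le_trans (ctau 0%N N); apply: ler_sum_nat => k _.
  by have := mc 0%N k (leq0n k); rewrite obs_autocov// subn0.
- move=> n; have := psum_var measurable_obs obs_L1sq c0 mc ctau predT 0 n.
  by rewrite count_all subn0.
move=> t; split=> e e0.
  have [N HN] := moment_clt s2 measurable_obs obs_mean XL XB mixall a1 na gamE gam_lim t e0.
  by exists N => n Nn; rewrite ger0_norm ?normr_ge0//; have [] := HN n Nn.
have [N HN] := moment_clt s2 measurable_obs obs_mean XL XB mixall a1 na gamE gam_lim t e0.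
by exists N => n Nn; rewrite ger0_norm ?normr_ge0//; have [] := HN n Nn.
Qed.

Lemma window_var_ge0 : 0 <= longrun_var autocov.
Proof.
have [K [_ cK _ _]] := window_clt.
have := var_cvg measurable_obs obs_L1sq obs_autocov cK.
move=> /cvgP h; have := var_cvg measurable_obs obs_L1sq obs_autocov cK => /cvg_lim <-//.
apply: limr_ge => //; near=> n; rewrite divr_ge0//; apply: Ex_ge0 => w; exact: sqr_ge0.
Unshelve. all: by end_near. Qed.

(** The Gaussian with the exact variance of the sum is replaced by the limiting one, the normalised
    variances converging by [var_cvg]. *)
Lemma window_cf (t : R) :
  (Ex P (fun w => cos (t / Num.sqrt n%:R * psum obs predT 0 n w)) @[n --> \oo] -->
     expR (- (t ^+ 2 * longrun_var autocov / 2))) /\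
  (Ex P (fun w => sin (t / Num.sqrt n%:R * psum obs predT 0 n w)) @[n --> \oo] --> (0 : R)).
Proof.
have [K [_ cK _ clt]] := window_clt; have [cg sg] := clt t; split; apply/tends0P; last first.
  by apply: tends0_le sg => n; rewrite subr0.
have vl := var_cvg measurable_obs obs_L1sq obs_autocov cK.
pose v n := Ex P (fun w => psum obs predT 0 n w ^+ 2) / n%:R.
have el : expR (- (t ^+ 2 * v n / 2)) @[n --> \oo] --> expR (- (t ^+ 2 * longrun_var autocov / 2)).
  apply: (continuous_cvg _ (@continuous_expR R _)); apply: cvgN; apply: cvgMl.
  by apply: cvgMr.
have /tends0P el' := el.
move=> e e0; have e2 : 0 < e / 2 by rewrite divr_gt0.
have [N1 H1] := cg _ e2; have [N2 H2] := el' _ e2; exists (N1 + N2).+1 => n Nn.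
have n0 : 0 < n%:R :> R by rewrite ltr0n (leq_trans _ Nn).
have := H1 n ltac:(lia); have := H2 n ltac:(lia).
rewrite (_ : t ^+ 2 * v n = (t / Num.sqrt n%:R) ^+ 2 * Ex P (fun w => psum obs predT 0 n w ^+ 2)); last first.
  by rewrite /v expr_div_n sqr_sqrtr ?(ltW n0)//; ring.
rewrite /cosgap normr_id => h2 h1; rewrite [leRHS]splitr.
by apply: le_trans (lerD h1 h2); exact: ler_distD.
Qed.

End WindowCLT.

(** * The least-squares map and the estimator *)

Section Slutsky.
Context {d : measure_display} {T : measurableType d} {R : realType}.
Variables (P : probability T R) (p k : nat) (S : nat -> T -> 'cV[R]_p) (G : nat -> T -> 'cV[R]_k).
Variables (D : nat -> T -> R) (H : 'M[R]_(k, p)) (C : R).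
Hypothesis mS : forall n b, measurable_fun setT (fun w => S n w b 0).
Hypothesis mG : forall n i, measurable_fun setT (fun w => G n w i 0).
Hypothesis S2 : forall n b, L1 P (fun w => S n w b 0 ^+ 2).
Hypothesis SC : forall n b, Ex P (fun w => S n w b 0 ^+ 2) <= C.
Hypothesis lD : forall n, L1 P (D n).
Hypothesis D0 : forall n w, 0 <= D n w.
Hypothesis D_lim : tends0 (fun n => Ex P (D n)).
Hypothesis near_GH : forall eta : R, 0 < eta -> exists2 del, 0 < del &
  forall n w, (0 < n)%N -> D n w < del ->
    forall i, `|G n w i 0 - (H *m S n w) i 0| <= eta * \sum_b `|S n w b 0|.

(** Since |x| <= 1 + x^2, this dominates the l1 norm of [S], and its mean is bounded uniformly in
    n. *)
Definition ssq n w : R := \sum_b (1 + S n w b 0 ^+ 2).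

Lemma ssq_ge0 n w : 0 <= ssq n w.
Proof. by apply: sumr_ge0 => b _; rewrite addr_ge0// sqr_ge0. Qed.

Lemma sum_abs_ssq n w : \sum_b `|S n w b 0| <= ssq n w.
Proof.
apply: ler_sum => b _; have := sqr_ge0 (`|S n w b 0| - 1); have := normr_ge0 (S n w b 0).
by rewrite sqrrB real_normK ?num_real// mulr1 expr1n; lra.
Qed.

Lemma L1_ssq n : L1 P (ssq n).
Proof. by apply: L1_sum => b _; apply: (L1D (L1_cst 1)). Qed.

Lemma Ex_ssq n : Ex P (ssq n) <= p%:R * (1 + C).
Proof.
rewrite /ssq Ex_sum => [|b _]; last exact: (L1D (L1_cst 1)).
apply: (@le_trans _ _ (\sum_(b < p) (1 + C))).
  by apply: ler_sum => b _; rewrite (ExD (L1_cst 1) (S2 n b)) (Ex_cst 1) lerD2l.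
by rewrite sumr_const card_ord mulr_natl.
Qed.

Let pC : 0 <= p%:R * (1 + C).
Proof. by apply: le_trans (Ex_ssq 0); apply: Ex_ge0 => w; exact: ssq_ge0. Qed.

Lemma measurable_HS n i : measurable_fun setT (fun w => (H *m S n w) i 0).
Proof.
by under eq_fun do rewrite mxE; apply: measurable_sum => b; exact: measurable_funM.
Qed.

(** Where D < del the Lipschitz bound and [near_GH] apply. Elsewhere the trivial bound 2 is at most
    2 D / del, whose mean tends to 0: Markov's inequality inside the integral. *)
Lemma slutsky_diff (f : R -> R) (b : 'cV[R]_k) : measurable_fun setT f ->
  (forall x, `|f x| <= 1) -> (forall x z, `|f x - f z| <= `|x - z|) ->
  tends0 (fun n => Ex P (fun w => f (dotv b (G n w))) - Ex P (fun w => f (dotv b (H *m S n w)))).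
Proof.
move=> mf f1 flip e e0.
pose nb : R := \sum_i `|b i 0|.
have nb0 : 0 <= nb by apply: sumr_ge0.
have A0 : 0 < nb * (p%:R * (1 + C)) + 1 by rewrite ltr_wpDl// mulr_ge0.
have eta0 : 0 < e / 2 / (nb * (p%:R * (1 + C)) + 1) by rewrite !divr_gt0.
set eta := e / 2 / _ in eta0; have [del del0 hdel] := near_GH eta0.
have ed : 0 < e / 4 * del by rewrite mulr_gt0// divr_gt0.
have [N HN] := D_lim ed; exists N.+1 => n Nn.
have mfG : measurable_fun setT (fun w => f (dotv b (G n w))).
  by apply: measurableT_comp => //; exact: measurable_dotv.
have mfS : measurable_fun setT (fun w => f (dotv b (H *m S n w))).
  apply: measurableT_comp => //; apply: measurable_dotv => i; exact: measurable_HS.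
rewrite -ExB; [|exact: (L1_bdd 1)|exact: (L1_bdd 1)].
have l1 : L1 P (fun w => eta * nb * ssq n w) by apply: L1Z; exact: L1_ssq.
have l2 : L1 P (fun w => 2 / del * D n w) by exact: L1Z.
apply: (@le_trans _ _ (Ex P (fun w => eta * nb * ssq n w + 2 / del * D n w))).
  apply: Ex_abs_le; [exact: measurable_funB|exact: L1D|move=> w].
  have s0 := ssq_ge0 n w; have [Dd|dD] := ltP (D n w) del; last first.
    apply: (@le_trans _ _ 2).
      by apply: (le_trans (ler_normB _ _)); rewrite -[leRHS]/(1 + 1) lerD.
    apply: (@le_trans _ _ (2 / del * D n w)).
      by rewrite mulrAC ler_pdivlMr// ler_wpM2l.
    by rewrite lerDr; apply: mulr_ge0 s0; apply: mulr_ge0 nb0; exact: ltW.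
  apply: (@le_trans _ _ (eta * nb * ssq n w)); last first.
    by rewrite lerDl mulr_ge0// divr_ge0// ltW.
  apply: (le_trans (flip _ _)); rewrite !dotvE -sumrB.
  apply: (le_trans (ler_norm_sum _ _ _)).
  rewrite (mulrC eta) -mulrA mulr_suml; apply: ler_sum => i _.
  rewrite -mulrBr normrM ler_wpM2l//.
  apply: (le_trans (hdel n w (leq_trans (ltn0Sn N) Nn) Dd i)).
  by rewrite ler_wpM2l ?(ltW eta0)//; exact: sum_abs_ssq.
rewrite (ExD l1 l2) (ExZ _ (L1_ssq n)) (ExZ _ (lD n)) [leRHS]splitr; apply: lerD.
  apply: (@le_trans _ _ (eta * (nb * (p%:R * (1 + C)) + 1))); last by rewrite /eta divfK// gt_eqF.
  rewrite -mulrA ler_wpM2l ?(ltW eta0)//.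
  by apply: (@le_trans _ _ (nb * (p%:R * (1 + C)))); [rewrite ler_wpM2l// Ex_ssq|rewrite lerDl].
have := HN n (ltnW Nn); have := ler_norm (Ex P (D n)) => h1 h2.
rewrite mulrAC ler_pdivrMr//; lra.
Qed.

Lemma slutsky_tight e : 0 < e -> exists K N, forall n, (N <= n)%N -> tailp P (G n) K <= e.
Proof.
move=> e0; have [del del0 hdel] := near_GH ltr01.
(* Bounds |G| by h [ssq] where D < del: the sum is for [H] and the 1 for the deviation allowed by
   [near_GH] with eta = 1. *)
pose h : R := 1 + \sum_i \sum_b `|H i b|.
have h0 : 1 <= h by rewrite lerDl; apply: sumr_ge0 => i _; apply: sumr_ge0.
have k1 : 0 < k%:R + 1 :> R by rewrite ltr_wpDl.
pose e1 := e / 2 / (k%:R + 1).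
have e10 : 0 < e1 by rewrite !divr_gt0.
pose K : R := (h * (p%:R * (1 + C)) + 1) / e1.
have hC : 0 <= h * (p%:R * (1 + C)) by rewrite mulr_ge0// (le_trans ler01).
have K0 : 0 < K by rewrite divr_gt0// ltr_wpDl.
have [N HN] := D_lim (mulr_gt0 e10 del0); exists K, N.+1 => n Nn.
apply: (@le_trans _ _ (\sum_(i < k) (e1 + e1))); last first.
  rewrite sumr_const card_ord -[leLHS]mulr_natr -[leLHS]mulrC.
  rewrite (_ : e = (k%:R + 1) * (e1 + e1)); last by rewrite /e1; field; rewrite gt_eqF.
  by rewrite ler_wpM2r// ?addr_ge0 ?(ltW e10)// lerDl.
apply: ler_sum => i _; rewrite -Ex_indic; last exact: measurable_tail.
have l1 : L1 P (fun w => h / K * ssq n w) by apply: L1Z; exact: L1_ssq.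
have l2 : L1 P (fun w => del^-1 * D n w) by exact: L1Z.
apply: (@le_trans _ _ (Ex P (fun w => h / K * ssq n w + del^-1 * D n w))).
  apply: Ex_le; [by apply: L1_indic; exact: measurable_tail|exact: L1D|move=> w].
  have s0 := ssq_ge0 n w.
  have t1 : 0 <= h / K * ssq n w by rewrite mulr_ge0// divr_ge0 ?(ltW K0)// (le_trans ler01).
  have t2 : 0 <= del^-1 * D n w by rewrite mulr_ge0// invr_ge0 ltW.
  rewrite indicE; case: (boolP (w \in _)) => [|_]; last exact: addr_ge0.
  rewrite inE /= => KG; have [Dd|dD] := ltP (D n w) del; last first.
    by apply: (@le_trans _ _ (del^-1 * D n w)); rewrite ?lerDr// mulrC ler_pdivlMr// mul1r.
  apply: (@le_trans _ _ (h / K * ssq n w)); last by rewrite lerDl.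
  rewrite mulrAC ler_pdivlMr// mul1r; apply: (le_trans (ltW KG)).
  have := hdel n w (leq_trans (ltn0Sn N) Nn) Dd i; rewrite mul1r => hd.
  have hs := sum_abs_ssq n w.
  have hH : `|(H *m S n w) i 0| <= (h - 1) * ssq n w.
    rewrite mxE; apply: (le_trans (ler_norm_sum _ _ _)).
    rewrite /h (addrC 1) addrK (bigD1 i)//= mulrDl.
    have r0 : 0 <= (\sum_(j < k | j != i) \sum_b `|H j b|) * ssq n w.
      by rewrite mulr_ge0//; apply: sumr_ge0 => j _; apply: sumr_ge0.
    apply: (@le_trans _ _ ((\sum_b `|H i b|) * ssq n w)); last by rewrite lerDl.
    rewrite mulr_suml; apply: ler_sum => b _; rewrite normrM ler_wpM2l//.
    by apply: le_trans hs; rewrite (bigD1 b)//= lerDl; apply: sumr_ge0.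
  have := ler_normD (G n w i 0 - (H *m S n w) i 0) ((H *m S n w) i 0).
  by rewrite subrK; lra.
rewrite (ExD l1 l2) (ExZ _ (L1_ssq n)) (ExZ _ (lD n)); apply: lerD.
  have eK : e1 * K = h * (p%:R * (1 + C)) + 1 by rewrite /K mulrC divfK// gt_eqF.
  rewrite mulrAC ler_pdivrMr// eK.
  apply: (@le_trans _ _ (h * (p%:R * (1 + C)))); last by rewrite lerDl.
  by rewrite ler_wpM2l ?Ex_ssq// (le_trans ler01).
have := HN n (ltnW Nn); have := ler_norm (Ex P (D n)) => h1 h2.
rewrite mulrC ler_pdivrMr//; lra.
Qed.

Lemma slutsky_levy (mu : probability (borelM R k 1) R) :
  (forall b, tends0 (fun n => Ex P (fun w => cos (dotv b (H *m S n w))) - Ex mu (fun x => cos (dotv b x)))) ->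
  (forall b, tends0 (fun n => Ex P (fun w => sin (dotv b (H *m S n w))) - Ex mu (fun x => sin (dotv b x)))) ->
  forall (f : 'cV[R]_k -> R) (M : R), continuous f -> (forall x, `|f x| <= M) ->
  tends0 (fun n => Ex P (fun w => f (G n w)) - Ex mu f).
Proof.
move=> hc hs f M cf fM.
have mc : measurable_fun setT (@cos R) by apply: continuous_measurable_fun; exact: continuous_cos.
have ms : measurable_fun setT (@sin R) by apply: continuous_measurable_fun; exact: continuous_sin.
have split_diff (u v w : nat -> R) : tends0 (fun n => u n - v n) -> tends0 (fun n => v n - w n) ->
    tends0 (fun n => u n - w n).
  move=> uv vw; have := tends0D uv vw; rewrite (_ : (fun n => _) = fun n => u n - w n)//.
  by apply/funext => n; ring.
apply: (levy (Y := fun x : borelM R k 1 => x)) fM => //.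
- by move=> i; exact: measurable_coord.
- move=> b; apply: split_diff (hc b); exact: (slutsky_diff b mc (@cos_le1' R) (@cos_lip R)).
- move=> b; apply: split_diff (hs b); exact: (slutsky_diff b ms (@sin_le1' R) (@sin_lip R)).
- exact: slutsky_tight.
Qed.

End Slutsky.

(** * Classes of functions closed under polynomial operations *)

Section PolynomialClosure.
Context {R : realType} {E : Type}.
Variable Q : (E -> R) -> Prop.
Hypothesis Q_cst : forall c, Q (fun=> c).
Hypothesis Q_add : forall f g, Q f -> Q g -> Q (fun x => f x + g x).
Hypothesis Q_mul : forall f g, Q f -> Q g -> Q (fun x => f x * g x).

(** [Q] is instantiated twice: by continuity at a fixed matrix in [lsq_near], and by measurability
    in [measurable_lsq]. *)
Definition entries m n (A : E -> 'M[R]_(m, n)) := forall i j, Q (fun x => A x i j).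

Lemma Q_sum I (r : seq I) (F : I -> E -> R) : (forall i, Q (F i)) -> Q (fun x => \sum_(i <- r) F i x).
Proof.
move=> QF; elim: r => [|i r IH].
  by rewrite (_ : (fun x => _) = fun=> 0)//; apply/funext => x; rewrite big_nil.
by under eq_fun do rewrite big_cons; exact: Q_add.
Qed.

Lemma Q_prod I (r : seq I) (F : I -> E -> R) : (forall i, Q (F i)) -> Q (fun x => \prod_(i <- r) F i x).
Proof.
move=> QF; elim: r => [|i r IH].
  by rewrite (_ : (fun x => _) = fun=> 1)//; apply/funext => x; rewrite big_nil.
by under eq_fun do rewrite big_cons; exact: Q_mul.
Qed.

Lemma entries_tr m n (A : E -> 'M[R]_(m, n)) : entries A -> entries (fun x => (A x)^T).
Proof. by move=> QA i j; under eq_fun do rewrite mxE; exact: QA. Qed.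

Lemma entries_mul m n r (A : E -> 'M[R]_(m, n)) (B : E -> 'M[R]_(n, r)) :
  entries A -> entries B -> entries (fun x => A x *m B x).
Proof. by move=> QA QB i j; under eq_fun do rewrite mxE; apply: Q_sum => k; exact: Q_mul. Qed.

Lemma Q_det n (A : E -> 'M[R]_n) : entries A -> Q (fun x => \det (A x)).
Proof.
move=> QA; rewrite /determinant; apply: Q_sum => s; apply: Q_mul; first exact: Q_cst.
by apply: Q_prod => i; exact: QA.
Qed.

Lemma entries_adj n (A : E -> 'M[R]_n) : entries A -> entries (fun x => \adj (A x)).
Proof.
move=> QA i j; under eq_fun do rewrite mxE; rewrite /cofactor.
apply: Q_mul; first exact: Q_cst.
by apply: Q_det => k l; under eq_fun do rewrite !mxE; exact: QA.
Qed.

End PolynomialClosure.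

Section LeastSquares.
Context {R : realType}.

Definition lsq p (M : 'M[R]_(p, 3)) : 'M[R]_(3, p) := invmx (M^T *m M) *m M^T.

Lemma lsqE p (M : 'M[R]_(p, 3)) : M^T *m M \in unitmx ->
  lsq M = (\det (M^T *m M))^-1 *: (\adj (M^T *m M) *m M^T).
Proof. by move=> u; rewrite /lsq /invmx u scalemxAl. Qed.

(** A row vector killed by the Gram matrix has an image under X^T of norm zero, and X^T has
    independent rows. *)
Lemma gram_unit p (X : 'M[R]_(p, 3)) : \rank X = 3%N -> X^T *m X \in unitmx.
Proof.
move=> rX; rewrite -row_free_unit; apply/inj_row_free => v vX.
have vXX : (v *m X^T) *m (v *m X^T)^T = 0 by rewrite trmx_mul trmxK -mulmxA (mulmxA X^T) mulmxA vX mul0mx.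
have z : v *m X^T = 0.
  apply/rowP => j; move/matrixP : vXX => /(_ 0 0); rewrite !mxE.
  under eq_bigr => j0 _ do rewrite [X in _ * X]mxE -expr2.
  move=> /eqP; rewrite psumr_eq0; last by move=> i _; exact: sqr_ge0.
  by move=> /allP/(_ j (mem_index_enum j)); rewrite /= sqrf_eq0 mxE => /eqP ->.
have fX : row_free X^T by rewrite -row_leq_rank mxrank_tr rX.
by apply: (row_free_inj fX); rewrite mul0mx.
Qed.

(** By Cramer's formula the entries are rational in those of the matrix, with a denominator that
    does not vanish at [X]; invertibility and closeness hold on a common neighbourhood. *)
Lemma lsq_near p (X : 'M[R]_(p, 3)) (eta : R) : \rank X = 3%N -> 0 < eta ->
  exists2 del : R, 0 < del & forall M : 'M[R]_(p, 3), (forall i j, `|X i j - M i j| < del) ->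
    M^T *m M \in unitmx /\ forall i j, `|lsq M i j - lsq X i j| <= eta.
Proof.
move=> rX eta0; have uX := gram_unit rX.
pose Q (f : 'M[R]_(p, 3) -> R) := f M @[M --> X] --> f X.
have FX : Filter (nbhs X) by exact: nbhs_filter.
have Qc c : Q (fun=> c) by apply: cvg_cst; exact: FX.
have QD f g : Q f -> Q g -> Q (fun x => f x + g x) by move=> Qf Qg; exact: cvgD.
have QM f g : Q f -> Q g -> Q (fun x => f x * g x) by move=> Qf Qg; exact: cvgM.
have Q1 : entries Q (@id 'M[R]_(p, 3)) by move=> i j; exact: coord_continuous.
have Qg : entries Q (fun M : 'M[R]_(p, 3) => M^T *m M).
  by apply: entries_mul => //; exact: entries_tr.
have Qd := Q_det Qc QD QM Qg.
have Qa : entries Q (fun M : 'M[R]_(p, 3) => \adj (M^T *m M) *m M^T).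
  apply: entries_mul => //; first exact: entries_adj.
  exact: entries_tr.
have d0 : \det (X^T *m X) != 0 by rewrite -unitfE -unitmxE.
pose h i j (M : 'M[R]_(p, 3)) := (\det (M^T *m M))^-1 * (\adj (M^T *m M) *m M^T) i j.
have Qh i j : Q (h i j) by apply: cvgM; [exact: (cvgV d0)|exact: Qa].
have nd : \forall M \near X, \det (M^T *m M) != 0.
  exact: (@cvgr_neq0 _ _ _ _ FX _ _ Qd d0).
have nh : \forall M \near X, forall i j, `|h i j M - h i j X| <= eta.
  apply: (filter_forall FX) => i; apply: (filter_forall FX) => j.
  by have /cvgrPdist_le/(_ _ eta0) := Qh i j; apply: (@filterS _ _ FX) => M; rewrite distrC.
have [del /= del0 hdel] := (nbhs_ballP _ _).1 (@filterI _ _ FX _ _ nd nh).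
exists del => // M XM; have [|dM hM] := hdel M; first exact: mx_ballI.
have uM : M^T *m M \in unitmx by rewrite unitmxE unitfE.
have hE (N : 'M[R]_(p, 3)) i j : N^T *m N \in unitmx -> lsq N i j = h i j N.
  by move=> uN; rewrite lsqE// mxE.
by split=> // i j; rewrite !hE.
Qed.

(** The inverse is not continuous at 0; writing it as x |x|^(-2), valid there too because 0 is
    inverted to 0, reduces the claim to measurability of a power. *)
Lemma measurable_inv : measurable_fun setT (fun x : R => x^-1).
Proof.
rewrite (_ : (fun x => _) = fun x : R => x * (`|x| `^ (- 2))).
  apply: measurable_funM => //; apply: (measurableT_comp (measurable_powR _)).
  exact: normr_measurable.
apply/funext => x; have [->|x0] := eqVneq x 0; first by rewrite invr0 mul0r.
rewrite powRN powR_mulrn ?normr_ge0// real_normK ?num_real//.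
by rewrite expr2 invfM mulrA divff// mul1r.
Qed.

Lemma measurable_lsq {d} {T : measurableType d} p (M : T -> 'M[R]_(p, 3)) :
  (forall i j, measurable_fun setT (fun w => M w i j)) ->
  forall i j, measurable_fun setT (fun w => lsq (M w) i j).
Proof.
pose Q (f : T -> R) := measurable_fun setT f.
have Qc c : Q (fun=> c) by exact: measurable_cst.
have QD f g : Q f -> Q g -> Q (fun x => f x + g x) by exact: measurable_funD.
have QM f g : Q f -> Q g -> Q (fun x => f x * g x) by exact: measurable_funM.
move=> Q1 i j.
have Qt := entries_tr (Q := Q) Q1.
have Qg := entries_mul Qc QD QM Qt Q1.
have Qd := Q_det Qc QD QM Qg.
have Qa := entries_mul Qc QD QM (entries_adj Qc QD QM Qg) Qt.
have Qb := entries_mul Qc QD QM Qg Qt.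
(* On singular Gram matrices [invmx] returns its argument, whence the first branch. *)
rewrite (_ : (fun w => _) = fun w => if \det ((M w)^T *m M w) == 0 then ((M w)^T *m M w *m (M w)^T) i j
   else (\det ((M w)^T *m M w))^-1 * (\adj ((M w)^T *m M w) *m (M w)^T) i j).
  apply: measurable_fun_ifT; first exact: measurable_fun_eqr.
    exact: Qb.
  by apply: QM; [exact: (measurableT_comp measurable_inv Qd)|exact: Qa].
apply/funext => w; have [d0|d0] := eqVneq.
  by rewrite /lsq /invmx unitmxE unitfE d0 eqxx.
by rewrite lsqE ?mxE// unitmxE unitfE.
Qed.

End LeastSquares.

(** * Moments, and passage from extended to real expectations *)

Section Bridges.
Context {d : measure_display} {T : measurableType d} {R : realType}.
Variable P : probability T R.
Implicit Types f g : T -> R.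

Lemma expectation_Ex f : L1 P f -> ('E_P[f] = (Ex P f)%:E)%E.
Proof.
move=> lf; rewrite unlock /Ex /Rintegral fineK//; exact: integrable_fin_num.
Qed.

Lemma L1_expectation f : measurable_fun setT f -> (forall w, 0 <= f w) ->
  ('E_P[f] < +oo)%E -> L1 P f.
Proof.
move=> mf f0; rewrite unlock => lf; apply/integrableP; split; first exact/measurable_EFinP.
by rewrite (eq_integral (fun w => (f w)%:E)) => [//|w _]; rewrite /= ger0_norm.
Qed.

Lemma covariance_cov f g : L1 P f -> L1 P g -> L1 P (fun w => f w * g w) ->
  covariance P f g = (cov P f g)%:E.
Proof.
move=> lf lg lfg.
rewrite covarianceE; try exact/Lfun1_integrable.
by rewrite (expectation_Ex lf) (expectation_Ex lg) (expectation_Ex lfg) -EFinM -EFinB.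
Qed.

Lemma ae_L1_Ex f g : measurable_fun setT f -> measurable_fun setT g ->
  {ae P, forall w, f w = g w} -> L1 P g -> L1 P f /\ Ex P f = Ex P g.
Proof.
move=> mf mg fg lg.
have mfe : measurable_fun setT (EFin \o f) by exact/measurable_EFinP.
have mge : measurable_fun setT (EFin \o g) by exact/measurable_EFinP.
split; last first.
  rewrite /Ex /Rintegral; congr fine; apply: ae_eq_integral => //.
  by apply: filterS fg => w /= -> _.
apply/integrableP; split => //.
rewrite (ae_eq_integral (fun w => `|(g w)%:E|%E))//; try exact: measurableT_comp.
  by move/integrableP : lg => [].
by apply: filterS fg => w /= -> _.
Qed.

Definition Lp (r : R) f := measurable_fun setT f /\ L1 P (fun w => `|f w| `^ r).

Lemma measurable_abs_powR (r : R) f : measurable_fun setT f -> measurable_fun setT (fun w => `|f w| `^ r).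
Proof.
move=> mf; apply: (measurableT_comp (measurable_powR r)); exact: measurableT_comp.
Qed.

Lemma max_powR_le (r a b : R) : 0 <= r -> 0 <= a -> 0 <= b -> Num.max a b `^ r <= a `^ r + b `^ r.
Proof.
by move=> r0 a0 b0; case: (leP a b) => _; [rewrite lerDr|rewrite lerDl]; exact: powR_ge0.
Qed.

Lemma Lp_add (r : R) f g : 0 <= r -> Lp r f -> Lp r g -> Lp r (fun w => f w + g w).
Proof.
move=> r0 [mf lf] [mg lg]; have mfg : measurable_fun setT (fun w => f w + g w) by exact: measurable_funD.
split => //; apply: (L1_dom (measurable_abs_powR r mfg) _ (L1Z (2 `^ r) (L1D lf lg))) => w.
rewrite ger0_norm ?powR_ge0//.
have m0 : 0 <= Num.max `|f w| `|g w| by rewrite le_max normr_ge0.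
apply: (@le_trans _ _ ((2 * Num.max `|f w| `|g w|) `^ r)).
  apply: ge0_ler_powR => //; rewrite ?nnegrE ?mulr_ge0//.
  apply: (le_trans (ler_normD _ _)); rewrite mulrDl mul1r.
  by apply: lerD; rewrite le_max lexx ?orbT.
by rewrite powRM// ler_wpM2l ?powR_ge0// max_powR_le.
Qed.

Lemma Lp_scale (r c : R) f : Lp r f -> Lp r (fun w => c * f w).
Proof.
move=> [mf lf]; split; first exact: measurable_funM.
by apply: (eq_L1 (L1Z (`|c| `^ r) lf)) => w; rewrite normrM powRM.
Qed.

Lemma Lp_sum (r : R) I (q : seq I) (F : I -> T -> R) : 0 < r -> (forall i, Lp r (F i)) ->
  Lp r (fun w => \sum_(i <- q) F i w).
Proof.
move=> r0 lF; elim: q => [|i q IH].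
  under eq_fun do rewrite big_nil; split; first exact: measurable_cst.
  apply: (@eq_L1 _ _ _ _ (cst 0)); first exact: (L1_cst 0).
  by move=> w; rewrite normr0 powR0// gt_eqF.
by under eq_fun do rewrite big_cons; apply: Lp_add; rewrite ?ltW.
Qed.

(** Replacing both factors by the larger one takes the place of Hoelder's inequality. *)
Lemma Lp_mul (r : R) f g : 0 < r -> Lp (r * 2) f -> Lp (r * 2) g -> Lp r (fun w => f w * g w).
Proof.
move=> r0 [mf lf] [mg lg]; have mfg : measurable_fun setT (fun w => f w * g w) by exact: measurable_funM.
split => //; apply: (L1_dom (measurable_abs_powR r mfg) _ (L1D lf lg)) => w.
rewrite ger0_norm ?powR_ge0//.
have m0 : 0 <= Num.max `|f w| `|g w| by rewrite le_max normr_ge0.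
apply: (@le_trans _ _ ((Num.max `|f w| `|g w|) `^ (r * 2))).
  rewrite [leRHS](_ : _ = ((Num.max `|f w| `|g w|) ^+ 2) `^ r); last first.
    by rewrite -powR_mulrn// -powRrM mulrC.
  apply: ge0_ler_powR; rewrite ?nnegrE ?sqr_ge0 ?(ltW r0)//.
  by rewrite normrM expr2; apply: ler_pM => //; rewrite le_max lexx ?orbT.
by apply: max_powR_le; rewrite ?mulr_ge0 ?(ltW r0).
Qed.

Lemma Lp_le (r s : R) f : 0 < r -> r <= s -> Lp s f -> Lp r f.
Proof.
move=> r0 rs [mf lf]; split => //.
apply: (L1_dom (measurable_abs_powR r mf) _ (L1D (L1_cst 1) lf)) => w /=.
rewrite ger0_norm ?powR_ge0//; have [f1|f1] := leP `|f w| 1.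
  apply: (@le_trans _ _ 1); last by rewrite lerDl powR_ge0.
  have -> : 1 = 1 `^ r :> R by rewrite powR1.
  by apply: ge0_ler_powR; rewrite ?nnegrE ?(ltW r0).
apply: (@le_trans _ _ (`|f w| `^ s)); last by rewrite lerDr.
by apply: ler_powR => //; exact: ltW.
Qed.

Lemma Lp_L1 (r : R) f : 1 <= r -> Lp r f -> L1 P f.
Proof.
move=> r1 /(Lp_le ltr01 r1)[mf lf].
by apply: (L1_dom mf _ lf) => w; rewrite powRr1.
Qed.

End Bridges.

(** * The regression equation and its estimator *)

Section Regression.
Context {d : measure_display} {T : measurableType d} {R : realType}.
Variables (P : probability T R) (p : nat) (y eps : int -> T -> 'cV[R]_p).
Hypothesis y_meas : forall t, measurable_fun setT (y t : T -> borelM R p 1).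
Hypothesis eps_meas : forall t, measurable_fun setT (eps t : T -> borelM R p 1).
Hypothesis y_mean0 : forall (t : int) (i : 'I_p), ('E_P[fun w => (y t w i 0)%R] = 0)%E.
Variables (W : 'M[R]_p) (lam0 lam1 lam2 : 'rV[R]_p).
Hypothesis model : forall t : int, {ae P, forall w,
     y t w = diag_mx lam0 *m W *m y t w + diag_mx lam1 *m y (t - 1) w
             + diag_mx lam2 *m W *m y (t - 1) w + eps t w}.
Hypothesis uncorrelated : forall (t : int) (a b : 'I_p), ecovmx P (y (t - 1)) (eps t) a b = 0%E.
Hypothesis stat : strictly_stationary P y.
Variable gamma : R.
Hypothesis gamma0 : 0 < gamma.
Hypothesis mixsum : (\sum_(1 <= k <oo) (alpha P y k `^ (gamma / (4 + gamma)))%:E < +oo)%E.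
Hypothesis y_moment : forall (i : 'I_p) (t : int),
  ('E_P[fun w => (`|dotv (unitv i) (y t w)| `^ (4 + gamma))%R] < +oo)%E.
Variable i : 'I_p.

Local Notation s := ((4 + gamma) / 2).
Local Notation win := (win y).

(** The regressors of the i-th equation read off a window, in the order of the columns of [Xhat].
    Column 1 of the window is the later time, so the first regressor is the contemporaneous one. *)
Definition reg (c : 'I_3) (M : 'M[R]_(p, 2)) : R :=
  [:: \sum_l W i l * M l 1; M i 0; \sum_l W i l * M l 0]`_c.

Definition lam : 'cV[R]_3 := col3 (lam0 0 i) (lam1 0 i) (lam2 0 i).

(* Equal to eps_(i,t+1) almost everywhere at M = win t, by the model equation. *)
Definition resid (M : 'M[R]_(p, 2)) : R := M i 1 - \sum_c lam c 0 * reg c M.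

(** The scalar <a, Z_t> with the noise replaced by the residual, which makes it a function of the
    window alone. *)
Definition score (a : 'cV[R]_p) (M : 'M[R]_(p, 2)) : R := (\sum_b a b 0 * M b 0) * resid M.

Lemma win_present t w l : win t w l 0 = y t w l 0.
Proof. by rewrite mxE addr0. Qed.

Lemma win_next t w l : win t w l 1 = y (t + 1) w l 0.
Proof. by rewrite mxE. Qed.

Lemma unitv_dot (l : 'I_p) (x : 'cV[R]_p) : dotv (unitv l) x = x l 0.
Proof.
rewrite dotvE (bigD1 l)//= big1 ?addr0 => [|j jl]; first by rewrite mxE !eqxx mul1r.
by rewrite mxE (negbTE jl) mul0r.
Qed.

Lemma wrow_dot (x : 'cV[R]_p) : dotv (wrow W i) x = \sum_l W i l * x l 0.
Proof. by rewrite dotvE; apply: eq_bigr => l _; rewrite !mxE. Qed.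

Let g4 : 0 < 4 + gamma.
Proof. by have := gamma0; lra. Qed.

Let s2E : s * 2 = 4 + gamma.
Proof. by field. Qed.

Let s1 : 1 <= s.
Proof. by rewrite ler_pdivlMr//; have := gamma0; lra. Qed.

Let s0 : 0 < s.
Proof. exact: lt_le_trans ltr01 s1. Qed.

Lemma y_Lp t l : Lp P (4 + gamma) (fun w => y t w l 0).
Proof.
have my := measurable_y y_meas t l; split => //.
apply: L1_expectation => [|w|]; [exact: measurable_abs_powR|exact: powR_ge0|].
have := y_moment l t; by under [X in expectation P X]eq_fun do rewrite unitv_dot.
Qed.

Lemma y_mean t l : Ex P (fun w => y t w l 0) = 0.
Proof.
have g1 : 1 <= 4 + gamma by have := gamma0; lra.
by have := y_mean0 t l; rewrite (expectation_Ex (Lp_L1 g1 (y_Lp t l))) => -[].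
Qed.

Lemma win_Lp t l (j : 'I_2) : Lp P (4 + gamma) (fun w => win t w l j).
Proof. by under eq_fun do rewrite mxE; exact: y_Lp. Qed.

Lemma reg_Lp c t : Lp P (4 + gamma) (fun w => reg c (win t w)).
Proof.
have ws (j : 'I_2) : Lp P (4 + gamma) (fun w => \sum_l W i l * win t w l j).
  by apply: Lp_sum => // l; apply: Lp_scale; exact: win_Lp.
by rewrite /reg; case: c => -[|[|[|//]]] ? /=; [exact: ws|exact: win_Lp|exact: ws].
Qed.

Lemma resid_Lp t : Lp P (4 + gamma) (fun w => resid (win t w)).
Proof.
have := Lp_scale (-1) (Lp_sum (index_enum 'I_3) g4 (fun c => Lp_scale (lam c 0) (reg_Lp c t))).
move=> /(Lp_add (ltW g4) (win_Lp t i 1)); rewrite /resid.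
by under eq_fun do rewrite mulN1r.
Qed.

Lemma measurable_reg c : measurable_fun setT (reg c : borelM R p 2 -> R).
Proof.
have ws (j : 'I_2) : measurable_fun setT ((fun M => \sum_l W i l * M l j) : borelM R p 2 -> R).
  by apply: measurable_sum => l; apply: measurable_funM => //; exact: measurable_coord.
by rewrite /reg; case: c => -[|[|[|//]]] ? /=; [exact: ws|exact: measurable_coord|exact: ws].
Qed.

Lemma measurable_resid : measurable_fun setT (resid : borelM R p 2 -> R).
Proof.
apply: measurable_funB; first exact: measurable_coord.
by apply: measurable_sum => c; apply: measurable_funM => //; exact: measurable_reg.
Qed.

Lemma measurable_score a : measurable_fun setT (score a : borelM R p 2 -> R).
Proof.
apply: measurable_funM; last exact: measurable_resid.
by apply: measurable_sum => b; apply: measurable_funM => //; exact: measurable_coord.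
Qed.

Lemma score_Lp a t : Lp P s (fun w => score a (win t w)).
Proof.
apply: Lp_mul => //; rewrite s2E; last exact: resid_Lp.
by apply: Lp_sum => // b; apply: Lp_scale; exact: win_Lp.
Qed.

Lemma lam_reg M : \sum_c lam c 0 * reg c M =
  lam0 0 i * (\sum_l W i l * M l 1) + lam1 0 i * M i 0 + lam2 0 i * \sum_l W i l * M l 0.
Proof. by rewrite !big_ord_recl big_ord0 /lam !mxE /reg /= addr0 addrA. Qed.

Lemma eps_resid t : {ae P, forall w, eps (t + 1) w i 0 = resid (win t w)}.
Proof.
apply: filterS (model (t + 1)) => w /(congr1 (fun x : 'cV[R]_p => x i 0)).
rewrite addrK -!mulmxA !mul_diag_mx !mxE => h.
rewrite /resid lam_reg win_next win_present.
under eq_bigr do rewrite win_next.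
under [X in _ + lam2 0 i * X]eq_bigr do rewrite win_present.
by rewrite [in RHS]h; ring.
Qed.

Lemma L1_mul4 f g : Lp P (4 + gamma) f -> Lp P (4 + gamma) g -> Lp P s (fun w => f w * g w).
Proof. by move=> lf lg; apply: Lp_mul; rewrite ?s2E. Qed.

(** The noise inherits its moments from the residual, a linear combination of observations. *)
Lemma eps_Lp t : Lp P (4 + gamma) (fun w => eps t w i 0).
Proof.
have me : measurable_fun setT (fun w => eps t w i 0).
  exact: (measurableT_comp (measurable_coord i 0) (eps_meas t)).
have [mr lr] := resid_Lp (t - 1); split => //.
have := eps_resid (t - 1); rewrite subrK => h.
have ae : {ae P, forall w, `|eps t w i 0| `^ (4 + gamma) = `|resid (win (t - 1) w)| `^ (4 + gamma)}.
  by apply: filterS h => w ->.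
by have [] := ae_L1_Ex (measurable_abs_powR (4 + gamma) me) (measurable_abs_powR (4 + gamma) mr) ae lr.
Qed.

Lemma score_unit b M : score (unitv b) M = M b 0 * resid M.
Proof.
rewrite /score (bigD1 b)//= big1 ?addr0 => [|j jl]; first by rewrite mxE !eqxx mul1r.
by rewrite mxE (negbTE jl) mul0r.
Qed.

(** Centring comes from the absence of correlation between noise and lagged observations; as the
    observations have mean zero, the covariance is the mean of the product. *)
Lemma score_unit_mean b : Ex P (fun w => score (unitv b) (win 0 w)) = 0.
Proof.
have g1 : 1 <= 4 + gamma by have := gamma0; lra.
have lye := L1_mul4 (y_Lp 0 b) (eps_Lp 1).
have := uncorrelated 1 b i; rewrite subrr /ecovmx.
rewrite (covariance_cov (Lp_L1 g1 (y_Lp 0 b)) (Lp_L1 g1 (eps_Lp 1)) (Lp_L1 s1 lye)) => -[].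
rewrite /cov y_mean mul0r subr0 => <-.
have [ms ls] := score_Lp (unitv b) 0; have [mye _] := lye.
have ae0 : {ae P, forall w, y 0 w b 0 * eps 1 w i 0 = score (unitv b) (win 0 w)}.
  have := eps_resid 0; rewrite add0r; apply: filterS => w h.
  by rewrite score_unit win_present -h.
by have [_ ->] := ae_L1_Ex mye ms ae0 (Lp_L1 s1 (conj ms ls)).
Qed.

Lemma scoreE a M : score a M = \sum_b a b 0 * score (unitv b) M.
Proof. by rewrite /score mulr_suml; apply: eq_bigr => b _; rewrite -mulrA -score_unit. Qed.

Lemma score_mean a : Ex P (fun w => score a (win 0 w)) = 0.
Proof.
have l b : L1 P (fun w => score (unitv b) (win 0 w)) := Lp_L1 s1 (score_Lp _ 0).
under eq_Ex do rewrite scoreE.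
rewrite (Ex_sum (P := P)); last by move=> b _; exact: L1Z.
by rewrite big1// => b _; rewrite (ExZ _ (l b)) score_unit_mean mulr0.
Qed.

Lemma Sigma_entry k a b : Sigma P y k a b = Ex P (fun w => y k%:Z w a 0 * y 0 w b 0).
Proof.
have g1 : 1 <= 4 + gamma by have := gamma0; lra.
have l := Lp_L1 s1 (L1_mul4 (y_Lp k%:Z a) (y_Lp 0 b)).
rewrite mxE /ecovmx (covariance_cov (Lp_L1 g1 (y_Lp k%:Z a)) (Lp_L1 g1 (y_Lp 0 b)) l) /=.
by rewrite /cov y_mean mul0r subr0.
Qed.

Definition Zeta b k (w : T) : R := score (unitv b) (win k%:Z w).

Lemma Zeta_sq b k : L1 P (fun w => Zeta b k w ^+ 2).
Proof.
have [mz lz] := score_Lp (unitv b) k%:Z.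
by apply: (@L1_powR_sq _ _ _ _ _ s) => //; rewrite ler_pdivlMr//; have := gamma0; lra.
Qed.

Lemma L1_Zeta2 b c k l : L1 P (fun w => Zeta b k w * Zeta c l w).
Proof.
have [mb _] := score_Lp (unitv b) k%:Z; have [mc _] := score_Lp (unitv c) l%:Z.
by apply: L1_sqM => //; exact: Zeta_sq.
Qed.

(** The covariances of the definition involve the noise; they are carried over to residuals by
    almost sure equality, and both means vanish. *)
Lemma lag_entry k b c : Sigma_yeps_lag P y eps i k b c = Ex P (fun w => Zeta b k w * Zeta c 0 w).
Proof.
pose Ze b k (w : T) := (eps (k%:Z + 1) w i 0 *: y k%:Z w) b 0.
have ZE b' k' : Ze b' k' = fun w => eps (k'%:Z + 1) w i 0 * y k'%:Z w b' 0.
  by apply/funext => w; rewrite /Ze mxE.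
have zae b' k' : {ae P, forall w, Ze b' k' w = Zeta b' k' w}.
  apply: filterS (eps_resid k'%:Z) => w h.
  by rewrite ZE h /Zeta score_unit win_present mulrC.
have lz b' k' : Lp P s (Zeta b' k') := score_Lp (unitv b') k'%:Z.
have mZ b' k' : measurable_fun setT (Ze b' k').
  by rewrite ZE; have [] := L1_mul4 (eps_Lp (k'%:Z + 1)) (y_Lp k'%:Z b').
have lZ b' k' : L1 P (Ze b' k') /\ Ex P (Ze b' k') = 0.
  have [mz _] := lz b' k'; have [l ->] := ae_L1_Ex (mZ b' k') mz (zae b' k') (Lp_L1 s1 (lz b' k')).
  split=> //; have [_ ->] := win_Ex y_meas stat k'%:Z (measurable_score (unitv b')) (Lp_L1 s1 (lz b' 0%N)).
  exact: score_unit_mean.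
have mzz : measurable_fun setT (fun w => Zeta b k w * Zeta c 0 w).
  by apply: measurable_funM; have [] := lz b k; have [] := lz c 0%N.
have mZZ : measurable_fun setT (fun w => Ze b k w * Ze c 0%N w) by exact: measurable_funM.
have aeZ : {ae P, forall w, Ze b k w * Ze c 0%N w = Zeta b k w * Zeta c 0 w}.
  by apply: filterS2 (zae b k) (zae c 0%N) => w -> ->.
have [lZZ eZZ] := ae_L1_Ex mZZ mzz aeZ (L1_Zeta2 b c k 0).
have [lb eb] := lZ b k; have [lc ec] := lZ c 0%N.
by rewrite mxE /ecovmx [covariance _ _ _](covariance_cov lb lc lZZ) /= /cov eb mul0r subr0.
Qed.

Local Notation lag := (Sigma_yeps_lag P y eps i).
Local Notation Sig := (Sigma_yeps P y eps i).

Lemma score_moment a : L1 P (fun w => `|score a (win 0 w)| `^ s).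
Proof. by have [] := score_Lp a 0. Qed.

Lemma obs_score a k w : obs y (score a) k w = \sum_b a b 0 * Zeta b k w.
Proof. exact: scoreE. Qed.

Lemma autocov_score a k : autocov P y (score a) k = dotv a (lag k *m a).
Proof.
rewrite /autocov dotvE; under eq_Ex do rewrite !obs_score mulr_suml.
have l b c : L1 P (fun w => a c 0 * (Zeta b k w * Zeta c 0 w)) by apply: L1Z; exact: L1_Zeta2.
have E b w : a b 0 * Zeta b k w * (\sum_c a c 0 * Zeta c 0 w) =
    a b 0 * \sum_c a c 0 * (Zeta b k w * Zeta c 0 w).
  by rewrite -mulrA; congr (_ * _); rewrite mulr_sumr; apply: eq_bigr => c _; ring.
under eq_Ex do under eq_bigr do rewrite E.
have l' b : L1 P (fun w => \sum_c a c 0 * (Zeta b k w * Zeta c 0 w)) by apply: L1_sum => c _.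
rewrite (Ex_sum (P := P)); last by move=> b _; exact: L1Z.
apply: eq_bigr => b _; rewrite (ExZ _ (l' b)) mxE; congr (_ * _).
rewrite (Ex_sum (P := P)) => [|c _]; last exact: l.
by apply: eq_bigr => c _; rewrite (ExZ _ (L1_Zeta2 b c k 0)) lag_entry mulrC.
Qed.

Lemma score_autocov_cvg a : cvgn (fun n => \sum_(1 <= k < n) dotv a (lag k *m a)).
Proof.
have [K [_ cK _ _]] := window_clt y_meas stat gamma0 mixsum (measurable_score a) (score_moment a) (score_mean a).
have := is_cvg_autocov cK; rewrite (_ : (fun n => _) = fun n => \sum_(1 <= k < n) dotv a (lag k *m a))//.
by apply/funext => n; apply: eq_bigr => k _; exact: autocov_score.
Qed.

(* Reduces the convergence of the series defining Sigma_yeps, entry by entry, to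
   that of the autocovariances of scalar processes. *)
Lemma polarization (M : 'M[R]_p) b c : (M + M^T) b c =
  2^-1 * (dotv (unitv b + unitv c) (M *m (unitv b + unitv c)) -
          dotv (unitv b - unitv c) (M *m (unitv b - unitv c))).
Proof.
have u (j l : 'I_p) : dotv (unitv j) (M *m unitv l) = M j l.
  rewrite unitv_dot mxE (bigD1 l)//= big1 ?addr0 => [|k kl]; first by rewrite mxE !eqxx mulr1.
  by rewrite mxE (negbTE kl) mulr0.
have dD (a x z : 'cV[R]_p) : dotv a (x + z) = dotv a x + dotv a z by rewrite /dotv mulmxDr mxE.
have dN (a x : 'cV[R]_p) : dotv a (- x) = - dotv a x by rewrite /dotv mulmxN mxE.
by rewrite !mulmxDr mulmxN !dD !dotvDl !dN !dotvNl !u !mxE; field.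
Qed.

Lemma lag_sum_cvg b c : cvgn (fun m => \sum_(1 <= j < m) (lag j + (lag j)^T) b c).
Proof.
rewrite (_ : (fun m => _) = fun m => 2^-1 *
  (\sum_(1 <= k < m) dotv (unitv b + unitv c) (lag k *m (unitv b + unitv c)) -
   \sum_(1 <= k < m) dotv (unitv b - unitv c) (lag k *m (unitv b - unitv c)))).
  by apply: is_cvgMr; apply: is_cvgB; exact: score_autocov_cvg.
by apply/funext => m; rewrite -sumrB mulr_sumr; apply: eq_bigr => k _; exact: polarization.
Qed.

Lemma tends0_sum I (r : seq I) (F : I -> nat -> R) : (forall j, tends0 (F j)) ->
  tends0 (fun n => \sum_(j <- r) F j n).
Proof.
move=> tF; elim: r => [|j r IH].
  by move=> e e0; exists 0%N => n _; rewrite big_nil normr0 ltW.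
have h := tends0D (tF j) IH => e e0; have [N HN] := h e e0.
by exists N => n Nn; rewrite big_cons; exact: HN.
Qed.

(** A quadratic form does not distinguish a matrix from its transpose, so twice the sum of the forms
    of the lags is the sum of the forms of the symmetrised lags, whose series converges entrywise by
    [lag_sum_cvg]. *)
Lemma longrun_score a : longrun_var (autocov P y (score a)) = dotv a (Sig *m a).
Proof.
pose F m (b c : 'I_p) := \sum_(1 <= j < m) (lag j + (lag j)^T) b c.
pose L := \matrix_(b, c) limn (fun m => F m b c).
have SE : Sig = lag 0 + L by [].
have dD (x z : 'cV[R]_p) : dotv a (x + z) = dotv a x + dotv a z by rewrite /dotv mulmxDr mxE.
rewrite SE mulmxDl dD /longrun_var autocov_score; congr (_ + _).
rewrite (_ : (fun n => _) = fun n => \sum_(1 <= k < n) dotv a (lag k *m a)); last first.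
  by apply/funext => n; apply: eq_bigr => k _; exact: autocov_score.
have quadE (M : 'M[R]_p) : dotv a (M *m a) = \sum_b \sum_c a b 0 * a c 0 * M b c.
  rewrite dotvE; apply: eq_bigr => b _; rewrite mxE mulr_sumr.
  by apply: eq_bigr => c _; ring.
have dT (M : 'M[R]_p) : dotv a (M^T *m a) = dotv a (M *m a).
  rewrite !quadE exchange_big; apply: eq_bigr => b _; apply: eq_bigr => c _.
  by rewrite mxE; ring.
have E n : 2 * \sum_(1 <= k < n) dotv a (lag k *m a) = \sum_b \sum_c a b 0 * a c 0 * F n b c.
  rewrite mulr_sumr (eq_bigr (fun k => dotv a ((lag k + (lag k)^T) *m a))) => [|k _]; last first.
    by rewrite mulmxDl dD dT; ring.
  under eq_bigr do rewrite quadE.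
  rewrite exchange_big; apply: eq_bigr => b _; rewrite exchange_big; apply: eq_bigr => c _.
  by rewrite -mulr_sumr.
have h1 : (2 * \sum_(1 <= k < n) dotv a (lag k *m a)) @[n --> \oo] -->
    2 * limn (fun n => \sum_(1 <= k < n) dotv a (lag k *m a)).
  by apply: cvgMr; exact: score_autocov_cvg.
have h2 : (2 * \sum_(1 <= k < n) dotv a (lag k *m a)) @[n --> \oo] --> dotv a (L *m a).
  apply/tends0P; rewrite quadE.
  rewrite (_ : (fun n => _) = fun n => \sum_b \sum_c a b 0 * a c 0 * (F n b c - L b c)).
    apply: tends0_sum => b; apply: tends0_sum => c; apply: tends0Z; apply/tends0P.
    by rewrite mxE; exact: lag_sum_cvg.
  apply/funext => n; rewrite E -sumrB; apply: eq_bigr => b _; rewrite -sumrB; apply: eq_bigr => c _.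
  by rewrite mulrBr.
exact: cvg_unique h1 h2.
Qed.

(** The form is a limit of normalised variances. *)
Lemma Sigma_yeps_psd a : 0 <= dotv a (Sig *m a).
Proof.
rewrite -longrun_score.
exact: (window_var_ge0 y_meas stat gamma0 mixsum (measurable_score a) (score_moment a) (score_mean a)).
Qed.

Lemma Sigma_yeps_sym : Sig^T = Sig.
Proof.
have E (M : 'M[R]_p) b c : (M + M^T) b c = M b c + M c b by rewrite !mxE.
apply/matrixP => b c; rewrite mxE /Sigma_yeps [LHS]mxE [RHS]mxE; congr (_ + _).
  by rewrite !lag_entry; apply: eq_Ex => w; rewrite mulrC.
rewrite [LHS]mxE [RHS]mxE; congr (limn _); apply/funext => m; apply: eq_bigr => j _.
by rewrite !E addrC.
Qed.

(** Mean-square law of large numbers with rate 1/n, from the linear variance bound in [window_clt]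
    applied to the centred function. The bound excludes n = 0, where the average is 0 by
    convention. *)
Lemma window_lln (h : 'M[R]_(p, 2) -> R) : measurable_fun setT (h : borelM R p 2 -> R) ->
  Lp P s (fun w => h (win 0 w)) ->
  exists K : R, forall n,
    let dev w := n%:R^-1 * \sum_(0 <= t < n) h (win t%:Z w) - Ex P (fun w => h (win 0 w)) in
    L1 P (fun w => dev w ^+ 2) /\ ((0 < n)%N -> Ex P (fun w => dev w ^+ 2) <= K / n%:R).
Proof.
move=> mh lh; set m := Ex P _; pose g M := h M + - m.
have mg : measurable_fun setT (g : borelM R p 2 -> R) by exact: measurable_funD.
have lm : Lp P s (fun=> - m).
  by split; [exact: measurable_cst|exact: (L1_cst (`|- m| `^ s))].
have lg : Lp P s (fun w => g (win 0 w)) by exact: (Lp_add (ltW s0) lh lm).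
have g0 : Ex P (fun w => g (win 0 w)) = 0.
  by rewrite /g (ExD (Lp_L1 s1 lh) (Lp_L1 s1 lm)) (Ex_cst (- m)) subrr.
have [_ lgs] := lg.
have [K [K0 _ var _]] := window_clt y_meas stat gamma0 mixsum mg lgs g0.
exists K => n dev.
have mo := measurable_obs y_meas mg.
have lo k : L1 P (fun w => obs y g k w ^+ 2).
  exact: (obs_L1sq y_meas stat gamma0 mg lgs).
have lp2 : L1 P (fun w => psum (obs y g) predT 0 n w ^+ 2) by exact: L1_psum2.
have devE : (0 < n)%N -> forall w, dev w = n%:R^-1 * psum (obs y g) predT 0 n w.
  move=> n0 w; have nn : n%:R != 0 :> R by rewrite pnatr_eq0 -lt0n.
  rewrite /dev /psum /= /obs /g /= big_split/= mulrDr; congr (_ + _).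
  by rewrite sumr_const_nat subn0 -(mulr_natl (- m) n) mulKf.
have [n0|n0] := posnP n.
  split=> [|]; last by rewrite n0.
  apply: (@eq_L1 _ _ _ _ (cst (m ^+ 2))); first exact: L1_cst.
  by move=> w; rewrite /dev n0 big_geq// mulr0 sub0r sqrrN.
have E : (fun w => dev w ^+ 2) = fun w => n%:R^-2 * psum (obs y g) predT 0 n w ^+ 2.
  by apply/funext => w; rewrite devE// exprMn exprVn.
rewrite E; split=> [|_]; first exact: L1Z.
rewrite (ExZ _ lp2); apply: (@le_trans _ _ (n%:R^-2 * (K * n%:R))).
  by rewrite ler_wpM2l// invr_ge0 exprn_ge0.
by rewrite le_eqVlt; apply/orP; left; apply/eqP; field; rewrite pnatr_eq0 -lt0n.
Qed.

Hypothesis X_rank : \rank (Xmx P y W i) = 3%N.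

Local Notation X := (Xmx P y W i).
Local Notation Xh := (Xhat y W i).

(** The index is lowered by one: the average over t = 1, ..., n becomes one over windows starting at
    0, ..., n - 1. *)
Lemma lagavg_entry n w (g : int -> R) b :
  lagavg y n w g b 0 = n%:R^-1 * \sum_(0 <= t < n) g (t%:Z + 1) * y t%:Z w b 0.
Proof.
rewrite /lagavg mxE summxE big_add1 /=; congr (_ * _); apply: eq_bigr => t _.
have -> : t.+1%:Z = t%:Z + 1 by rewrite -addn1 PoszD.
by rewrite mxE addrK.
Qed.

Definition cross (b : 'I_p) c (M : 'M[R]_(p, 2)) : R := reg c M * M b 0.

Lemma Xhat_entry n w b c : Xh n w b c = n%:R^-1 * \sum_(0 <= t < n) cross b c (win t%:Z w).
Proof.
rewrite mxE /cross /reg; case: c => -[|[|[|//]]] ? /=; rewrite lagavg_entry; congr (_ * _);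
  apply: eq_bigr => t _; rewrite win_present.
- by rewrite wrow_dot; congr (_ * _); apply: eq_bigr => l _; rewrite win_next.
- by rewrite addrK win_present.
- by rewrite wrow_dot addrK; congr (_ * _); apply: eq_bigr => l _; rewrite win_present.
Qed.

Lemma measurable_cross b c : measurable_fun setT (cross b c : borelM R p 2 -> R).
Proof. by apply: measurable_funM; [exact: measurable_reg|exact: measurable_coord]. Qed.

Lemma cross_Lp b c t : Lp P s (fun w => cross b c (win t w)).
Proof. by apply: L1_mul4; [exact: reg_Lp|exact: win_Lp]. Qed.

Lemma Xmx_entry b c : X b c = Ex P (fun w => cross b c (win 0 w)).
Proof.
have l0 j l : L1 P (fun w => y 0 w j 0 * y 0 w l 0) := Lp_L1 s1 (L1_mul4 (y_Lp 0 j) (y_Lp 0 l)).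
have l1 j l : L1 P (fun w => y 1 w j 0 * y 0 w l 0) := Lp_L1 s1 (L1_mul4 (y_Lp 1 j) (y_Lp 0 l)).
rewrite mxE /cross /reg; case: c => -[|[|[|//]]] ? /=.
- rewrite mxE (eq_Ex (fun w => \sum_l W i l * (y 1 w l 0 * y 0 w b 0))) => [|w]; last first.
    by rewrite win_present mulr_suml; apply: eq_bigr => l _; rewrite win_next add0r mulrA.
  rewrite (Ex_sum (P := P)) => [|l _]; last exact: L1Z.
  apply: eq_bigr => l _; rewrite (ExZ _ (l1 l b)) [X in X * _]mxE Sigma_entry.
  by rewrite [X in _ * X]mxE [X in _ * X]mxE mulrC.
- rewrite mxE (bigD1 i)//= big1 ?addr0 => [|j ji].
    rewrite [X in _ * X]mxE !eqxx mulr1 Sigma_entry; apply: eq_Ex => w.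
    by rewrite !win_present mulrC.
  by rewrite [X in _ * X]mxE (negbTE ji) mulr0.
- rewrite mxE (eq_Ex (fun w => \sum_l W i l * (y 0 w l 0 * y 0 w b 0))) => [|w]; last first.
    by rewrite win_present mulr_suml; apply: eq_bigr => l _; rewrite win_present mulrA.
  rewrite (Ex_sum (P := P)) => [|l _]; last exact: L1Z.
  apply: eq_bigr => l _; rewrite (ExZ _ (l0 l b)) Sigma_entry [X in _ * X]mxE [X in _ * X]mxE mulrC.
  by congr (_ * _); apply: eq_Ex => w; rewrite mulrC.
Qed.

Definition Svec n w : 'cV[R]_p := \col_b ((Num.sqrt n%:R)^-1 * \sum_(0 <= t < n) Zeta b t w).

Definition dist2 n w : R := \sum_b \sum_c (Xh n w b c - X b c) ^+ 2.

Definition err n w : 'cV[R]_3 := Num.sqrt n%:R *: (lambda_hat y W i n w - lam).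

(** The identity holds at every point, not merely almost everywhere, because the residual is defined
    from the observations. *)
Lemma Yhat_entry n w b : Yhat y i n w b 0 =
  (Xh n w *m lam) b 0 + n%:R^-1 * \sum_(0 <= t < n) Zeta b t w.
Proof.
have E t : y (t%:Z + 1) w i 0 * y t%:Z w b 0 =
    \sum_c lam c 0 * cross b c (win t%:Z w) + Zeta b t w.
  rewrite -win_next -win_present /Zeta score_unit /resid /cross mulrBr mulr_sumr.
  rewrite (eq_bigr (fun c => win t%:Z w b 0 * (lam c 0 * reg c (win t%:Z w)))) => [|c _]; last by ring.
  by rewrite addrC subrK mulrC.
rewrite lagavg_entry (eq_bigr _ (fun t _ => E t)) big_split mulrDr; congr (_ + _).
rewrite mxE exchange_big mulr_sumr; apply: eq_bigr => c _.
by rewrite Xhat_entry -mulr_sumr; ring.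
Qed.

Lemma err_lsq n w : (0 < n)%N -> (Xh n w)^T *m Xh n w \in unitmx ->
  err n w = lsq (Xh n w) *m Svec n w.
Proof.
move=> n0 u; have nn : 0 < n%:R :> R by rewrite ltr0n.
have YE : Yhat y i n w = Xh n w *m lam + (Num.sqrt n%:R)^-1 *: Svec n w.
  apply/colP => b; rewrite Yhat_entry [RHS]mxE; congr (_ + _).
  by rewrite !mxE mulrA -invfM -expr2 sqr_sqrtr// ltW.
rewrite /err /lambda_hat YE mulmxDr -/(lsq (Xh n w)) mulmxA.
have -> : lsq (Xh n w) *m Xh n w = 1%:M by rewrite /lsq -mulmxA mulVmx.
rewrite mul1mx addrC addKr -scalemxAr scalerA divff ?scale1r//.
by rewrite gt_eqF// sqrtr_gt0.
Qed.

Lemma measurable_Xhat n b c : measurable_fun setT (fun w => Xh n w b c).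
Proof.
under eq_fun do rewrite Xhat_entry; apply: measurable_funM => //; apply: measurable_sum => t.
exact: (measurableT_comp (measurable_cross b c) (measurable_win y_meas _)).
Qed.

Lemma measurable_Zeta_sum n b : measurable_fun setT (fun w => \sum_(0 <= t < n) Zeta b t w).
Proof.
apply: measurable_sum => t.
exact: (measurableT_comp (measurable_score (unitv b)) (measurable_win y_meas _)).
Qed.

Lemma measurable_Svec n b : measurable_fun setT (fun w => Svec n w b 0).
Proof.
under eq_fun do rewrite mxE; apply: measurable_funM => //; exact: measurable_Zeta_sum.
Qed.

Lemma measurable_err n c : measurable_fun setT (fun w => err n w c 0).
Proof.
have mX := measurable_lsq (measurable_Xhat n).
have mY b : measurable_fun setT (fun w => Yhat y i n w b 0).
  under eq_fun do rewrite Yhat_entry mxE; apply: measurable_funD.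
    by apply: measurable_sum => j; apply: measurable_funM => //; exact: measurable_Xhat.
  by apply: measurable_funM => //; exact: measurable_Zeta_sum.
rewrite (_ : (fun w => _) = fun w => Num.sqrt n%:R *
    ((\sum_b lsq (Xh n w) c b * Yhat y i n w b 0) - lam c 0)).
  apply: measurable_funM => //; apply: measurable_funB => //.
  by apply: measurable_sum => b; exact: measurable_funM.
apply/funext => w; rewrite /err /lambda_hat -/(lsq (Xh n w)) mxE; congr (_ * _).
by rewrite mxE; congr (_ + _); rewrite mxE.
Qed.

Lemma Svec_dot a n w : dotv a (Svec n w) = (Num.sqrt n%:R)^-1 * psum (obs y (score a)) predT 0 n w.
Proof.
rewrite dotvE /psum /= (eq_bigr _ (fun t _ => obs_score a t w)) exchange_big mulr_sumr.
apply: eq_bigr => b _; rewrite mxE -mulr_sumr; ring.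
Qed.

Lemma Svec_moment : exists C : R, forall n b, L1 P (fun w => Svec n w b 0 ^+ 2) /\
  Ex P (fun w => Svec n w b 0 ^+ 2) <= C.
Proof.
have H b : exists K : R, 0 <= K /\ forall n, L1 P (fun w => Svec n w b 0 ^+ 2) /\
    Ex P (fun w => Svec n w b 0 ^+ 2) <= K.
  have [K [K0 _ var _]] := window_clt y_meas stat gamma0 mixsum (measurable_score (unitv b))
    (score_moment (unitv b)) (score_mean (unitv b)).
  exists K; split => // n.
  have E : (fun w => Svec n w b 0 ^+ 2) =
      fun w => n%:R^-1 * psum (obs y (score (unitv b))) predT 0 n w ^+ 2.
    apply/funext => w; rewrite mxE exprMn exprVn sqr_sqrtr//.
  have mo := measurable_obs y_meas (measurable_score (unitv b)).
  have lo k : L1 P (fun w => obs y (score (unitv b)) k w ^+ 2).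
    exact: (obs_L1sq y_meas stat gamma0 (measurable_score (unitv b)) (score_moment (unitv b))).
  have lp2 : L1 P (fun w => psum (obs y (score (unitv b))) predT 0 n w ^+ 2) by exact: L1_psum2.
  rewrite E; split; first exact: L1Z.
  rewrite (ExZ _ lp2); have [->|n0] := posnP n; first by rewrite invr0 mul0r.
  by rewrite mulrC ler_pdivrMr// ltr0n.
have /choice[K HK] := H; exists (\sum_b K b) => n b.
have [_ /(_ n)[l e]] := HK b; split => //; apply: (le_trans e).
by rewrite (bigD1 b)//= lerDl; apply: sumr_ge0 => j _; have [] := HK j.
Qed.

Lemma dist2_lim : (forall n, L1 P (dist2 n)) /\ tends0 (fun n => Ex P (dist2 n)).
Proof.
have H b c := window_lln (measurable_cross b c) (cross_Lp b c 0).
have E n : dist2 n = fun w => \sum_b \sum_c (n%:R^-1 * \sum_(0 <= t < n) cross b c (win t%:Z w)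
    - Ex P (fun w => cross b c (win 0 w))) ^+ 2.
  by apply/funext => w; apply: eq_bigr => b _; apply: eq_bigr => c _; rewrite Xhat_entry Xmx_entry.
have l n b c : L1 P (fun w => (n%:R^-1 * \sum_(0 <= t < n) cross b c (win t%:Z w)
    - Ex P (fun w => cross b c (win 0 w))) ^+ 2).
  by have [K /(_ n)[]] := H b c.
have l' n b := @L1_sum _ _ _ P _ (index_enum 'I_3) predT _ (fun c _ => l n b c).
split=> [n|]; first by rewrite E; apply: L1_sum => b _; exact: l'.
rewrite (_ : (fun n => _) = fun n => \sum_b \sum_c
    Ex P (fun w => (n%:R^-1 * \sum_(0 <= t < n) cross b c (win t%:Z w)
    - Ex P (fun w => cross b c (win 0 w))) ^+ 2)); last first.
  apply/funext => n; rewrite E (Ex_sum (P := P)) => [|b _]; last exact: l'.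
  by apply: eq_bigr => b _; rewrite (Ex_sum (P := P)) => [|c _]; [|exact: l].
apply: tends0_sum => b; apply: tends0_sum => c e e0; have [K HK] := H b c.
have [N [N0 HN]] := ex_nat_ge (K / e); exists N => n Nn.
have n0 : (0 < n)%N := leq_trans N0 Nn.
rewrite ger0_norm; last by apply: Ex_ge0 => w; exact: sqr_ge0.
have [_ /(_ n0) h] := HK n; apply: (le_trans h).
rewrite ler_pdivrMr ?ltr0n// mulrC -ler_pdivrMr//; apply: (le_trans HN).
by rewrite ler_nat.
Qed.

Lemma err_near (eta : R) : 0 < eta -> exists2 del : R, 0 < del &
  forall n w, (0 < n)%N -> dist2 n w < del ->
    forall c, `|err n w c 0 - (lsq X *m Svec n w) c 0| <= eta * \sum_b `|Svec n w b 0|.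
Proof.
move=> eta0; have [del del0 hdel] := lsq_near X_rank eta0.
exists (del ^+ 2) => [|n w n0 Dd c]; first exact: exprn_gt0.
(* A single entry off by [del] would already make the squared distance at least del^2. *)
have XhX b j : `|X b j - Xh n w b j| < del.
  rewrite distrC ltNge; apply/negP => h.
  have : del ^+ 2 <= (Xh n w b j - X b j) ^+ 2.
    by rewrite -[leRHS]real_normK ?num_real// lerXn2r ?nnegrE ?(ltW del0)//.
  apply/negP; rewrite -ltNge; apply: le_lt_trans Dd.
  rewrite /dist2 (bigD1 b)//= (bigD1 j)//= -addrA lerDl addr_ge0//.
    by apply: sumr_ge0 => k _; exact: sqr_ge0.
  by apply: sumr_ge0 => k _; apply: sumr_ge0 => l _; exact: sqr_ge0.
have [u hl] := hdel _ XhX.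
rewrite err_lsq// !mxE -sumrB mulr_sumr; apply: (le_trans (ler_norm_sum _ _ _)).
apply: ler_sum => b _; rewrite -mulrBl normrM ler_wpM2r//; exact: hl.
Qed.

(** The sandwich V^-1 U V^-1 is [lsq X] times Sigma times its transpose, that is, the covariance of
    the image under [lsq X] of a vector with covariance Sigma. *)
Lemma asymptotic_cov_quad b : dotv b (invmx (Vmx P y W i) *m Umx P y W eps i *m invmx (Vmx P y W i) *m b) =
  dotv ((lsq X)^T *m b) (Sig *m ((lsq X)^T *m b)).
Proof.
have VT : (invmx (Vmx P y W i))^T = invmx (Vmx P y W i).
  by rewrite trmx_inv /Vmx trmx_mul trmxK.
rewrite /dotv /lsq !trmx_mul !trmxK -/(Vmx P y W i) VT /Umx; congr (_ 0 0).
by rewrite !mulmxA.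
Qed.

Lemma asymptotic_cov_sym : (invmx (Vmx P y W i) *m Umx P y W eps i *m invmx (Vmx P y W i))^T =
  invmx (Vmx P y W i) *m Umx P y W eps i *m invmx (Vmx P y W i).
Proof.
have VT : (invmx (Vmx P y W i))^T = invmx (Vmx P y W i).
  by rewrite trmx_inv /Vmx trmx_mul trmxK.
by rewrite !trmx_mul VT trmxK Sigma_yeps_sym !mulmxA.
Qed.

Lemma estimator_clt : exists mu : probability (borelM R 3 1) R,
  is_mvnormal mu 0 (invmx (Vmx P y W i) *m Umx P y W eps i *m invmx (Vmx P y W i)) /\
  cvg_in_distribution P err mu.
Proof.
have [|mu [mu_normal mu_cf]] := mvnormal_exists asymptotic_cov_sym.
  by move=> b; rewrite asymptotic_cov_quad; exact: Sigma_yeps_psd.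
exists mu; split => // f cf [M fM].
have [C HC] := Svec_moment; have [lD D_lim] := dist2_lim.
have D0 n w : 0 <= dist2 n w.
  by apply: sumr_ge0 => b _; apply: sumr_ge0 => c _; exact: sqr_ge0.
(* Cramer-Wold: a linear form of the limit candidate is a normalised sum of scalar scores with
   weight vector (lsq X)^T b, to which [window_cf] applies at t = 1. *)
have dotT b n w : dotv b (lsq X *m Svec n w) =
    1 / Num.sqrt n%:R * psum (obs y (score ((lsq X)^T *m b))) predT 0 n w.
  by rewrite div1r -Svec_dot /dotv trmx_mul trmxK mulmxA.
have wcf b := window_cf y_meas stat gamma0 mixsum (measurable_score ((lsq X)^T *m b))
  (score_moment _) (score_mean _) 1.
have lim : tends0 (fun n => Ex P (fun w => f (err n w)) - Ex mu f).
  apply: (slutsky_levy measurable_Svec measurable_err (fun n b => (HC n b).1) (fun n b => (HC n b).2)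
    lD D0 D_lim err_near _ _ cf fM) => b; apply/tends0P.
    have [wc _] := wcf b; have [mc _] := mu_cf b.
    have -> : Ex mu (fun x => cos (dotv b x)) = Ex mu (fun x => cos (1 * dotv b x)).
      by apply: eq_Ex => x; rewrite mul1r.
    rewrite mc asymptotic_cov_quad -longrun_score.
    by under eq_fun do under eq_Ex do rewrite dotT.
  have [_ ws] := wcf b; have [_ ms] := mu_cf b.
  have -> : Ex mu (fun x => sin (dotv b x)) = Ex mu (fun x => sin (1 * dotv b x)).
    by apply: eq_Ex => x; rewrite mul1r.
  rewrite ms.
  by under eq_fun do under eq_Ex do rewrite dotT.
have lf n : L1 P (fun w => f (err n w)).
  by apply: (L1_bdd M (measurable_continuous_vec (measurable_err n) cf)) => w.
have lmu : L1 mu f by apply: (L1_bdd M (continuous_borelM cf)).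
have := expectation_Ex lmu; rewrite [in X in X -> _]unlock => ->.
under eq_fun do rewrite (expectation_Ex (lf _)).
by apply: cvg_EFin; [near=> n|apply/tends0P].
Unshelve. all: by end_near. Qed.

End Regression.

Theorem theorem1 (d : measure_display) (T : measurableType d) (R : realType)
  (P : probability T R) (p : nat) (hp : (1 <= p)%N)
  (y eps : int -> T -> 'cV[R]_p)
  (y_meas : forall t, measurable_fun setT (y t : T -> borelM R p 1))
  (eps_meas : forall t, measurable_fun setT (eps t : T -> borelM R p 1))
  (y_mean0 : forall (t : int) (i : 'I_p), ('E_P[fun w => (y t w i 0)%R] = 0)%E)
  (W : 'M[R]_p) (lam0 lam1 lam2 : 'rV[R]_p)
  (model : forall t : int, {ae P, forall w,
     y t w = diag_mx lam0 *m W *m y t w + diag_mx lam1 *m y (t - 1) w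
             + diag_mx lam2 *m W *m y (t - 1) w + eps t w})
  (A1_diag : forall i : 'I_p, W i i = 0)
  (A1_inv : 1%:M - diag_mx lam0 *m W \in unitmx)
  (A2a : forall (t : int) (a b : 'I_p),
     ecovmx P (y (t - 1)) (eps t) a b = 0%E)
  (A2b_stat : strictly_stationary P y)
  (A2b_mix : alpha P y k @[k --> \oo] --> (0 : R))
  (gamma : R) (gamma_gt0 : 0 < gamma)
  (A2b_sum : (\sum_(1 <= k <oo)
     (alpha P y k `^ (gamma / (4 + gamma)))%:E < +oo)%E)
  (A2c_wS0 : forall (i : 'I_p) (t : int),
     ('E_P[fun w => (`|dotv (wrow W i) (Sigma P y 0 *m y t w)| `^ (4 + gamma))%R]
       < +oo)%E)
  (A2c_wS1 : forall (i : 'I_p) (t : int),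
     ('E_P[fun w => (`|dotv (wrow W i) (Sigma P y 1 *m y t w)| `^ (4 + gamma))%R]
       < +oo)%E)
  (A2c_eS0 : forall (i : 'I_p) (t : int),
     ('E_P[fun w => (`|dotv (unitv i) (Sigma P y 0 *m y t w)| `^ (4 + gamma))%R]
       < +oo)%E)
  (A2c_w : forall (i : 'I_p) (t : int),
     ('E_P[fun w => (`|dotv (wrow W i) (y t w)| `^ (4 + gamma))%R] < +oo)%E)
  (A2c_e : forall (i : 'I_p) (t : int),
     ('E_P[fun w => (`|dotv (unitv i) (y t w)| `^ (4 + gamma))%R] < +oo)%E)
  (A2c_V : forall (i : 'I_p) (c : 'I_3), (Vdiag P y W i c < +oo)%E)
  (A3 : forall i : 'I_p, \rank (Xmx P y W i) = 3%N) :
  forall i : 'I_p,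
  exists mu : probability (borelM R 3 1) R,
    is_mvnormal mu 0
      (invmx (Vmx P y W i) *m Umx P y W eps i *m invmx (Vmx P y W i)) /\
    cvg_in_distribution P
      (fun (n : nat) (w : T) =>
         Num.sqrt n%:R *: (lambda_hat y W i n w
                           - col3 (lam0 0 i) (lam1 0 i) (lam2 0 i)))
      mu.
Proof.
move=> i; exact: (estimator_clt y_meas eps_meas y_mean0 model A2a A2b_stat gamma_gt0 A2b_sum A2c_e (A3 _)).
Qed.
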